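(* For all sufficiently small $h>0$ there exists $\rho_0>0$ such that for every $\rho\in(0,\rho_0]$ there exists $\epsilon_0>0$ (depending on $h$ and $\rho$) such that for every $0<\epsilon\le\epsilon_0$ the following holds. The problem: find $u_{\epsilon,h}\in V_h$ with $u_{\epsilon,h}=g_h$ on $\partial\Omega$ and $$\epsilon\int_\Omega\Delta u_{\epsilon,h}\,\Delta v_h\,dx-\int_\Omega(\det D^2u_{\epsilon,h})\,v_h\,dx=-\int_\Omega f v_h\,dx+\epsilon^3\int_{\partial\Omega}\frac{\partial v_h}{\partial n}\,ds\qquad\text{for all }v_h\in V_h\cap H_0^1(\Omega)$$ has a unique solution in $B_\rho(u_h)$, and for every $u_h^0\in B_\rho(u_h)$ with $u_h^0=g_h$ on $\partial\Omega$ the whole sequence $(u_h^k)_{k\ge0}$ defined by $u_h^{k+1}\in V_h$, $u_h^{k+1}=g_h$ on $\partial\Omega$ and $$\epsilon\int_\Omega \Delta u_h^{k+1}\,\Delta v_h\,dx+\int_\Omega[(\operatorname{cof}D^2u_h^k)Du_h^{k+1}]\cdot Dv_h\,dx=-\int_\Omega f v_h\,dx+\epsilon^3\int_{\partial\Omega}\frac{\partial v_h}{\partial n}\,ds+\frac{n-1}{n}\int_\Omega[(\operatorname{cof}D^2u_h^k)Du_h^k]\cdot Dv_h\,dx$$ for all $v_h\in V_h\cap H_0^1(\Omega)$ converges, as $k\to\infty$, to this solution.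
   Context: Setting. $n\in\{2,3\}$; $\Omega\subset\mathbb{R}^n$ is a bounded convex domain with polygonal (polyhedral) boundary $\partial\Omega$; the symbol $n$ in $\partial/\partial n$ denotes the unit outward normal to $\partial\Omega$. $f\in L^1(\Omega)$ satisfies $f\ge c_0>0$ for a constant $c_0$, and $g$ is a given function on $\partial\Omega$ having a smooth extension. $Dv$ is the gradient, $D^2v$ the Hessian, $\operatorname{cof}A$ the matrix of cofactors of $A$; $\|\cdot\|_{k,p}$ is the norm of $W^{k,p}(\Omega)$ and $\|\cdot\|_k=\|\cdot\|_{k,2}$ the norm of $H^k(\Omega)$. Approximation spaces. For each mesh parameter $h>0$, $V_h$ is a finite dimensional space of $C^1$ functions on $\Omega$ that are piecewise polynomials of degree $d\ge2$ on a mesh $\mathcal{T}_h$ of $\Omega$; second derivatives of functions in $V_h$ are taken element by element (equivalently, almost everywhere). It is assumed that, with constants $C$ independent of $h$ (norms of order exceeding the global regularity being taken elementwise): (i) there is an interpolation operator $I_h$ mapping $W^{l+1,p}(\Omega)$ into $V_h$ for $1\le p\le\infty$, $0\le l\le d$, with $\|v-I_hv\|_{k,p}\le Ch^{l+1-k}\|v\|_{l+1,p}$ for $0\le k\le l$; (ii) the inverse estimates $\|v\|_{s,p}\le Ch^{l-s+\min(0,\frac np-\frac nq)}\|v\|_{l,q}$ hold for all $v\in V_h$, $0\le l\le s$, $1\le p,q\le\infty$. $g_h\in V_h$ is the interpolant $I_h$ of a smooth extension of $g$. Discrete Monge–Ampère problem. It is assumed that for each $h$ the problem: find $u_h\in V_h$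 with $u_h=g_h$ on $\partial\Omega$ and $$\int_\Omega v_h\det D^2u_h\,dx=\int_\Omega f v_h\,dx\quad\text{for all }v_h\in V_h\cap H_0^1(\Omega)$$ has a strictly convex solution $u_h$, with $0<2C_0\le\lambda_1(D^2u_h)\le\lambda_n(D^2u_h)\le C_4$ for constants $C_0,C_4$ independent of $h$, where $\lambda_1$ and $\lambda_n$ denote the smallest and largest eigenvalues. This solution $u_h$ is fixed throughout. For $\rho>0$, $B_\rho(u_h)=\{v_h\in V_h:\|v_h-u_h\|_1\le\rho\}$. Since $V_h$ is finite dimensional, convergence in $V_h$ is with respect to any norm. *)

(* Defs.v *)
From HB Require Import structures.
From mathcomp Require Import all_boot all_order all_algebra.
From mathcomp Require Import all_classical all_reals all_analysis.

Set Implicit Arguments.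
Unset Strict Implicit.
Unset Printing Implicit Defensive.

Import Order.TTheory GRing.Theory Num.Theory.
Import numFieldNormedType.Exports.

Local Open Scope classical_set_scope.
Local Open Scope ring_scope.

(* Lebesgue measure on R^n, vectors being row vectors: the sigma-algebra on
   'rV[R]_n is generated by the coordinates, and vol R n is the n-fold product
   of the Lebesgue measure of R along rV_cons : R x R^n -> R^(n+1). *)

Definition rV_display : measure_display.
Proof. exact. Qed.

Section rV_measurable.
Variables (R : realType) (n : nat).

Let coor (i : 'I_n) (x : 'rV[R]_n) : R := x ord0 i.

Let rV_measurable0 : g_sigma_preimage coor set0.
Proof. exact: sigma_algebra0. Qed.

Let rV_measurableC A : g_sigma_preimage coor A -> g_sigma_preimage coor (~` A).
Proof. exact: sigma_algebraC. Qed.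

Let rV_measurable_bigcup (F : _^nat) : (forall i, g_sigma_preimage coor (F i)) ->
  g_sigma_preimage coor (\bigcup_i (F i)).
Proof. exact: sigma_algebra_bigcup. Qed.

HB.instance Definition _ := @isMeasurable.Build rV_display 'rV[R]_n
  (g_sigma_preimage coor) rV_measurable0 rV_measurableC rV_measurable_bigcup.

Lemma measurable_coor (i : 'I_n) :
  measurable_fun [set: 'rV[R]_n] (fun x : 'rV[R]_n => x ord0 i).
Proof.
move=> _ Y mY; rewrite setTI; apply: sub_sigma_algebra => /=.
rewrite -bigcup_seq/=; exists i => /=; first by rewrite mem_index_enum.
by exists Y => //; rewrite setTI.
Qed.

Lemma measurable_fun_rVP d (T : measurableType d) (f : T -> 'rV[R]_n) :
  (forall i, measurable_fun [set: T] (fun t => f t ord0 i)) ->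
  measurable_fun [set: T] f.
Proof.
move=> mf; move=> _ A mA; rewrite setTI.
have : preimage_set_system setT f (g_sigma_preimage coor) (f @^-1` A).
  by exists A => //; rewrite setTI.
rewrite -g_sigma_preimage_comp; move: (f @^-1` A).
apply: smallest_sub; first exact: sigma_algebra_measurable.
elim/big_ind : _ => //=.
- by move=> X Y mX mY; rewrite subUset; split.
- by move=> i _ _ [B mB <-]; exact: mf.
Qed.

End rV_measurable.

Section rV_cons.
Variables (R : realType) (n : nat).

Definition rV_cons (p : measurableTypeR R * 'rV[R]_n) : 'rV[R]_n.+1 := row_mx p.1%:M p.2.

Lemma measurable_rV_cons : measurable_fun setT rV_cons.
Proof.
apply: measurable_fun_rVP => i; rewrite /rV_cons.
have [j|j] := split_ordP (i : 'I_(1 + n)) => ->.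
- rewrite (_ : (fun _ => _) = fst) //.
  apply/funext => p; transitivity ((scalar_mx p.1 : 'M[R]_1) ord0 j).
    exact: row_mxEl.
  by rewrite mxE !ord1 eqxx mulr1n.
- rewrite (_ : (fun _ => _) = (fun x : 'rV[R]_n => x ord0 j) \o snd); last first.
    by apply/funext => p; exact: row_mxEr.
  apply: measurableT_comp => //; exact: measurable_coor.
Qed.

Definition rV_uncons (x : 'rV[R]_n.+1) : measurableTypeR R * 'rV[R]_n :=
  (x ord0 ord0, rsubmx (x : 'rV[R]_(1 + n))).

Lemma rV_consK : cancel rV_cons rV_uncons.
Proof.
case=> a x; rewrite /rV_uncons /rV_cons row_mxKr; congr pair.
transitivity (row_mx (scalar_mx a : 'M[R]_1) x ord0 (lshift n ord0)).
  by congr (row_mx _ _ _ _); exact: val_inj.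
by transitivity ((scalar_mx a : 'M[R]_1) ord0 ord0); [exact: row_mxEl|rewrite mxE !ord1 eqxx mulr1n].
Qed.

Lemma measurable_rV_uncons : measurable_fun setT rV_uncons.
Proof.
apply: measurable_fun_pair; first exact: measurable_coor.
apply: measurable_fun_rVP => i.
rewrite (_ : (fun _ => _) = fun t : 'rV[R]_n.+1 => t ord0 (rshift 1 i)).
  exact: measurable_coor.
by apply/funext => x; rewrite mxE.
Qed.

Variable m : {sigma_finite_measure set 'rV[R]_n -> \bar R}.
Local Open Scope ereal_scope.

Definition vol_step (A : set 'rV[R]_n.+1) : \bar R :=
  (lebesgue_measure \x m) (rV_cons @^-1` A).

Let vol_step0 : vol_step set0 = 0.
Proof. by rewrite /vol_step preimage_set0 measure0. Qed.

Let vol_step_ge0 A : 0 <= vol_step A.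
Proof. exact: measure_ge0. Qed.

Let vol_step_sigma_additive : semi_sigma_additive vol_step.
Proof.
move=> F mF tF mUF; rewrite /vol_step preimage_bigcup.
apply: measure_semi_sigma_additive.
- by move=> k; rewrite -[X in measurable X]setTI; exact: measurable_rV_cons.
- apply/trivIsetP => /= i j _ _ ij; rewrite -preimage_setI.
  by move/trivIsetP : tF => /(_ _ _ _ _ ij) ->//; rewrite preimage_set0.
- by rewrite -preimage_bigcup -[X in measurable X]setTI; exact: measurable_rV_cons.
Qed.

HB.instance Definition _ := isMeasure.Build _ _ _ vol_step
  vol_step0 vol_step_ge0 vol_step_sigma_additive.

Let vol_step_sigma_finite : sigma_finite setT vol_step.
Proof.
have /sigma_finiteP[F [FT ndF mF]] := sigma_finiteT (@lebesgue_measure R).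
have /sigma_finiteP[G [GT ndG mG]] := sigma_finiteT m.
exists (fun k => rV_uncons @^-1` (F k `*` G k)).
  rewrite -preimage_bigcup (_ : \bigcup_k _ = setT) ?preimage_setT//.
  apply/seteqP; split => // -[x y] _.
  have [i _ Fi] : (\bigcup_k F k) x by rewrite -FT.
  have [j _ Gj] : (\bigcup_k G k) y by rewrite -GT.
  exists (maxn i j) => //; split => /=.
  - by move: x Fi; exact/subsetPset/ndF/leq_maxl.
  - by move: y Gj; exact/subsetPset/ndG/leq_maxr.
move=> k; have [mFk Fkoo] := mF k; have [mGk Gkoo] := mG k; split.
  rewrite -[X in measurable X]setTI; apply: measurable_rV_uncons => //.
  exact: measurableX.
rewrite /vol_step (_ : _ @^-1` _ = F k `*` G k).
  by rewrite product_measure1E// lte_mul_pinfty// ge0_fin_numE.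
by apply/seteqP; split => x; rewrite /preimage /mkset rV_consK.
Qed.

HB.instance Definition _ :=
  Measure_isSigmaFinite.Build _ _ _ vol_step vol_step_sigma_finite.

Definition vol_succ : {sigma_finite_measure set 'rV[R]_n.+1 -> \bar R} := vol_step.

End rV_cons.

Fixpoint vol (R : realType) (n : nat) :
    {sigma_finite_measure set 'rV[R]_n -> \bar R} :=
  if n is n'.+1 then vol_succ (vol R n') else dirac (0 : 'rV[R]_0).

Section calculus.
Variables (R : realType) (n : nat).
Local Notation E := 'rV[R]_n.
Implicit Types (x y nu : E) (v w phi : E -> R) (D U : set E).

Definition dot x y : R := \sum_(i < n) x ord0 i * y ord0 i.

Definition partial (i : 'I_n) v : E -> R := 'D_(delta_mx ord0 i) v.

Definition grad v x : E := \row_i partial i v x.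

Definition cof (A : 'M[R]_n) : 'M[R]_n := \matrix_(i, j) cofactor A i j.

Section elementwise.
Variables (N : nat) (T : 'I_N -> set E).

(* Hessian taken element by element on a mesh with open elements T, and set to 0
   on the interelement boundaries, a null set. *)
Definition hess v x : 'M[R]_n :=
  if `[< exists j, T j x >] then \matrix_(i, j) partial i (partial j v) x else 0.

Definition lap v x : R := \tr (hess v x).

(* ((cof D^2 u) D w) . D v; vectors are rows, whence the transpose. *)
Definition cof_form (u w v : E -> R) x : R :=
  dot (grad w x *m (cof (hess u x))^T) (grad v x).

End elementwise.

Definition dpart (s : seq 'I_n) v : E -> R := foldr partial v s.

Definition smooth v : Prop := forall s x, differentiable (dpart s v) x.

Definition test D phi : Prop :=
  [/\ smooth phi, compact (closure [set x | phi x != 0]) &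
      closure [set x | phi x != 0] `<=` D].

Definition mindex (k : nat) (a : {ffun 'I_n -> 'I_k.+1}) : 'I_n -> nat :=
  fun i => a i.

Definition mdeg (a : 'I_n -> nat) : nat := \sum_(i < n) a i.

Definition mpartial (a : 'I_n -> nat) v : E -> R :=
  dpart (flatten [seq nseq (a i) i | i <- enum 'I_n]) v.

Definition locint D v : Prop :=
  measurable_fun D v /\
  forall K : set E, compact K -> K `<=` D -> (vol R n).-integrable K (EFin \o v).

Definition is_wderiv D (a : 'I_n -> nat) v w : Prop :=
  [/\ locint D v, locint D w & forall phi, test D phi ->
    \int[vol R n]_(x in D) (v x * mpartial a phi x) =
    (-1) ^+ mdeg a * \int[vol R n]_(x in D) (w x * phi x)].

(* Weak derivatives are unique up to null sets, hence the norms below do not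
   depend on the representative chosen here: the classical derivative when it
   is a weak derivative, an arbitrary weak derivative otherwise. *)
Definition wderiv D (a : 'I_n -> nat) v : E -> R :=
  if `[< is_wderiv D a v (mpartial a v) >] then mpartial a v
  else get (is_wderiv D a v).

(* The W^{k,p} norm taken element by element on a finite family T of open sets,
   for 1 <= p <= +oo. *)
Definition bnorm (I : finType) (T : I -> set E) (k : nat) (p : \bar R) v
    : \bar R :=
  if p == +oo%E then
    (\big[maxe/0]_(j : I)
      \big[maxe/0]_(a : {ffun 'I_n -> 'I_k.+1} | (mdeg (mindex a) <= k)%N)
        'N[vol R n]_p[(EFin \o wderiv (T j) (mindex a) v) \_ (T j)])%E
  else
    ((\sum_(j : I) \sum_(a : {ffun 'I_n -> 'I_k.+1} | (mdeg (mindex a) <= k)%N)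
        'N[vol R n]_p[(EFin \o wderiv (T j) (mindex a) v) \_ (T j)] `^ (fine p))
     `^ (fine p)^-1)%E.

Definition snorm D (k : nat) (p : \bar R) v : \bar R :=
  bnorm (fun _ : unit => D) k p v.

Definition Sobolev D (k : nat) (p : \bar R) v : Prop :=
  (forall a : 'I_n -> nat, (mdeg a <= k)%N -> exists w, is_wderiv D a v w) /\
  (snorm D k p v < +oo)%E.

(* H^1_0: closure of the test functions in H^1 *)
Definition H10 D v : Prop :=
  Sobolev D 1 2%:E v /\
  forall e : R, 0 < e -> exists2 phi, test D phi & (snorm D 1 2%:E (v - phi)%R < e%:E)%E.

(* v = w on the boundary of D, for H^1 functions, in the sense of traces *)
Definition eq_bnd D v w : Prop := H10 D (v - w).

End calculus.

Section geometry.
Variables (R : realType) (n : nat).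
Local Notation E := 'rV[R]_n.
Implicit Types (D : set E) (v : E -> R).

Definition halfspaces (m : nat) (nu : 'I_m -> E) (b : 'I_m -> R) : set E :=
  [set x | forall i, dot (nu i) x < b i].

Definition polytope D : Prop :=
  [/\ D !=set0, bounded_set D &
      exists m (nu : 'I_m -> E) (b : 'I_m -> R), D = halfspaces nu b].

(* D is a bounded convex domain with polyhedral boundary: a bounded nonempty
   intersection of finitely many open half-spaces, given by pairwise distinct
   pairs (unit outward normal, offset), so that distinct indices have faces
   that overlap only in a null set of the boundary. *)
Record polyhedral_domain D (m : nat) (nu : 'I_m -> E) (b : 'I_m -> R) : Prop := {
  pd_halfspaces : D = halfspaces nu b ;
  pd_nonempty : D !=set0 ;
  pd_bounded : bounded_set D ;
  pd_unit : forall i, dot (nu i) (nu i) = 1 ;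
  pd_distinct : injective (fun i => (nu i, b i)) }.

Definition hproj (nu : E) (b : R) (x : E) : E := x - (dot nu x - b) *: nu.

(* Integral over the face of D lying in the hyperplane {nu . x = b}, |nu| = 1.
   The surface measure of a subset of this hyperplane is the volume of the right
   prism of height 1 erected on it. *)
Definition face_int D (nu : E) (b : R) (phi : E -> R) : R :=
  \int[vol R n]_(x in [set x | 0 < dot nu x - b < 1 /\
                                closure D (hproj nu b x)]) phi (hproj nu b x).

(* outward normal derivative at a boundary point: trace of the gradient from D *)
Definition nderiv D (nu : E) v (y : E) : R :=
  lim ((fun z => dot (grad v z) nu) @ within D (nbhs y)).

Definition flux D (m : nat) (nu : 'I_m -> E) (b : 'I_m -> R) v : R :=
  \sum_(i < m) face_int D (nu i) (b i) (nderiv D (nu i) v).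

Definition strictly_convex D v : Prop :=
  forall (x y : E) (t : R), D x -> D y -> x != y -> 0 < t < 1 ->
    v (t *: x + (1 - t) *: y) < t * v x + (1 - t) * v y.

(* the elements are open polytopes *)
Definition mesh D (N : nat) (T : 'I_N -> set E) : Prop :=
  [/\ forall j, polytope (T j), trivIset setT T &
      closure D = \bigcup_j closure (T j)].

Definition polyfun (d : nat) (p : E -> R) : Prop :=
  exists c : {ffun 'I_n -> 'I_d.+1} -> R,
    p = fun x => \sum_(a : {ffun 'I_n -> 'I_d.+1} | (mdeg (mindex a) <= d)%N)
                   c a * \prod_(i < n) x ord0 i ^+ a i.

(* C^1 functions on D, up to the boundary: v and its gradient extend continuously
   to the closure of D. *)
Definition C1 D v : Prop :=
  [/\ forall x, D x -> differentiable v x,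
      forall i x, D x -> {for x, continuous (partial i v)},
      forall y, closure D y -> cvg (v @ within D (nbhs y)) &
      forall i y, closure D y -> cvg (partial i v @ within D (nbhs y))].

Definition finite_dim (V : set (E -> R)) : Prop :=
  exists (N : nat) (e : 'I_N -> E -> R),
    V = [set v | exists c : 'I_N -> R, v = \sum_(i < N) c i *: e i].

(* A function on D is represented by its extension by zero outside D. *)
Definition fe_space D (d N : nat) (T : 'I_N -> set E) (V : set (E -> R)) : Prop :=
  finite_dim V /\
  forall v, V v ->
    [/\ C1 D v,
        forall j, exists2 p, polyfun d p & forall x, T j x -> v x = p x &
        forall x, ~ D x -> v x = 0].

Definition norm_on (V : set (E -> R)) (N : (E -> R) -> R) : Prop :=
  [/\ forall v, V v -> 0 <= N v,
      forall v, V v -> N v = 0 -> v = 0,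
      forall (a : R) v, V v -> N (a *: v) = `|a| * N v &
      forall v w, V v -> V w -> N (v + w) <= N v + N w].

Definition cvg_in (V : set (E -> R)) (us : nat -> E -> R) (u : E -> R) : Prop :=
  forall N, norm_on V N -> (fun k => N (us k - u)) @ \oo --> 0.

Definition ball_in (V : set (E -> R)) D (uh : E -> R) (rho : R) : set (E -> R) :=
  [set v | V v /\ (snorm D 1 2%:E (v - uh)%R <= rho%:E)%E].

End geometry.

Section approximation.
Variables (R : realType) (n : nat).
Local Notation E := 'rV[R]_n.
Variables (D : set E) (H : set R) (N : R -> nat) (T : forall h, 'I_(N h) -> set E).
Variable V : R -> set (E -> R).
Arguments T h _ : clear implicits.

Definition interpolation (d : nat) (Ih : R -> (E -> R) -> (E -> R)) : Prop :=
  (forall h (l : nat) (p : \bar R) v, H h -> (l <= d)%N -> (1 <= p)%E ->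
     Sobolev D l.+1 p v ->
     V h (Ih h v) /\ forall w, ae_eq (vol R n) D v w -> Ih h w = Ih h v) /\
  (forall (l k : nat) (p : \bar R), (l <= d)%N -> (k <= l)%N -> (1 <= p)%E ->
     exists C : R, forall h v, H h -> Sobolev D l.+1 p v ->
       (bnorm (T h) k p (v - Ih h v)%R <=
          (C * h ^+ (l.+1 - k))%R%:E * snorm D l.+1 p v)%E).

(* (fine p)^-1 is 1/p, including 1/+oo = 0. *)
Definition inverse_estimates : Prop :=
  forall (l s : nat) (p q : \bar R), (l <= s)%N -> (1 <= p)%E -> (1 <= q)%E ->
    exists C : R, forall h v, H h -> V h v ->
      (bnorm (T h) s p v <=
        (C * h `^ (l%:R - s%:R + Num.min 0 (n%:R / fine p - n%:R / fine q)))%R%:E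
          * bnorm (T h) l q v)%E.

End approximation.

Section problems.
Variables (R : realType) (n : nat).
Local Notation E := 'rV[R]_n.
Variables (D : set E) (m : nat) (nu : 'I_m -> E) (b : 'I_m -> R).
Variables (f : E -> R) (N : nat) (T : 'I_N -> set E).
Variables (V : set (E -> R)) (gh : E -> R).
Implicit Types u v w : E -> R.

Local Notation integ := (Rintegral (vol R n) D).

Definition MA_solution u : Prop :=
  [/\ V u, eq_bnd D u gh & forall v, V v -> H10 D v ->
    integ (fun x => v x * \det (hess T u x)) = integ (fun x => f x * v x)].

Definition regularized_solution (eps : R) u : Prop :=
  [/\ V u, eq_bnd D u gh & forall v, V v -> H10 D v ->
    eps * integ (fun x => lap T u x * lap T v x)
      - integ (fun x => \det (hess T u x) * v x) =
    - integ (fun x => f x * v x) + eps ^+ 3 * flux D nu b v].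

Definition next_iterate (eps : R) u w : Prop :=
  [/\ V w, eq_bnd D w gh & forall v, V v -> H10 D v ->
    eps * integ (fun x => lap T w x * lap T v x)
      + integ (fun x => cof_form T u w v x) =
    - integ (fun x => f x * v x) + eps ^+ 3 * flux D nu b v
      + (n%:R - 1) / n%:R * integ (fun x => cof_form T u u v x)].

End problems.

(* Main.v *)
(* Testing the cofactor form against v in V_h meet H^1_0 and integrating by parts
   (the columns of cof D^2 u are divergence free, u being C^1 and piecewise
   polynomial) gives int (cof D^2u Dw).Dv = - int (cof D^2u : D^2w) v. Hence the
   derivative of -int (det D^2u) v in the direction w is int (cof D^2u Dw).Dv, and,
   as cof D^2u : D^2u = n det D^2u, the given iteration is Newton's method, in
   coordinates on the finite dimensional affine space u_h + (V_h meet H^1_0), for the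
   residual of the regularized problem. At u_h the derivative for eps = 0 is
   invertible, because cof D^2 u_h is positive definite with D^2 u_h; the residual is
   polynomial in the coordinates and O(eps) at u_h. Newton's method thus
   converges from a ball whose radius does not depend on eps, to a zero at distance
   O(eps) from u_h which is the only one in the ball. *)

Require Import Defs.
From HB Require Import structures.
From mathcomp Require Import all_boot all_order all_algebra.
From mathcomp Require Import all_classical all_reals all_analysis.
From mathcomp Require Import perm measurable_realfun ring lra.

Set Implicit Arguments.
Unset Strict Implicit.
Unset Printing Implicit Defensive.

Import Order.TTheory GRing.Theory Num.Theory.
Import numFieldNormedType.Exports.

Local Open Scope classical_set_scope.
Local Open Scope ring_scope.

(** * Lebesgue measure on row vectors *)


(** The obstacle is regularity: D^2 u jumps between elements, so nothing can be differentiated a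
    third time, and no divergence theorem on the elements is invoked. The only source of integration
    by parts is translation invariance of Lebesgue measure: Lipschitz functions have bounded
    difference quotients, these converge off a null set, and dominated convergence does the rest.
    Zero boundary values are exploited through density: a first order functional with bounded
    coefficients that vanishes on test functions vanishes on H^1_0. This yields both the integration
    by parts against v and the fact that a constant in H^1_0 is 0, with no trace theorem.
    Invertibility is qualitative: injectivity of a square matrix at eps = 0, then perturbation, with
    constants uniform for eps in [0, 1] but allowed to depend on h. The ball of the statement is
    measured in H^1 while Newton's method runs in the maximum norm of coordinates, so the two norms
    are compared in both directions: one direction fixes rho0, the other makes eps0 depend on rho,
    because the zero must lie in the given ball. *)

Lemma lebesgue_measure_shift (R : realType) (c : R) (A : set (measurableTypeR R)) :
  measurable A -> lebesgue_measure ((fun x => x + c) @^-1` A) = lebesgue_measure A.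
Proof.
move=> mA.
have ms : measurable_fun setT (fun x : measurableTypeR R => x + c : measurableTypeR R).
  by apply: measurable_funD => //; exact: measurable_id.
pose phi : {mfun _ >-> _} := HB.pack (fun x : measurableTypeR R => x + c : measurableTypeR R)
  (isMeasurableFun.Build _ _ _ _ _ ms).
suff <- : pushforward lebesgue_measure phi A = lebesgue_measure A by [].
(* Half-open intervals determine the measure, so only these are compared. *)
apply/esym; apply: (@lebesgue_measure_unique R (pushforward lebesgue_measure phi)) => // X.
case=> -[a b] /= _ <-.
rewrite /pushforward.
rewrite (_ : _ @^-1` _ = (`]a - c, b - c]%classic : set (measurableTypeR R))); last first.
  by apply/seteqP; split => x /=; rewrite !in_itv/= ltrBlDr lerBrDr.
rewrite !lebesgue_measure_itv /= !lte_fin ltrD2r.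
by case: ifP => // _; rewrite -!EFinB; congr (_%:E); lra.
Qed.

Section vol_facts.
Variable R : realType.
Implicit Types n : nat.

Lemma volS n (A : set 'rV[R]_n.+1) :
  vol R n.+1 A = (\int[lebesgue_measure]_a vol R n [set y | A (rV_cons (a, y))])%E.
Proof.
rewrite /= /vol_step /product_measure1; apply: eq_integral => a _ /=.
by congr (vol R n _); apply/seteqP; split => y /=; rewrite /xsection/= ?inE.
Qed.

Let pre_cons n (A : set 'rV[R]_n.+1) : measurable A ->
  measurable (@rV_cons R n @^-1` A).
Proof. by move=> mA; rewrite -[X in measurable X]setTI; exact: measurable_rV_cons. Qed.

Let sliceE n (A : set 'rV[R]_n.+1) (a : R) :
  [set y | A (rV_cons (a, y))] = xsection (@rV_cons R n @^-1` A) a.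
Proof. by apply/seteqP; split => y /=; rewrite /xsection/= ?inE. Qed.

Lemma measurable_slice n (A : set 'rV[R]_n.+1) (a : R) : measurable A ->
  measurable [set y | A (rV_cons (a, y))].
Proof. by move=> mA; rewrite sliceE; apply: measurable_xsection; exact: pre_cons. Qed.

Lemma measurable_shift n (y : 'rV[R]_n) : measurable_fun setT (fun x : 'rV[R]_n => x + y).
Proof.
apply: measurable_fun_rVP => i.
rewrite (_ : (fun _ => _) = fun x : 'rV[R]_n => x ord0 i + y ord0 i).
  by apply: measurable_funD => //; exact: measurable_coor.
by apply/funext => x; rewrite mxE.
Qed.

Lemma rV_consE0 n (p : R * 'rV[R]_n) : rV_cons p ord0 ord0 = p.1.
Proof. by have := congr1 fst (rV_consK p). Qed.

Lemma rV_consES n (p : R * 'rV[R]_n) i : rV_cons p ord0 (lift ord0 i) = p.2 ord0 i.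
Proof.
have /(congr1 snd)/rowP/(_ i) := rV_consK p.
by rewrite mxE => <-; congr (rV_cons _ _ _); exact/val_inj.
Qed.

Definition rtail n (x : 'rV[R]_n.+1) : 'rV[R]_n := \row_i x ord0 (lift ord0 i).

Lemma rV_consP n (x : 'rV[R]_n.+1) : x = rV_cons (x ord0 ord0, rtail x).
Proof.
apply/rowP => i; have [j ->|->] := unliftP ord0 i.
  by rewrite rV_consES mxE.
by rewrite rV_consE0.
Qed.

Lemma rV_cons_shift n (y : 'rV[R]_n.+1) (p : R * 'rV[R]_n) :
  rV_cons p + y = rV_cons (p.1 + y ord0 ord0, p.2 + rtail y).
Proof.
apply/rowP => i; rewrite [LHS]mxE; have [j ->|->] := unliftP ord0 i.
  by rewrite !rV_consES /= !mxE.
by rewrite !rV_consE0.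
Qed.

(** Induction on the dimension by slicing: the tail of y shifts each slice, and the first coordinate
    of y shifts the variable of the outer integral. *)
Lemma vol_shift n (y : 'rV[R]_n) (A : set 'rV[R]_n) : measurable A ->
  vol R n ((fun x => x + y) @^-1` A) = vol R n A.
Proof.
elim: n y A => [|n IH] y A mA.
  by congr (vol R 0 _); apply/seteqP; split => x /=; rewrite (thinmx0 y) addr0.
rewrite !volS.
pose s (a : measurableTypeR R) : measurableTypeR R := a + y ord0 ord0.
pose F (a : measurableTypeR R) := vol R n [set z | A (rV_cons (a, z))].
transitivity (\int[lebesgue_measure]_a (F \o s) a)%E.
  apply: eq_integral => a _ /=.
  rewrite -[RHS](IH (rtail y)); last exact: measurable_slice.
  by congr (vol R n _); apply/seteqP; split => z /=; rewrite rV_cons_shift.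
have ms : measurable_fun setT s.
  by apply: measurable_funD => //; exact: measurable_id.
rewrite -[LHS](@ge0_integral_pushforward _ _ _ _ _ s ms _ setT F) //.
- apply: eq_measure_integral => B mB _; exact: lebesgue_measure_shift.
- rewrite (_ : F = vol R n \o xsection (@rV_cons R n @^-1` A)).
    exact: measurable_fun_xsection (pre_cons mA).
  by apply/funext => a; rewrite /F sliceE.
Qed.

Lemma ball_rVE n (x y : 'rV[R]_n) (r : R) : 0 < r ->
  ball x r y <-> forall i, `|x ord0 i - y ord0 i| < r.
Proof.
move=> r0; split=> [[_ h] i|h]; first exact: h.
by split=> // i j; rewrite (ord1 i); exact: h.
Qed.

Lemma measurable_coor_lt n (i : 'I_n) (c r : R) :
  measurable [set x : 'rV[R]_n | `|c - x ord0 i| < r].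
Proof.
rewrite (_ : [set _ | _] = (fun x : 'rV[R]_n => x ord0 i) @^-1` `]c - r, c + r[).
  by rewrite -[X in measurable X]setTI; apply: measurable_coor => //; exact: measurable_itv.
by apply/seteqP; split => x /=; rewrite in_itv/= ltr_norml; move=> /andP[? ?]; apply/andP; split; lra.
Qed.

Lemma measurable_ball_rV n (x : 'rV[R]_n) (r : R) : measurable (ball x r).
Proof.
have [r0|r0] := ltP 0 r; last first.
  rewrite (_ : ball x r = set0) //; apply/seteqP; split => // y [].
  by rewrite ltNge r0.
rewrite (_ : ball x r = \bigcap_(i in [set: 'I_n]) [set y | `|x ord0 i - y ord0 i| < r]).
  apply: fin_bigcap_measurable => //.
  by move=> i _; exact: measurable_coor_lt.
apply/seteqP; split => y; first by move/(ball_rVE _ _ r0) => h i _; exact: h.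
by move=> h; apply/(ball_rVE _ _ r0) => i; exact: h.
Qed.

(** The norm of row vectors is the maximum norm, so a ball is a cube: an interval times a ball of
    one dimension less. *)
Lemma vol_ball n (x : 'rV[R]_n) (r : R) : 0 < r ->
  vol R n (ball x r) = ((r *+ 2) ^+ n)%:E.
Proof.
move=> r0; elim: n x => [|n IH] x.
  rewrite expr0 /= diracE mem_set//; apply/(ball_rVE _ _ r0) => -[]//.
rewrite /= /vol_step (_ : _ @^-1` _ =
   (`](x ord0 ord0) - r, (x ord0 ord0) + r[%classic : set (measurableTypeR R)) `*`
   ball (rtail x) r).
  rewrite product_measure1E //; last exact: measurable_ball_rV.
  rewrite [X in (X * _)%E](_ : _ = (r *+ 2)%:E); last first.
    rewrite [LHS]lebesgue_measure_itv /= lte_fin ifT; last lra.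
    by rewrite -EFinB mulr2n; congr (_%:E); lra.
  by rewrite [X in (_ * X)%E]IH -EFinM exprS.
apply/seteqP; split => -[a z] /=.
  move/(ball_rVE _ _ r0) => h; split.
    have := h ord0; rewrite rV_consE0 /= in_itv /= ltr_norml.
    by move=> /andP[? ?]; apply/andP; split; lra.
  apply/(ball_rVE _ _ r0) => i.
  by have := h (lift ord0 i); rewrite rV_consES mxE.
rewrite in_itv /= => -[/andP[? ?]] /(ball_rVE _ _ r0) h.
apply/(ball_rVE _ _ r0) => i; have [j ->|->] := unliftP ord0 i.
  by rewrite rV_consES; have := h j; rewrite mxE.
by rewrite rV_consE0 /= ltr_norml; apply/andP; split; lra.
Qed.

(** The sigma-algebra is generated by the coordinates, not by the topology; an open set is the
    countable union of the balls with rational centre and radius 1/(k+1) that it contains. *)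
Lemma open_measurable_rV n (U : set 'rV[R]_n) : open U -> measurable U.
Proof.
move=> oU.
pose q2r (q : 'rV[rat]_n) : 'rV[R]_n := map_mx ratr q.
pose F (k : 'rV[rat]_n * nat) := 
  if `[< ball (q2r k.1) k.2.+1%:R^-1 `<=` U >] then ball (q2r k.1) k.2.+1%:R^-1 else set0.
rewrite (_ : U = \bigcup_k F k).
  apply: countable_bigcupT_measurable.
    exact: countableP.
  by move=> k; rewrite /F; case: ifP => _ //; exact: measurable_ball_rV.
apply/seteqP; split => x; last first.
  by move=> [k _]; rewrite /F; case: ifPn => [/asboolP|//]; apply.
move=> Ux; have /nbhs_ballP[e /= e0 he] : nbhs x U by exact: open_nbhs_nbhs.
(* The radius 1/(k+1) is below e / 2, so such a ball around a rational point that close to x stays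
   within e of x. *)
pose k := Num.truncn (2 / e).
have ke : k.+1%:R^-1 < e / 2.
  rewrite -[e / 2]invrK ltf_pV2 ?posrE ?invr_gt0 ?divr_gt0 // invf_div.
  by have := truncnS_gt (2 / e).
have k0 : 0 < k.+1%:R^-1 :> R by rewrite invr_gt0.
have hq i : exists q : rat, `|ratr q - x ord0 i| < k.+1%:R^-1.
  have [|q hq] := @rat_in_itvoo R (x ord0 i - k.+1%:R^-1) (x ord0 i + k.+1%:R^-1).
    by rewrite ltrD2l gtrN.
  exists q; move: hq k0; set t := _^-1; rewrite in_itv /= => /andP[? ?] t0.
  by rewrite ltr_norml; apply/andP; split; lra.
pose q : 'rV[rat]_n := \row_i sval (cid (hq i)).
exists (q, k) => //; rewrite /F /= asboolT.
  by apply/(ball_rVE _ _ k0) => i; rewrite !mxE; case: cid.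
move=> y /(ball_rVE _ _ k0) hy; apply: he; apply/(ball_rVE _ _ e0) => i.
have := hy i; rewrite !mxE; case: cid => /= r hr hri.
have -> : x ord0 i - y ord0 i = - (ratr r - x ord0 i) + (ratr r - y ord0 i) by lra.
apply: le_lt_trans (ler_normD _ _) _; rewrite normrN.
by move: ke hr hri; set t := _^-1 => ke hr hri; lra.
Qed.

Lemma continuous_measurable_rV n (f : 'rV[R]_n -> R) (D : set 'rV[R]_n) :
  open D -> (forall x, D x -> {for x, continuous f}) -> measurable_fun D f.
Proof.
move=> oD cf; apply: (measurability _ (RGenOInfty.measurableE R)).
move=> _ -[_ [a ->] <-]; apply: open_measurable_rV.
rewrite openE => x [Dx /= fx]; apply: filterI; first exact: open_nbhs_nbhs.
apply: (cf x Dx); apply: open_nbhs_nbhs; split; [|exact: fx].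
by rewrite set_itvE; exact: open_gt.
Qed.

Lemma dot_cons n (nu : 'rV[R]_n.+1) (p : R * 'rV[R]_n) :
  dot nu (rV_cons p) = nu ord0 ord0 * p.1 + dot (rtail nu) p.2.
Proof.
rewrite /dot big_ord_recl rV_consE0; congr (_ + _).
by apply: eq_bigr => i _; rewrite rV_consES mxE.
Qed.

Lemma measurable_dot n (nu : 'rV[R]_n) : measurable_fun setT (dot nu).
Proof.
rewrite /dot; apply: measurable_sum => i.
by apply: measurable_funM => //; exact: measurable_coor.
Qed.

Lemma measurable_hyperplane n (nu : 'rV[R]_n) (b : R) : measurable [set x | dot nu x = b].
Proof.
rewrite (_ : [set _ | _] = dot nu @^-1` [set b]) //.
by rewrite -[X in measurable X]setTI; apply: measurable_dot.
Qed.

(** If the normal has a nonzero tail, every slice is a hyperplane of lower dimension; otherwise the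
    set is a point of the first axis times the whole space. This makes interelement boundaries null
    sets. *)
Lemma vol_hyperplane n (nu : 'rV[R]_n) (b : R) : nu != 0 ->
  vol R n [set x | dot nu x = b] = 0%E.
Proof.
elim: n nu b => [|n IH] nu b nu0.
  by move: nu0; rewrite (thinmx0 nu) eqxx.
have [t0|t0] := eqVneq (rtail nu) 0; last first.
  rewrite volS (eq_integral (cst 0%E)) ?integral0// => a _ /=.
  rewrite -[RHS](IH (rtail nu) (b - nu ord0 ord0 * a) t0).
  congr (vol R n _); apply/seteqP; split => y /=; rewrite dot_cons /= => h; lra.
have c0 : nu ord0 ord0 != 0.
  apply: contra_neq nu0 => c0; rewrite (rV_consP nu) t0 c0.
  apply/rowP => i; have [j ->|->] := unliftP ord0 i; rewrite ?rV_consES ?rV_consE0 !mxE//.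
rewrite /= /vol_step (_ : _ @^-1` _ = [set b / nu ord0 ord0] `*` setT).
  rewrite product_measure1E // [X in (X * _)%E](_ : _ = 0%E) ?mul0e//.
  exact: lebesgue_measure_set1.
have d0 (z : 'rV[R]_n) : dot (rtail nu) z = 0.
  by rewrite t0 /dot big1 // => i _; rewrite mxE mul0r.
apply/seteqP; split => -[a z] /=; rewrite dot_cons /= d0 addr0.
  by move=> <-; split => //; field.
by case=> -> _; field.
Qed.

End vol_facts.

(** * Integrals of bounded measurable functions *)


Section bounded_measurable.
Variables (R : realType) (n : nat).
Local Notation E := 'rV[R]_n.
Local Notation mu := (vol R n).

(** A class stable under sums and products and integrable on sets of finite measure: integrability
    of most integrands below follows from their shape. *)
Definition bmf (D : set E) (f : E -> R) : Prop :=
  measurable_fun D f /\ exists M : R, forall x, D x -> `|f x| <= M.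

Section calculus_rules.
Variable D : set E.
Implicit Types f g : E -> R.

Lemma bmf_eq f g : (forall x, D x -> f x = g x) -> bmf D f -> bmf D g.
Proof.
move=> fg [mf [M hM]]; split.
  by apply: eq_measurable_fun mf => x; rewrite inE => /fg.
by exists M => x Dx; rewrite -fg //; exact: hM.
Qed.

Lemma bmf_cst c : bmf D (fun=> c).
Proof. by split; [exact: measurable_cst|exists `|c|]. Qed.

Lemma bmfD f g : bmf D f -> bmf D g -> bmf D (fun x => f x + g x).
Proof.
move=> [mf [M hM]] [mg [P hP]]; split; first exact: measurable_funD.
by exists (M + P) => x Dx; apply: le_trans (ler_normD _ _) _; apply: lerD; [exact: hM|exact: hP].
Qed.

Lemma bmfM f g : bmf D f -> bmf D g -> bmf D (fun x => f x * g x).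
Proof.
move=> [mf [M hM]] [mg [P hP]]; split; first exact: measurable_funM.
by exists (M * P) => x Dx; rewrite normrM; apply: ler_pM => //; [exact: hM|exact: hP].
Qed.

Lemma bmfZ c f : bmf D f -> bmf D (fun x => c * f x).
Proof. by move=> h; apply: bmfM => //; exact: bmf_cst. Qed.

Lemma bmfN f : bmf D f -> bmf D (fun x => - f x).
Proof. by move=> /(bmfZ (-1)); apply: bmf_eq => x _; rewrite mulN1r. Qed.

Lemma bmfB f g : bmf D f -> bmf D g -> bmf D (fun x => f x - g x).
Proof. by move=> hf hg; apply: bmfD => //; exact: bmfN. Qed.

Lemma bmf_norm f : bmf D f -> bmf D (fun x => `|f x|).
Proof.
move=> [mf [M hM]]; split; first exact: measurableT_comp.
by exists M => x Dx; rewrite normr_id; exact: hM.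
Qed.

Lemma bmf_sum (I : Type) (s : seq I) (P : pred I) (F : I -> E -> R) :
  (forall i, P i -> bmf D (F i)) -> bmf D (fun x => \sum_(i <- s | P i) F i x).
Proof.
move=> h; elim: s => [|i s IH].
  by apply: bmf_eq (bmf_cst 0) => x _; rewrite big_nil.
have [Pi|Pi] := boolP (P i).
  by apply: bmf_eq (bmfD (h i Pi) IH) => x _; rewrite big_cons Pi.
by apply: bmf_eq IH => x _; rewrite big_cons (negbTE Pi).
Qed.

Lemma bmf_prod (I : Type) (s : seq I) (P : pred I) (F : I -> E -> R) :
  (forall i, P i -> bmf D (F i)) -> bmf D (fun x => \prod_(i <- s | P i) F i x).
Proof.
move=> h; elim: s => [|i s IH].
  by apply: bmf_eq (bmf_cst 1) => x _; rewrite big_nil.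
have [Pi|Pi] := boolP (P i).
  by apply: bmf_eq (bmfM (h i Pi) IH) => x _; rewrite big_cons Pi.
by apply: bmf_eq IH => x _; rewrite big_cons (negbTE Pi).
Qed.

End calculus_rules.

Lemma bmfS (D D' : set E) f : measurable D -> D' `<=` D -> bmf D f -> bmf D' f.
Proof.
move=> mD DD' [mf [M hM]]; split; first exact: measurable_funS mf.
by exists M => x /DD'; exact: hM.
Qed.

Lemma bmf_patch (D : set E) f : measurable D -> bmf D f ->
  bmf setT (fun x => if `[< D x >] then f x else 0).
Proof.
move=> mD [mf [M hM]]; split.
  rewrite (_ : (fun _ => _) = f \_ D).
    by apply/(measurable_restrictT f mD).
  apply/funext => x; rewrite /restrict /patch.
  have [/asboolP h|/asboolPn h] := boolP `[< D x >].
    by rewrite mem_set.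
  by rewrite memNset.
exists `|M| => x _; case: ifPn => [/asboolP /hM h|_]; last by rewrite normr0.
exact: le_trans h (ler_norm _).
Qed.

Section on_finite_set.
Variable D : set E.
Hypotheses (mD : measurable D) (fD : (mu D < +oo)%E).
Implicit Types f g : E -> R.
Local Notation integ := (Rintegral mu D).

Lemma bmf_integrable f : bmf D f -> mu.-integrable D (EFin \o f).
Proof.
move=> [mf [M hM]]; apply: measurable_bounded_integrable => //.
exists M; split; rewrite ?num_real // => x Mx y Dy /=.
exact: le_trans (hM _ Dy) (ltW Mx).
Qed.

Lemma integ_eq f g : (forall x, D x -> f x = g x) -> integ f = integ g.
Proof. by move=> fg; apply: eq_Rintegral => x; rewrite inE => /fg. Qed.

Lemma integD f g : bmf D f -> bmf D g -> integ (fun x => f x + g x) = integ f + integ g.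
Proof. by move=> hf hg; rewrite RintegralD //; exact: bmf_integrable. Qed.

Lemma integB f g : bmf D f -> bmf D g -> integ (fun x => f x - g x) = integ f - integ g.
Proof. by move=> hf hg; rewrite RintegralB //; exact: bmf_integrable. Qed.

Lemma integZ c f : bmf D f -> integ (fun x => c * f x) = c * integ f.
Proof. by move=> hf; rewrite RintegralZl //; exact: bmf_integrable. Qed.

Lemma integ0 : integ (fun=> 0) = 0.
Proof. by rewrite Rintegral_cst // mul0r. Qed.

Lemma integ_sum (I : Type) (s : seq I) (P : pred I) (F : I -> E -> R) :
  (forall i, P i -> bmf D (F i)) ->
  integ (fun x => \sum_(i <- s | P i) F i x) = \sum_(i <- s | P i) integ (F i).
Proof.
move=> h; elim: s => [|i s IH].
  by rewrite big_nil; transitivity (integ (fun=> 0)); [apply: integ_eq => x _; rewrite big_nil|exact: integ0].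
rewrite big_cons; have [Pi|Pi] := boolP (P i).
  rewrite -IH -integD //; [|exact: h|exact: bmf_sum].
  by apply: integ_eq => x _; rewrite big_cons Pi.
by rewrite -IH; apply: integ_eq => x _; rewrite big_cons (negbTE Pi).
Qed.

Lemma integ_le f g : bmf D f -> bmf D g -> (forall x, D x -> f x <= g x) -> integ f <= integ g.
Proof. by move=> hf hg fg; apply: le_Rintegral => //; exact: bmf_integrable. Qed.

Lemma integ_abs_le f g : bmf D f -> bmf D g -> (forall x, D x -> `|f x| <= g x) ->
  `|integ f| <= integ g.
Proof.
move=> hf hg fg; apply: le_trans (le_normr_Rintegral _ _) _ => //; first exact: bmf_integrable.
by apply: integ_le => //; exact: bmf_norm.
Qed.

Lemma integ_bound f M : bmf D f -> (forall x, D x -> `|f x| <= M) ->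
  `|integ f| <= M * fine (mu D).
Proof.
move=> hf fM; rewrite -(Rintegral_cst mu mD M); apply: integ_abs_le => //; exact: bmf_cst.
Qed.

(** Dominated convergence with a constant majorant, available because D has finite measure. *)
Lemma integ_lim_eq0 (F : nat -> E -> R) g M :
  bmf D g -> (forall k, bmf D (F k)) -> (forall k x, D x -> `|F k x| <= M) ->
  {ae mu, forall x, D x -> F ^~ x @ \oo --> g x} ->
  (forall k, integ (F k) = 0) -> integ g = 0.
Proof.
move=> hg hF hM cv F0.
have [|||||ig _ h] := @dominated_convergence _ _ _ mu D mD (fun k => EFin \o F k) (EFin \o g)
  (EFin \o cst M).
- by move=> k; apply/measurable_EFinP; have [] := hF k.
- by apply/measurable_EFinP; have [] := hg.
- by apply: filterS cv => x h Dx; apply: cvg_EFin; [exact: nearW|exact: h].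
- by apply: bmf_integrable; exact: bmf_cst.
- by apply: aeW => x k Dx; rewrite /= lee_fin; exact: hM.
have h0 : (fun k => \int[mu]_(x in D) (EFin \o F k) x)%E = cst 0%E.
  apply/funext => k; rewrite -[LHS]fineK; last exact/integrable_fin_num/bmf_integrable.
  by congr (_%:E); exact: F0.
move: h; rewrite h0 => h.
have := cvg_unique _ h (cvg_cst 0%E).
by rewrite /Rintegral => -> //.
Qed.

(** A positive value at x would persist, up to a factor 1/2, on a ball of positive volume.
    Continuity is asked on U only, as it will hold inside one element and not on all of D. *)
Lemma integ_eq0_open f (U : set E) : bmf D f -> (forall x, D x -> 0 <= f x) ->
  open U -> U `<=` D -> (forall x, U x -> {for x, continuous f}) ->
  integ f = 0 -> forall x, U x -> f x = 0.
Proof.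
move=> hf f0 oU UD cf If x Ux; apply/eqP; rewrite eq_le f0 ?andbT; last exact: UD.
rewrite leNgt; apply/negP => fx.
have : nbhs x (U `&` [set y | f x / 2 < f y]).
  apply: filterI; first exact: open_nbhs_nbhs.
  have := cf _ Ux; move/cvgr_gt; apply; lra.
move=> /nbhs_ballP[e /= e0 he].
have mB : measurable (ball x e) by exact: measurable_ball_rV.
have BD : ball x e `<=` D by move=> y /he[/UD].
have h1 : bmf D (\1_(ball x e)).
  split; first exact: measurable_indic.
  by exists 1 => y _; rewrite indicE; case: (_ \in _); rewrite ?normr1 ?normr0.
have : integ (fun y => f x / 2 * \1_(ball x e) y) <= integ f.
  apply: integ_le => //; first exact: bmfZ.
  move=> y Dy; rewrite indicE; have [|] := boolP (y \in (ball x e : set E)).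
    by rewrite inE mulr1 => /he[_ /ltW].
  by rewrite mulr0 => _; exact: f0.
rewrite If integZ // /Rintegral integral_indic // setIidl //.
rewrite [X in fine X](vol_ball x e0) /= leNgt => /negP; apply; apply: mulr_gt0; first lra.
by apply: exprn_gt0; lra.
Qed.

End on_finite_set.

Lemma integ_subset (D D' : set E) f : measurable D -> D `<=` D' ->
  (forall x, D' x -> ~ D x -> f x = 0) -> Rintegral mu D' f = Rintegral mu D f.
Proof.
move=> mD DD' f0; rewrite Rintegral_mkcond [RHS]Rintegral_mkcond; congr Rintegral.
apply/funext => x; rewrite /patch; have [|/negP] := boolP (x \in D).
  by rewrite inE => /DD' h; rewrite mem_set.
by rewrite inE => h; case: ifPn => //; rewrite inE => /f0; apply.
Qed.

Lemma integrable_shift f (y : E) : mu.-integrable setT (EFin \o f) ->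
  mu.-integrable setT (EFin \o (fun x => f (x + y))) /\
  Rintegral mu setT (fun x => f (x + y)) = Rintegral mu setT f.
Proof.
move=> hf; have ms := @measurable_shift R n y.
pose phi : {mfun _ >-> _} := HB.pack (fun x : E => x + y)
  (isMeasurableFun.Build _ _ _ _ _ ms).
have e A : measurable A -> A `<=` setT -> pushforward mu phi A = mu A.
  by move=> mA _; exact: vol_shift.
have mEf : measurable_fun setT (EFin \o f) by have /integrableP[] := hf.
have hp : mu.-integrable setT ((EFin \o f) \o phi).
  apply/integrableP; split; first exact: measurableT_comp.
  have /integrableP[_] := hf; apply: le_lt_trans.
  have := @ge0_integral_pushforward _ _ _ _ _ phi ms mu setT
    (fun x => `|(EFin \o f) x|)%E measurableT.
  have mA : measurable_fun setT (fun x => `|(EFin \o f) x|)%E by exact: measurableT_comp.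
  move=> /(_ mA (fun _ _ => abse_ge0 _)).
  have <- : (\int[pushforward mu phi]_y `|(EFin \o f) y| = \int[mu]_y `|(EFin \o f) y|)%E.
    by apply: eq_measure_integral => A mA' _; exact: e.
  by move=> ->.
split => //.
rewrite /Rintegral; congr fine.
have := @integral_pushforward _ _ _ _ _ phi ms mu setT (EFin \o f) mEf hp measurableT.
have -> : (\int[pushforward mu phi]_y (EFin \o f) y = \int[mu]_y (EFin \o f) y)%E.
  by apply: eq_measure_integral => A mA' _; exact: e.
by move=> ->.
Qed.

Lemma bmf_shift f (y : E) : bmf setT f -> bmf setT (fun x => f (x + y)).
Proof.
move=> [mf [M hM]]; split; last by exists M => x _; exact: hM.
exact: (measurableT_comp mf (measurable_shift y)).
Qed.

(** W is integrable on the whole space since it is bounded and lives on a set of finite measure;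
    translation invariance then gives the zero integral on which every integration by parts below
    rests. *)
Lemma integ_shift_sub (D : set E) (W : E -> R) (y : E) : measurable D -> (mu D < +oo)%E ->
  bmf setT W -> (forall x, ~ D x -> W x = 0) ->
  mu.-integrable setT (EFin \o (fun x => W (x + y) - W x)) /\
  Rintegral mu setT (fun x => W (x + y) - W x) = 0.
Proof.
move=> mD fD hW W0.
have iW : mu.-integrable setT (EFin \o W).
  have : mu.-integrable D (EFin \o W) by apply: bmf_integrable => //; exact: bmfS hW.
  move/(integrable_mkcond _ mD); rewrite (_ : _ \_ D = EFin \o W) //.
  apply/funext => x; rewrite /patch; case: ifPn => // /negP; rewrite inE => h.
  by rewrite /= W0.
have [iWy e] := integrable_shift y iW.
split; last by rewrite RintegralB // e subrr.
rewrite (_ : _ \o _ = (fun x : E => (W (x + y)%R)%:E - (W x)%:E)%E).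
  exact: integrableB.
by apply/funext => x; rewrite /= EFinB.
Qed.

End bounded_measurable.

(** * Differential calculus on row vectors *)


Section calculus_rV.
Variables (R : realType) (n : nat).
Local Notation E := 'rV[R]_n.
Local Notation mu := (vol R n).
Implicit Types (f g : E -> R) (x y v w : E).

(** A sequential form of the directional derivative, suited to dominated convergence along a
    sequence of steps. *)
Lemma cvg_quotient f x v (t : nat -> R) : (forall k, t k != 0) -> t @ \oo --> 0 ->
  differentiable f x ->
  (fun k => (t k)^-1 * (f (x + t k *: v) - f x)) @ \oo --> 'D_v f x.
Proof.
move=> t0 tl df.
have tl' : t @ \oo --> 0^'.
  move=> A [e /= e0 he].
  have h : \forall k \near \oo, ball (0 : R) e (t k) by apply: tl; exact: nbhsx_ballx.
  by apply: filterS h => k /= hk; exact: he.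
have dv : derivable f x v by exact: diff_derivable.
have := cvg_comp _ _ tl' dv; rewrite /derive.
apply: cvg_trans; apply: near_eq_cvg; apply: nearW => k /=.
by rewrite [t k *: v + x]addrC.
Qed.

Lemma deriveDv f x v w : differentiable f x -> 'D_(v + w) f x = 'D_v f x + 'D_w f x.
Proof. by move=> df; rewrite !deriveE // linearD. Qed.

(** The base point moves with the step. The quotient is the difference of the quotients at the fixed
    point x in the directions w + v and w, so differentiability at x suffices and no continuity of
    the derivative is required. *)
Lemma cvg_quotient2 f x v w (t : nat -> R) : (forall k, t k != 0) -> t @ \oo --> 0 ->
  differentiable f x ->
  (fun k => (t k)^-1 * (f (x + t k *: w + t k *: v) - f (x + t k *: w))) @ \oo --> 'D_v f x.
Proof.
move=> t0 tl df.
have h : (fun k => (t k)^-1 * (f (x + t k *: (w + v)) - f x) -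
    (t k)^-1 * (f (x + t k *: w) - f x)) @ \oo --> 'D_(w + v) f x - 'D_w f x.
  by apply: cvgB; exact: cvg_quotient.
move: h; rewrite deriveDv // [X in _ --> X](_ : _ = 'D_v f x); last ring.
apply: cvg_trans; apply: near_eq_cvg; apply: nearW => k /=.
rewrite -mulrBr; congr (_ * _); rewrite scalerDr addrA; ring.
Qed.

Lemma derive_partial f x v : differentiable f x ->
  'D_v f x = \sum_i v ord0 i * partial i f x.
Proof.
move=> df; rewrite deriveE // {1}(row_sum_delta v) linear_sum /=.
by apply: eq_bigr => i _; rewrite linearZ /= /partial deriveE.
Qed.

Lemma partialD i f g x : differentiable f x -> differentiable g x ->
  partial i (f + g) x = partial i f x + partial i g x.
Proof. by move=> df dg; rewrite /partial deriveD //; exact: diff_derivable. Qed.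

Lemma partialB i f g x : differentiable f x -> differentiable g x ->
  partial i (f - g) x = partial i f x - partial i g x.
Proof. by move=> df dg; rewrite /partial deriveB //; exact: diff_derivable. Qed.

Lemma partialZ i (c : R) f x : differentiable f x ->
  partial i (c *: f) x = c * partial i f x.
Proof. by move=> df; rewrite /partial deriveZ //; exact: diff_derivable. Qed.

Lemma partialM i f g x : differentiable f x -> differentiable g x ->
  partial i (f * g) x = f x * partial i g x + g x * partial i f x.
Proof. by move=> df dg; rewrite /partial deriveM //; exact: diff_derivable. Qed.

Lemma partial_near i f g x : {near x, f =1 g} -> partial i f x = partial i g x.
Proof. by move=> h; rewrite /partial; apply: near_eq_derive. Qed.

Lemma open_near_eq (U : set E) f g x : open U -> U x -> (forall y, U y -> f y = g y) ->
  {near x, f =1 g}.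
Proof. by move=> oU Ux h; have : nbhs x U by [exact: open_nbhs_nbhs]; apply: filterS. Qed.

Lemma near_differentiable f g x : {near x, f =1 g} -> differentiable f x -> differentiable g x.
Proof.
move=> fg df.
have fgx : f x = g x by exact: (nbhs_singleton fg).
have [cd _] := (diff_locallyP x f).1 df.
have h3 : \forall h \near (0 : E), f (h + x) = g (h + x).
  by move: fg; rewrite (near_shift (0 : E)) subr0 => fg; exact: filterS fg.
have key (eps : R) : 0 < eps ->
  \forall h \near (0 : E), `|(g \o shift x - (cst (g x) + 'd f x)) h| <= eps * `|h|.
  move=> e0; have /eqaddoP/(_ _ e0) h1 := diff_locally df.
  near=> h.
  have <- : (f \o shift x - (cst (f x) + 'd f x)) h = (g \o shift x - (cst (g x) + 'd f x)) h.
    by rewrite !fctE /= -fgx; congr (_ - _); near: h.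
  by near: h.
have e : 'd g x = 'd f x :> (E -> R).
  by apply: (@diff_unique _ _ _ g ('d f x) x cd); apply/eqaddoP => eps; exact: key.
apply/diff_locallyP; rewrite e; split => //.
by apply/eqaddoP => eps; exact: key.
Unshelve. all: by end_near. Qed.

(** The margin tells how small a step must be for paths that meet a compact support to stay in the
    domain. *)
Lemma compact_margin (K U : set E) : compact K -> open U -> K `<=` U ->
  exists2 d : R, 0 < d & forall x y, K x -> `|x - y| < d -> U y.
Proof.
move=> /compact_near_coveringP cK oU KU.
have : \forall d \near 0^'+, K `<=` (fun x => forall y, `|x - y| < d -> U y).
  apply: (cK _ (0^'+) (fun d x => forall y, `|x - y| < d -> U y)) => x /KU Ux.
  have /nbhs_ballP[e /= e0 he] : nbhs x U by exact: open_nbhs_nbhs.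
  exists (ball x (e / 2), [set d : R | d < e / 2]) => /=.
    split; first by apply: nbhsx_ballx; lra.
    by apply: nbhs_right_lt; lra.
  move=> [z d] /= [hz hd] y hy; apply: he.
  rewrite mx_norm_ball /ball_ /= in hz *.
  have -> : x - y = (x - z) + (z - y) by rewrite addrA subrK.
  apply: le_lt_trans (ler_normD _ _) _; lra.
move=> h; near (0:R)^'+ => d; exists d => // x y Kx.
by move: x Kx y; near: d.
Unshelve. all: by end_near. Qed.

Lemma le_coord_norm (x : E) i : `|x ord0 i| <= `|x|.
Proof.
rewrite [X in _ <= X](_ : _ = mx_norm x) // mx_normrE.
by rewrite (le_trans _ (le_bigmax _ _ (ord0, i))).
Qed.

End calculus_rV.

(** * Lipschitz functions on a set *)

Section lipschitz.
Variables (R : realType) (n : nat).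
Local Notation E := 'rV[R]_n.
Variable D : set E.
Implicit Types (f g : E -> R).

(** A Lipschitz bound controls all difference quotients at once; it supplies the majorant for
    dominated convergence. *)
Definition lipD f : Prop :=
  exists2 L : R, 0 <= L & forall x y, D x -> D y -> `|f x - f y| <= L * `|x - y|.

Lemma lipD_eq f g : (forall x, D x -> f x = g x) -> lipD f -> lipD g.
Proof. by move=> fg [L L0 h]; exists L => // x y Dx Dy; rewrite -!fg //; exact: h. Qed.

Lemma lipD_cst c : lipD (fun=> c).
Proof. by exists 0 => // x y _ _; rewrite subrr normr0 mul0r. Qed.

Lemma lipD_coor i : lipD (fun x => x ord0 i).
Proof.
exists 1 => // x y _ _; rewrite mul1r.
have -> : x ord0 i - y ord0 i = (x - y) ord0 i by rewrite !mxE.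
exact: le_coord_norm.
Qed.

Lemma lipDD f g : lipD f -> lipD g -> lipD (fun x => f x + g x).
Proof.
move=> [L L0 hf] [M M0 hg]; exists (L + M); first exact: addr_ge0.
move=> x y Dx Dy; rewrite opprD addrACA mulrDl; apply: le_trans (ler_normD _ _) _.
by apply: lerD; [exact: hf|exact: hg].
Qed.

Lemma lipDM f g : (exists B, forall x, D x -> `|f x| <= B) ->
  (exists B, forall x, D x -> `|g x| <= B) ->
  lipD f -> lipD g -> lipD (fun x => f x * g x).
Proof.
move=> [B hB] [C hC] [L L0 hf] [M M0 hg]; exists (`|B| * M + `|C| * L).
  by apply: addr_ge0; apply: mulr_ge0.
move=> x y Dx Dy.
have -> : f x * g x - f y * g y = f x * (g x - g y) + g y * (f x - f y) by ring.
apply: le_trans (ler_normD _ _) _; rewrite !normrM mulrDl -!mulrA.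
apply: lerD; apply: ler_pM => //.
- exact: le_trans (hB _ Dx) (ler_norm _).
- exact: hg.
- exact: le_trans (hC _ Dy) (ler_norm _).
- exact: hf.
Qed.

Lemma lipDZ c f : lipD f -> lipD (fun x => c * f x).
Proof.
move=> [L L0 h]; exists (`|c| * L); first exact: mulr_ge0.
by move=> x y Dx Dy; rewrite -mulrBr normrM -mulrA; apply: ler_wpM2l => //; exact: h.
Qed.

Lemma lipD_bounded f : bounded_set D -> lipD f -> exists B, forall x, D x -> `|f x| <= B.
Proof.
move=> [r [_ hr]] [L L0 h].
have [[x0 D0]|D0] := pselect (D !=set0); last by exists 0 => x Dx; case: D0; exists x.
have hb x : D x -> `|x| <= r + 1 by apply: hr; rewrite ltrDl.
exists (`|f x0| + L * (`|r + 1| + `|r + 1|)) => x Dx.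
have -> : f x = f x0 + (f x - f x0) by ring.
apply: le_trans (ler_normD _ _) _; apply: lerD => //.
apply: le_trans (h _ _ Dx D0) _; apply: ler_wpM2l => //.
by apply: le_trans (ler_normB _ _) _; apply: lerD; apply: le_trans (hb _ _) (ler_norm _).
Qed.

Lemma lipD_continuous f x : open D -> lipD f -> D x -> {for x, continuous f}.
Proof.
move=> oD [L L0 h] Dx; apply/(@cvgrPdist_lt R R _ (nbhs x) (nbhs_filter x)) => e e0.
have L1 : 0 < L + 1 by lra.
near=> y.
have Dy : D y by near: y; exact: open_nbhs_nbhs.
apply: le_lt_trans (h _ _ Dx Dy) _.
have hy : `|x - y| < e / (L + 1).
  by near: y; apply: cvgr_dist_lt => //; rewrite divr_gt0.
apply: (@le_lt_trans _ _ ((L + 1) * `|x - y|)); first by apply: ler_wpM2r => //; lra.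
by rewrite mulrC -ltr_pdivlMr.
Unshelve. all: by end_near. Qed.

Lemma lipD_bmf f : open D -> bounded_set D -> lipD f -> bmf D f.
Proof.
move=> oD bD hf; split; last exact: lipD_bounded.
by apply: continuous_measurable_rV => // x Dx; exact: lipD_continuous.
Qed.

End lipschitz.

Section bounded_sets.
Variables (R : realType) (n : nat).
Local Notation E := 'rV[R]_n.

Lemma bounded_vol (D : set E) : measurable D -> bounded_set D -> (vol R n D < +oo)%E.
Proof.
move=> mD [r [_ hr]].
have r0 : 0 < `|r| + 2 by apply: ltr_pwDr.
apply: (@le_lt_trans _ _ (vol R n (ball (0 : E) (`|r| + 2)))); last by rewrite vol_ball ?ltry.
apply: le_measure; rewrite ?inE //; first exact: measurable_ball_rV.
move=> x Dx; rewrite mx_norm_ball /ball_ /= sub0r normrN.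
apply: (@le_lt_trans _ _ (`|r| + 1)); last by rewrite ltrD2l; lra.
by apply: hr => //; rewrite (le_lt_trans (ler_norm _)) // ltrDl.
Qed.

End bounded_sets.

(** * Null Lagrangians *)


Section null_lagrangian.
Variables (R : realType) (n : nat).
Local Notation E := 'rV[R]_n.
Local Notation mu := (vol R n).
Variable D : set E.
Hypotheses (oD : open D) (bD : bounded_set D).

Let mD : measurable D. Proof. exact: open_measurable_rV. Qed.
Let fD : (mu D < +oo)%E. Proof. exact: bounded_vol. Qed.

(** The integral is over the whole space, where translations cause no boundary terms; integrability
    is recorded because that space has infinite measure. *)
Definition null_integral (F : E -> R) : Prop :=
  mu.-integrable setT (EFin \o F) /\ Rintegral mu setT F = 0.

Lemma null_integralD F G : null_integral F -> null_integral G ->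
  null_integral (fun x => F x + G x).
Proof.
move=> [iF F0] [iG G0]; split; last by rewrite RintegralD // F0 G0 addr0.
by rewrite (_ : _ \o _ = (fun x => (F x)%:E + (G x)%:E)%E) //; exact: integrableD.
Qed.

Lemma null_integralZ c F : null_integral F -> null_integral (fun x => c * F x).
Proof.
move=> [iF F0]; split; last by rewrite RintegralZl // F0 mulr0.
by rewrite (_ : _ \o _ = (fun x => c%:E * (F x)%:E)%E) //; exact: integrableZl.
Qed.

Lemma null_integral_shift W (y : E) : bmf setT W -> (forall x, ~ D x -> W x = 0) ->
  null_integral (fun x => W (x + y) - W x).
Proof. by move=> hW W0; exact: (integ_shift_sub y mD fD). Qed.

Lemma null_integral_lim (F : nat -> E -> R) g M :
  bmf D g -> (forall k, null_integral (F k)) -> (forall k, measurable_fun setT (F k)) ->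
  (forall k x, ~ D x -> F k x = 0) ->
  (forall k x, D x -> `|F k x| <= M) ->
  {ae mu, forall x, D x -> F ^~ x @ \oo --> g x} ->
  Rintegral mu D g = 0.
Proof.
move=> hg nF mF F0 FM cv; apply: (integ_lim_eq0 mD fD hg _ FM cv).
  move=> k; split; first exact: measurable_funS (mF k).
  by exists M => x; exact: FM.
move=> k; have [_ <-] := nF k; apply/esym; apply: integ_subset => // x _; exact: F0.
Qed.

Variables (K : set E) (zeta : E -> R).
Hypotheses (cK : compact K) (KD : K `<=` D).
Hypotheses (zetaK : forall x, ~ K x -> zeta x = 0) (mzeta : bmf setT zeta).
Hypothesis lzeta : lipD D zeta.

Let dq (t : R) (f : E -> R) (v x : E) := t^-1 * (f (x + t *: v) - f x).

Let zetaD x : ~ D x -> zeta x = 0.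
Proof. by move=> nD; apply: zetaK => /KD. Qed.

(* A null Lagrangian is an alternating sum of products of derivatives with zero
   integral. No second derivatives are available, so each product is replaced by
   the product of difference quotients taken along a path x, x + t a,
   x + t a + t b: the alternating sum of these is exactly a sum of differences
   W (x + t e) - W x, which integrate to 0 by translation invariance. A small
   step keeps the paths that meet the support [K] of zeta inside [D]. *)
Let small (t B : R) := 0 < t /\ forall x y, K x -> `|x - y| <= t * B *+ 3 -> D y.

Let exists_small (B : R) : 0 <= B ->
  exists t : nat -> R, [/\ forall k, t k != 0, t @ \oo --> 0 & forall k, small (t k) B].
Proof.
move=> B0; have [d d0 hd] := compact_margin cK oD KD.
(* Three steps of length at most c * B stay below d = 4 c (B + 1); the added 1 keeps the denominator
   positive when B = 0. *)
pose c := d / ((B + 1) *+ 4).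
have c0 : 0 < c by rewrite divr_gt0 // pmulrn_lgt0 //; lra.
exists (fun k => c * k.+1%:R^-1); split.
- by move=> k; rewrite mulf_neq0 ?gt_eqF // invr_gt0.
- by rewrite -[X in _ --> X](mulr0 c); apply: cvgM; [exact: cvg_cst|exact: cvg_harmonic].
- move=> k; split; first by rewrite mulr_gt0 // invr_gt0.
  move=> x y Kx hxy; apply: hd Kx _; apply: le_lt_trans hxy _.
  have k1 : k.+1%:R^-1 <= 1 :> R by rewrite invf_le1 // ler1n.
  have h1 : c * k.+1%:R^-1 * B <= c * B.
    by apply: ler_wpM2r => //; rewrite ler_piMr // ltW.
  have h2 : c * ((B + 1) *+ 4) = d.
    by rewrite /c divfK // gt_eqF // pmulrn_lgt0 //; lra.
  have cB : 0 <= c * B by rewrite mulr_ge0 // ltW.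
  move: h2 h1; rewrite mulrnAr mulrDr mulr1; move: cB.
  set z := c * B; set w := _ * B => ? h2 ?.
  by lra.
Qed.

Let lip_dq f L B t x v : 0 <= L -> (forall x y, D x -> D y -> `|f x - f y| <= L * `|x - y|) ->
  0 < t -> `|v| <= B -> D x -> D (x + t *: v) -> `|dq t f v x| <= L * B.
Proof.
move=> L0 hf t0 vB Dx Dy; rewrite /dq normrM gtr0_norm ?invr_gt0 //.
rewrite ler_pdivrMl //; apply: le_trans (hf _ _ Dy Dx) _.
rewrite addrAC subrr add0r normrZ gtr0_norm // mulrCA.
by rewrite ler_pM2l // ler_wpM2l.
Qed.

(** If the quotient of zeta is nonzero, then x or x + t v lies in K, and every point of the path is
    within three steps of that point, hence in D. *)
Let dq_support B t x v w1 w2 : small t B -> `|v| <= B -> `|w1| <= B -> `|w2| <= B ->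
  dq t zeta v x != 0 ->
  [/\ D x, D (x + t *: v), D (x + t *: v + t *: w1) & D (x + t *: v + t *: w1 + t *: w2)].
Proof.
move=> [t0 st] vB wB1 wB2 dz.
have B0 : 0 <= B by apply: le_trans vB.
have [z Kz hz] : exists2 z, K z & z = x \/ z = x + t *: v.
  apply: contrapT => nz; move: dz; rewrite /dq !zetaK ?subrr ?mulr0 ?eqxx //.
    by move=> Kx; apply: nz; exists x => //; left.
  by move=> Kx; apply: nz; exists (x + t *: v) => //; right.
have tB (v' : E) : `|v'| <= B -> `|t *: v'| <= t * B.
  by move=> h; rewrite normrZ gtr0_norm // ler_pM2l.
have tB0 : 0 <= t * B by rewrite mulr_ge0 // ltW.
have st' y w : K z -> z = y + w -> `|w| <= t * B *+ 3 -> D y.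
  by move=> _ zy hw; apply: st Kz _; rewrite zy addrAC subrr add0r.
have h1 := tB _ vB; have h2 := tB _ wB1; have h3 := tB _ wB2.
have e3 : t * B *+ 3 = t * B + t * B + t * B by rewrite !mulrS mulr0n addr0 addrA.
case: hz => ez; split.
- by rewrite -ez; exact: KD.
- by apply: (st' _ (- (t *: v))) => //; rewrite ?addrK // normrN e3; lra.
- apply: (st' _ (- (t *: v + t *: w1))) => //; first by rewrite -[X in X - _]addrA addrK.
  by rewrite normrN e3; apply: le_trans (ler_normD _ _) _; lra.
- apply: (st' _ (- (t *: v + t *: w1 + t *: w2))) => //; first by rewrite -[X in _ - X]addrA -2![X in X - _]addrA addrK.
  rewrite normrN e3; apply: le_trans (ler_normD _ _) _; apply: lerD => //.
  by apply: le_trans (ler_normD _ _) _; apply: lerD.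
- by apply: (st' _ (t *: v)) => //; rewrite e3; lra.
- by rewrite -ez; exact: KD.
- by apply: (st' _ (- (t *: w1))) => //; rewrite ?addrK // normrN e3; lra.
- apply: (st' _ (- (t *: w1 + t *: w2))) => //; first by rewrite -[X in X - _]addrA addrK.
  by rewrite normrN e3; apply: le_trans (ler_normD _ _) _; lra.
Qed.

(** With a single factor the difference quotient is already a difference of translates. *)
Lemma null_lagrangian1 (e1 : E) g : bmf D g ->
  {ae mu, forall x, D x -> differentiable zeta x /\ g x = 'D_e1 zeta x} ->
  Rintegral mu D g = 0.
Proof.
move=> hg hae; have [t [t0 tl st]] := exists_small (normr_ge0 e1).
have [L L0 hL] := lzeta.
apply: (@null_integral_lim (fun k x => dq (t k) zeta e1 x) g (L * `|e1|)) => //.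
- by move=> k; apply: null_integralZ; exact: null_integral_shift.
- move=> k; have [] // : bmf setT (dq (t k) zeta e1).
  by apply: bmfZ; apply: bmfB => //; exact: bmf_shift.
- move=> k x nD; apply/eqP/negP => /negP h.
  by have [] := dq_support (st k) (lexx _) (lexx _) (lexx _) h.
- move=> k x Dx; have [->|h] := eqVneq (dq (t k) zeta e1 x) 0.
    by rewrite normr0 mulr_ge0.
  have [_ Dy _ _] := dq_support (st k) (lexx _) (lexx _) (lexx _) h.
  by have [t0k _] := st k; exact: lip_dq.
- apply: filterS hae => x h Dx; have [dz ->] := h Dx.
  exact: cvg_quotient.
Qed.

Lemma null_lagrangian2 (p : E -> R) (e1 e2 : E) g : bmf setT p -> lipD D p -> bmf D g ->
  {ae mu, forall x, D x -> [/\ differentiable zeta x, differentiable p x &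
     g x = 'D_e1 zeta x * 'D_e2 p x - 'D_e2 zeta x * 'D_e1 p x]} ->
  Rintegral mu D g = 0.
Proof.
move=> mp lp hg hae; pose B := `|e1| + `|e2|.
have B1 : `|e1| <= B by rewrite lerDl.
have B2 : `|e2| <= B by rewrite lerDr.
have B0 : 0 <= B by exact: le_trans B1.
have [t [t0 tl st]] := exists_small B0.
have [L L0 hL] := lzeta; have [P P0 hP] := lp.
pose T k a b x := dq (t k) zeta a x * dq (t k) p b (x + t k *: a).
have T0 k a b x : `|a| <= B -> `|b| <= B -> ~ D x -> T k a b x = 0.
  move=> ha hb nD; rewrite /T; have [->|h] := eqVneq (dq (t k) zeta a x) 0; first by rewrite mul0r.
  by have [] := dq_support (st k) ha hb hb h.
have TM k a b x : `|a| <= B -> `|b| <= B -> `|T k a b x| <= (L * B) * (P * B).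
  move=> ha hb; rewrite /T; have [->|h] := eqVneq (dq (t k) zeta a x) 0.
    by rewrite mul0r normr0 !mulr_ge0.
  have [Dx Dy Dz _] := dq_support (st k) ha hb hb h.
  have [t0k _] := st k; rewrite normrM.
  by apply: ler_pM => //; [exact: lip_dq|exact: (@lip_dq p P)].
pose W k a x : R := zeta x * (p (x + t k *: a) - p x).
have W0 k a x : ~ D x -> W k a x = 0 by move=> nD; rewrite /W zetaD // mul0r.
have mW k a : bmf setT (W k a).
  by apply: bmfM => //; apply: bmfB => //; exact: bmf_shift.
(* Discrete form of d zeta ^ dp = d (zeta dp): the two paths end at the same corner x + t e1 + t e2,
   so in the coefficient of zeta x the values of p there cancel. *)
have WT k x : T k e1 e2 x - T k e2 e1 x =
    (t k)^-1 ^+ 2 * ((W k e2 (x + t k *: e1) - W k e2 x) + - 1 * (W k e1 (x + t k *: e2) - W k e1 x)).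
  rewrite /T /W /dq [x + t k *: e2 + t k *: e1]addrAC; ring.
apply: (@null_integral_lim (fun k x => T k e1 e2 x - T k e2 e1 x) g ((L * B) * (P * B) *+ 2)) => //.
- move=> k; rewrite (funext (WT k)); apply: null_integralZ; apply: null_integralD.
    by apply: null_integral_shift => // x; exact: W0.
  by apply: null_integralZ; apply: null_integral_shift => // x; exact: W0.
- move=> k; rewrite (funext (WT k)).
  suff [] : bmf setT (fun x => (t k)^-1 ^+ 2 * ((W k e2 (x + t k *: e1) - W k e2 x) +
    - 1 * (W k e1 (x + t k *: e2) - W k e1 x))) by [].
  apply: bmfZ; apply: bmfD; first by apply: bmfB => //; exact: bmf_shift.
  by apply: bmfZ; apply: bmfB => //; exact: bmf_shift.
- by move=> k x nD; rewrite !T0 // subrr.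
- move=> k x Dx; apply: le_trans (ler_normB _ _) _; rewrite mulr2n.
  by apply: lerD; exact: TM.
- apply: filterS hae => x h Dx; have [dz dp ->] := h Dx.
  by apply: cvgB; apply: cvgM; (try exact: cvg_quotient); exact: cvg_quotient2.
Qed.

Lemma null_lagrangian3 (p q : E -> R) (e1 e2 e3 : E) g :
  bmf setT p -> lipD D p -> bmf setT q -> lipD D q -> bmf D g ->
  {ae mu, forall x, D x -> [/\ differentiable zeta x, differentiable p x,
     differentiable q x &
     g x = 'D_e1 zeta x * ('D_e2 p x * 'D_e3 q x - 'D_e3 p x * 'D_e2 q x)
         + 'D_e2 zeta x * ('D_e3 p x * 'D_e1 q x - 'D_e1 p x * 'D_e3 q x)
         + 'D_e3 zeta x * ('D_e1 p x * 'D_e2 q x - 'D_e2 p x * 'D_e1 q x)]} ->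
  Rintegral mu D g = 0.
Proof.
move=> mp lp mq lq hg hae; pose B := `|e1| + `|e2| + `|e3|.
have B1 : `|e1| <= B by rewrite /B -addrA lerDl addr_ge0.
have B2 : `|e2| <= B by rewrite /B addrAC lerDr addr_ge0.
have B3 : `|e3| <= B by rewrite lerDr addr_ge0.
have B0 : 0 <= B by exact: le_trans B1.
have [t [t0 tl st]] := exists_small B0.
have [L L0 hL] := lzeta; have [P P0 hP] := lp; have [Q Q0 hQ] := lq.
pose T k a b c x := dq (t k) zeta a x * dq (t k) p b (x + t k *: a)
  * dq (t k) q c (x + t k *: a + t k *: b).
have T0 k a b c x : `|a| <= B -> `|b| <= B -> `|c| <= B -> ~ D x -> T k a b c x = 0.
  move=> ha hb hc nD; rewrite /T; have [->|h] := eqVneq (dq (t k) zeta a x) 0.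
    by rewrite !mul0r.
  by have [] := dq_support (st k) ha hb hc h.
have TM k a b c x : `|a| <= B -> `|b| <= B -> `|c| <= B ->
    `|T k a b c x| <= (L * B) * (P * B) * (Q * B).
  move=> ha hb hc; rewrite /T; have [->|h] := eqVneq (dq (t k) zeta a x) 0.
    by rewrite !mul0r normr0 !mulr_ge0.
  have [Dx Dy Dz Dw] := dq_support (st k) ha hb hc h.
  have [t0k _] := st k; rewrite normrM [X in X * _ <= _]normrM.
  apply: ler_pM => //; last exact: (@lip_dq q Q).
  by apply: ler_pM => //; [exact: lip_dq|exact: (@lip_dq p P)].
(* Product of the increments of p and q along the path b, then c; [W] antisymmetrises it and
   multiplies by zeta, as in zeta dp ^ dq. *)
pose S k b c x : R := (p (x + t k *: b) - p x) * (q (x + t k *: b + t k *: c) - q (x + t k *: b)).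
pose W k b c x : R := zeta x * (S k b c x - S k c b x).
have W0 k a b x : ~ D x -> W k a b x = 0 by move=> nD; rewrite /W zetaD // mul0r.
have mS k a b : bmf setT (S k a b).
  apply: bmfM; apply: bmfB => //; try exact: bmf_shift.
  by apply: (@bmf_shift _ _ (fun x => q (x + t k *: b))); exact: bmf_shift.
have mW k a b : bmf setT (W k a b).
  by apply: bmfM => //; apply: bmfB.
pose F k x := (T k e1 e2 e3 x - T k e1 e3 e2 x) + (T k e2 e3 e1 x - T k e2 e1 e3 x)
  + (T k e3 e1 e2 x - T k e3 e2 e1 x).
(* Discrete form of d zeta ^ dp ^ dq = d (zeta dp ^ dq), a sum of three differences of
   translates. *)
have WT k x : F k x = (t k)^-1 ^+ 3 * ((W k e2 e3 (x + t k *: e1) - W k e2 e3 x)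
    + (W k e3 e1 (x + t k *: e2) - W k e3 e1 x)
    + (W k e1 e2 (x + t k *: e3) - W k e1 e2 x)).
  rewrite /F /T /W /S /dq.
  have -> : x + t k *: e2 + t k *: e1 = x + t k *: e1 + t k *: e2 by rewrite addrAC.
  have -> : x + t k *: e3 + t k *: e1 = x + t k *: e1 + t k *: e3 by rewrite addrAC.
  have -> : x + t k *: e3 + t k *: e2 = x + t k *: e2 + t k *: e3 by rewrite addrAC.
  have -> : x + t k *: e1 + t k *: e3 + t k *: e2 = x + t k *: e1 + t k *: e2 + t k *: e3 by rewrite addrAC.
  have -> : x + t k *: e2 + t k *: e3 + t k *: e1 = x + t k *: e1 + t k *: e2 + t k *: e3.
    by rewrite addrAC; congr (_ + _); rewrite addrAC.
  ring.
apply: (@null_integral_lim F g ((L * B) * (P * B) * (Q * B) *+ 6)) => //.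
- move=> k; rewrite (funext (WT k)); apply: null_integralZ.
  by apply: null_integralD; [apply: null_integralD|];
    apply: null_integral_shift => // x; exact: W0.
- move=> k; rewrite (funext (WT k)).
  have h : bmf setT (fun x => (t k)^-1 ^+ 3 * ((W k e2 e3 (x + t k *: e1) - W k e2 e3 x)
    + (W k e3 e1 (x + t k *: e2) - W k e3 e1 x)
    + (W k e1 e2 (x + t k *: e3) - W k e1 e2 x))).
    by apply: bmfZ; apply: bmfD; [apply: bmfD|]; apply: bmfB => //; exact: bmf_shift.
  by case: h.
- by move=> k x nD; rewrite /F !T0 // !subrr !addr0.
- move=> k x Dx; rewrite /F !mulrS mulr0n addr0.
  rewrite [X in _ <= X](_ : _ = ((L * B) * (P * B) * (Q * B) + (L * B) * (P * B) * (Q * B)) +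
    ((L * B) * (P * B) * (Q * B) + (L * B) * (P * B) * (Q * B)) +
    ((L * B) * (P * B) * (Q * B) + (L * B) * (P * B) * (Q * B))); last by rewrite !addrA.
  apply: le_trans (ler_normD _ _) _; apply: lerD.
    apply: le_trans (ler_normD _ _) _; apply: lerD.
      by apply: le_trans (ler_normB _ _) _; apply: lerD; exact: TM.
    by apply: le_trans (ler_normB _ _) _; apply: lerD; exact: TM.
  by apply: le_trans (ler_normB _ _) _; apply: lerD; exact: TM.
- apply: filterS hae => x h Dx; have [dz dp dq' ->] := h Dx.
  have cT a b c : (fun k => T k a b c x) @ \oo --> 'D_a zeta x * 'D_b p x * 'D_c q x.
    apply: cvgM; first by apply: cvgM; [exact: cvg_quotient|exact: cvg_quotient2].
    rewrite /dq; have := @cvg_quotient2 _ _ q x c (a + b) t t0 tl dq'.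
    apply: cvg_trans; apply: near_eq_cvg; apply: nearW => k /=.
    by rewrite scalerDr addrA.
  have alg (z1 z2 z3 p1 p2 p3 q1 q2 q3 : R) :
      z1 * (p2 * q3 - p3 * q2) + z2 * (p3 * q1 - p1 * q3) + z3 * (p1 * q2 - p2 * q1) =
      (z1 * p2 * q3 - z1 * p3 * q2) + (z2 * p3 * q1 - z2 * p1 * q3) + (z3 * p1 * q2 - z3 * p2 * q1).
    by ring.
  rewrite alg; apply: cvgD; last exact: (cvgB (cT _ _ _) (cT _ _ _)).
  by apply: cvgD; exact: (cvgB (cT _ _ _) (cT _ _ _)).
Qed.

End null_lagrangian.

(** * Functions with continuous gradient on a convex set *)


Section chained_lipschitz.
Variable R : realType.

(** The largest s up to which |h t - h 0| <= M t holds is attained by continuity; if s < 1, a piece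
    containing s and points just beyond it pushes the bound past s. Nothing is assumed on the order
    in which the pieces are met, so a segment may alternate between them. *)
Lemma chained_lipschitz (N : nat) (F : 'I_N -> set R) (h : R -> R) (M : R) :
  0 <= M -> (forall j, closed (F j)) ->
  (forall t, 0 <= t <= 1 -> exists j, F j t) ->
  (forall j s t, F j s -> F j t -> 0 <= s <= 1 -> 0 <= t <= 1 ->
     `|h s - h t| <= M * `|s - t|) ->
  (forall t, 0 <= t <= 1 -> forall e, 0 < e ->
     exists2 d, 0 < d & forall s, 0 <= s <= 1 -> `|s - t| < d -> `|h s - h t| < e) ->
  `|h 1 - h 0| <= M.
Proof.
move=> M0 cF cov lip ch.
pose S := [set t | 0 <= t <= 1 /\ `|h t - h 0| <= M * t].
have S0 : S 0 by split; rewrite ?lexx ?ler01 // subrr normr0 mulr0.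
have hS : has_sup S by split; [exists 0|exists 1 => t [/andP[]]].
pose s := sup S.
have s0 : 0 <= s by apply: sup_upper_bound.
have s1 : s <= 1 by apply: ge_sup; [exists 0|move=> t [/andP[]]].
have s01 : 0 <= s <= 1 by rewrite s0.
have Ss : `|h s - h 0| <= M * s.
  rewrite leNgt; apply/negP => lt.
  have e0 : 0 < `|h s - h 0| - M * s by rewrite subr_gt0.
  have [d d0 hd] := ch s s01 _ e0.
  have [t [t01 ht] st] := sup_adherent d0 hS.
  have ts : t <= s by apply: sup_upper_bound.
  have := hd t t01 _; rewrite ler0_norm ?subr_le0 // opprB => /(_ _); rewrite -/s in st.
  have -> : s - t < d by lra.
  move=> /(_ isT); have : M * t <= M * s by apply: ler_wpM2l.
  have -> : h s - h 0 = (h t - h 0) - (h t - h s) by ring.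
  have := ler_normB (h t - h 0) (h t - h s); lra.
have [|slt] := leP 1 s; first by move=> h1; have e : s = 1 by [lra]; move: Ss; rewrite e mulr1.
have near_s j : F j s \/ exists2 d, 0 < d & forall t, s <= t -> t < s + d -> ~ F j t.
  have [Fs|nF] := pselect (F j s); [by left|right].
  have : nbhs s (~` F j) by apply: open_nbhs_nbhs; split => //; exact: closed_openC.
  move=> /nbhs_ballP[d /= d0 hd]; exists d => // t st td; apply: hd.
  by rewrite /ball /= ltr_norml; apply/andP; split; lra.
(* Pigeonhole: finitely many pieces cover the points to the right of s, so one of them accumulates
   at s, and it contains s because it is closed. *)
have [j Fj] : exists j, F j s /\ forall d, 0 < d -> exists t, [/\ s < t, t < s + d, t <= 1 & F j t].
  apply: contrapT => nj.
  have H j : exists2 d, 0 < d & forall t, s < t -> t < s + d -> t <= 1 -> ~ F j t.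
    have [Fs|[d d0 hd]] := near_s j; last by exists d => // t /ltW; move=> ? ? _; exact: hd.
    apply: contrapT => nd; apply: nj; exists j; split => // d d0.
    apply: contrapT => nt; apply: nd; exists d => // t st td t1 Ft; apply: nt.
    by exists t.
  pose dd j := sval (cid2 (H j)).
  have dd0 j : 0 < dd j by rewrite /dd; case: cid2.
  have ddP j t : s < t -> t < s + dd j -> t <= 1 -> ~ F j t by rewrite /dd; case: cid2 => /= x _; exact.
  (* If every piece avoided an interval to the right of s, the point s + d / 2 would lie in [0, 1]
     and in no piece. *)
  pose d := \big[Num.min/(1 - s)]_j dd j.
  have d0 : 0 < d by apply: lt_bigmin => //; rewrite subr_gt0.
  have d1 : d <= 1 - s by exact: bigmin_le_id.
  have [|j Fj] := cov (s + d / 2); first by apply/andP; split; lra.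
  have dj : d <= dd j by exact: bigmin_le.
  by apply: (ddP j (s + d / 2)) => //; lra.
case: Fj => Fs Ft.
have [t [st _ t1 Ftj]] := Ft 1 ltr01.
have t01 : 0 <= t <= 1 by apply/andP; split; lra.
have : t <= s; last by lra.
apply: sup_upper_bound => //; split => //.
have -> : h t - h 0 = (h t - h s) + (h s - h 0) by ring.
apply: le_trans (ler_normD _ _) _.
have := lip j t s Ftj Fs t01 s01; rewrite (gtr0_norm (_ : 0 < t - s)); last lra.
by rewrite mulrBr; lra.
Qed.

End chained_lipschitz.

Section nice_functions.
Variables (R : realType) (n : nat).
Local Notation E := 'rV[R]_n.
Local Notation mu := (vol R n).
Implicit Types (f g : E -> R).

Definition convexD (D : set E) : Prop :=
  forall x y (t : R), D x -> D y -> 0 <= t <= 1 -> D (y + t *: (x - y)).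

Lemma continuous_bounded_on f (D : set E) : continuous f -> bounded_set D ->
  exists B, forall x, D x -> `|f x| <= B.
Proof.
move=> cf [r [_ hr]].
pose K := [set x : E | `|x| <= r + 1].
have DK : D `<=` K by move=> x Dx; apply: hr => //; rewrite ltrDl.
have cK : compact K.
  apply: bounded_closed_compact.
    by exists (r + 1); split; rewrite ?num_real // => M hM x Kx; exact: le_trans Kx (ltW hM).
  by apply: (@closed_comp _ _ (fun x : E => `|x|) [set z | z <= r + 1]);
    [move=> x _; exact: norm_continuous|exact: closed_le].
have : compact (f @` K) by apply: continuous_compact => //; exact: continuous_subspaceT.
move=> /compact_bounded[M [_ hM]]; exists (M + 1) => x /DK Kx.
by apply: hM; [rewrite ltrDl|exists x].
Qed.

Lemma line_derive f (y v : E) (t : R) : differentiable f (y + t *: v) ->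
  is_derive t 1 (fun s : R => f (y + s *: v)) ('D_v f (y + t *: v)).
Proof.
move=> df; have dv : derivable f (y + t *: v) v by exact: diff_derivable.
have e : (fun h : R => h^-1 *: (((fun s : R => f (y + s *: v)) \o shift t) (h *: 1) - f (y + t *: v)))
   = (fun h : R => h^-1 *: ((f \o shift (y + t *: v)) (h *: v) - f (y + t *: v))).
  apply/funext => h /=; congr (_ *: (f _ - _)).
  by rewrite [h *: 1]mulr1 scalerDl addrCA.
by split; [rewrite /derivable e|rewrite /derive e].
Qed.

Lemma norm_sum_coord (v : E) (a : 'I_n -> R) B : 0 <= B -> (forall i, `|a i| <= B) ->
  `|\sum_i v ord0 i * a i| <= n%:R * B * `|v|.
Proof.
move=> B0 hB; apply: le_trans (ler_norm_sum _ _ _) _.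
apply: (@le_trans _ _ (\sum_(i < n) B * `|v|)).
  apply: ler_sum => i _; rewrite normrM mulrC; apply: ler_pM => //; exact: le_coord_norm.
by rewrite sumr_const card_ord -[X in X <= _]mulr_natl mulrA.
Qed.

Lemma mean_value_bound (D : set E) f B : convexD D -> 0 <= B ->
  (forall x, D x -> differentiable f x) ->
  (forall i x, D x -> `|partial i f x| <= B) ->
  forall x y, D x -> D y -> `|f x - f y| <= n%:R * B * `|x - y|.
Proof.
move=> cD B0 df hB x y Dx Dy; pose v := x - y.
have hd (t : R) : 0 <= t <= 1 -> is_derive t 1 (fun s : R => f (y + s *: v)) ('D_v f (y + t *: v)).
  by move=> t01; apply: line_derive; apply: df; exact: cD.
have hd' (t : R) : t \in `]0, 1[ -> is_derive t 1 (fun s : R => f (y + s *: v)) ('D_v f (y + t *: v)).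
  by rewrite in_itv /= => /andP[h0 h1]; apply: hd; apply/andP; split; exact: ltW.
have cont : {within `[0, 1], continuous (fun s : R => f (y + s *: v))}.
  apply: continuous_in_subspaceT => t; rewrite inE /= in_itv /= => t01.
  apply: differentiable_continuous; apply/derivable1_diffP.
  by have [] := hd t t01.
have [t] := MVT_segment ler01 hd' cont.
rewrite in_itv /= => t01; rewrite scale1r scale0r addr0 subr0 mulr1 /v subrKC => ->.
rewrite derive_partial; last by apply: df; exact: cD.
by apply: norm_sum_coord => // i; apply: hB; exact: cD.
Qed.

(** The regularity shared by test functions and finite element functions; the Lipschitz condition on
    all of D bounds the gradient up to the boundary. *)
Definition nice (D : set E) f : Prop :=
  [/\ lipD D f, forall x, D x -> differentiable f x &
      forall i x, D x -> {for x, continuous (partial i f)}].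

Lemma nice_partial_bounded (D : set E) f : open D -> nice D f ->
  exists2 B, 0 <= B & forall i x, D x -> `|partial i f x| <= B.
Proof.
move=> oD [[L L0 hL] df _].
exists (L * \sum_i `|delta_mx ord0 i : E|).
  by rewrite mulr_ge0 // sumr_ge0.
move=> i x Dx; rewrite /partial; set v := delta_mx _ _.
apply: (@le_trans _ _ (L * `|v|)); last first.
  by apply: ler_wpM2l => //; rewrite (bigD1 i) //= lerDl sumr_ge0.
have h := cvg_quotient (v := v) (t := fun k => k.+1%:R^-1) _ _ (df x Dx).
have t0 k : k.+1%:R^-1 != 0 :> R by [].
have {}h := h t0 (@cvg_harmonic R).
have tv : (fun k : nat => x + k.+1%:R^-1 *: v) @ \oo --> x.
  rewrite -[X in _ --> X]addr0 -(scale0r v).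
  by apply: cvgD; [exact: cvg_cst|apply: cvgZ; [exact: cvg_harmonic|exact: cvg_cst]].
apply: (cvgr_to_le (cvg_norm h)).
have nD : \forall k \near \oo, D (x + k.+1%:R^-1 *: v) by apply: tv; exact: open_nbhs_nbhs.
apply: filterS nD => k Dk /=.
have k0 : 0 < k.+1%:R^-1 :> R by rewrite invr_gt0.
rewrite normrM gtr0_norm ?invr_gt0 ?invrK // mulrC -ler_pdivlMr //.
apply: le_trans (hL _ _ Dk Dx) _.
by rewrite addrAC subrr add0r normrZ gtr0_norm // mulrCA mulrC.
Qed.

Lemma nice_partial_bmf (D : set E) f i : open D -> nice D f -> bmf D (partial i f).
Proof.
move=> oD hf; have [B _ hB] := nice_partial_bounded oD hf.
split; last by exists B => x; exact: hB.
by apply: continuous_measurable_rV => // x; have [_ _] := hf; exact.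
Qed.

Lemma nice_bmf (D : set E) f : open D -> bounded_set D -> nice D f -> bmf D f.
Proof. by move=> oD bD [lf _ _]; exact: lipD_bmf. Qed.

Lemma near_continuous f g x : {near x, f =1 g} -> {for x, continuous f} -> {for x, continuous g}.
Proof.
move=> fg cf; rewrite /prop_for /continuous_at -(nbhs_singleton fg).
have h : g @ x --> f @ x by exact: (@near_eq_cvg _ _ (nbhs x) (nbhs_filter x) f g fg).
exact: cvg_trans h cf.
Qed.

Lemma niceD (D : set E) f g : open D -> nice D f -> nice D g -> nice D (f + g).
Proof.
move=> oD [lf df cf] [lg dg cg]; split.
- exact: lipDD.
- by move=> x Dx; apply: differentiableD; [exact: df|exact: dg].
- move=> i x Dx; apply: (@near_continuous (fun y => partial i f y + partial i g y)).
    by apply: (open_near_eq oD) => // y Dy; rewrite partialD //; [exact: df|exact: dg].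
  by apply: continuousD; [exact: cf|exact: cg].
Qed.

Lemma niceZ (D : set E) c f : open D -> nice D f -> nice D (c *: f).
Proof.
move=> oD [lf df cf]; split.
- exact: lipDZ.
- by move=> x Dx; apply: differentiableZ; exact: df.
- move=> i x Dx; apply: (@near_continuous (fun y => c * partial i f y)).
    by apply: (open_near_eq oD) => // y Dy; rewrite partialZ //; exact: df.
  by apply: continuousM; [exact: cst_continuous|exact: cf].
Qed.

Lemma niceB (D : set E) f g : open D -> nice D f -> nice D g -> nice D (f - g).
Proof. by move=> oD hf hg; rewrite -scaleN1r; exact: (niceD oD hf (niceZ (-1) oD hg)). Qed.

(** The partial derivatives are continuous on the whole space, hence bounded on D, and the mean
    value inequality on the convex set D gives the Lipschitz bound. *)
Lemma smooth_nice (D : set E) f : convexD D -> bounded_set D -> smooth f -> nice D f.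
Proof.
move=> cD bD sf.
have df x : differentiable f x by exact: (sf [::]).
have dpf i x : differentiable (partial i f) x by exact: (sf [:: i]).
have cpf i : continuous (partial i f) by move=> x; apply: differentiable_continuous.
split => //; last by move=> i x _; exact: cpf.
pose B i := sval (cid (continuous_bounded_on (cpf i) bD)).
have hB i x : D x -> `|partial i f x| <= B i by rewrite /B; case: cid => /= b; exact.
exists (n%:R * \sum_i `|B i|); first by rewrite mulr_ge0 // sumr_ge0.
apply: mean_value_bound => //; first by rewrite sumr_ge0.
move=> i x Dx; apply: le_trans (hB i x Dx) _; apply: le_trans (ler_norm _) _.
by rewrite (bigD1 i) //= lerDl sumr_ge0.
Qed.

End nice_functions.

(** * Polynomials and polytopes *)


Section polynomials.
Variables (R : realType) (n : nat).
Local Notation E := 'rV[R]_n.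

(** Polynomials without degree or coefficients: closure under partial derivatives and symmetry of
    second derivatives become structural inductions. *)
Inductive pf : (E -> R) -> Prop :=
| pf_cst c : pf (fun=> c)
| pf_coor i : pf (fun x => x ord0 i)
| pf_add p q : pf p -> pf q -> pf (fun x => p x + q x)
| pf_mul p q : pf p -> pf q -> pf (fun x => p x * q x).

Lemma pf_sum (I : Type) (s : seq I) (P : pred I) (F : I -> E -> R) :
  (forall i, P i -> pf (F i)) -> pf (fun x => \sum_(i <- s | P i) F i x).
Proof.
move=> h; elim: s => [|i s IH].
  by rewrite (_ : (fun _ => _) = fun=> 0); [exact: pf_cst|apply/funext => x; rewrite big_nil].
have [Pi|Pi] := boolP (P i).
  rewrite (_ : (fun _ => _) = fun x => F i x + \sum_(i <- s | P i) F i x).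
    by apply: pf_add => //; exact: h.
  by apply/funext => x; rewrite big_cons Pi.
by rewrite (_ : (fun _ => _) = fun x => \sum_(i <- s | P i) F i x) //; apply/funext => x; rewrite big_cons (negbTE Pi).
Qed.

Lemma pf_prod (I : Type) (s : seq I) (P : pred I) (F : I -> E -> R) :
  (forall i, P i -> pf (F i)) -> pf (fun x => \prod_(i <- s | P i) F i x).
Proof.
move=> h; elim: s => [|i s IH].
  by rewrite (_ : (fun _ => _) = fun=> 1); [exact: pf_cst|apply/funext => x; rewrite big_nil].
have [Pi|Pi] := boolP (P i).
  rewrite (_ : (fun _ => _) = fun x => F i x * \prod_(i <- s | P i) F i x).
    by apply: pf_mul => //; exact: h.
  by apply/funext => x; rewrite big_cons Pi.
by rewrite (_ : (fun _ => _) = fun x => \prod_(i <- s | P i) F i x) //; apply/funext => x; rewrite big_cons (negbTE Pi).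
Qed.

Lemma pf_exp p k : pf p -> pf (fun x => p x ^+ k).
Proof.
move=> hp; elim: k => [|k IH]; first exact: pf_cst.
rewrite (_ : (fun _ => _) = fun x => p x * p x ^+ k); first exact: pf_mul.
by apply/funext => x; rewrite exprS.
Qed.

Lemma polyfun_pf d p : polyfun d p -> pf p.
Proof.
move=> [c ->]; apply: pf_sum => a _; apply: pf_mul; first exact: pf_cst.
by apply: pf_prod => i _; apply: pf_exp; exact: pf_coor.
Qed.

Lemma pf_differentiable p x : pf p -> differentiable p x.
Proof.
elim=> [c|i|{}p q _ hp _ hq|{}p q _ hp _ hq].
- exact: differentiable_cst.
- exact: differentiable_coord.
- exact: differentiableD.
- exact: differentiableM.
Qed.

Lemma partial_cst i (c : R) : partial i (fun=> c : R) = (fun=> 0) :> (E -> R).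
Proof. by apply/funext => x; rewrite /partial derive_cst. Qed.

Lemma partial_coor i j : partial i (fun x : E => x ord0 j) = fun=> (i == j)%:R.
Proof.
apply/funext => x; rewrite /partial; set v := delta_mx _ _.
have dx : differentiable (fun x : E => x ord0 j) x by exact: differentiable_coord.
have t0 k : k.+1%:R^-1 != 0 :> R by [].
have h := cvg_quotient (v := v) t0 (@cvg_harmonic R) dx.
have e : (fun k : nat => k.+1%:R^-1^-1 * ((x + k.+1%:R^-1 *: v) ord0 j - x ord0 j)) = fun=> (i == j)%:R :> R.
  apply/funext => k; rewrite !mxE addrAC subrr add0r mulrA mulVf // mul1r eqxx /=.
  by rewrite eq_sym.
by move: h; rewrite e => h; exact: (cvg_unique _ h (cvg_cst _)).
Qed.

Lemma pf_partial i p : pf p -> pf (partial i p).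
Proof.
elim=> [c|j|{}p q pp hp pq hq|{}p q pp hp pq hq].
- by rewrite partial_cst; exact: pf_cst.
- by rewrite partial_coor; exact: pf_cst.
- rewrite (_ : partial _ _ = fun x => partial i p x + partial i q x); first exact: pf_add.
  by apply/funext => x; rewrite -partialD //; exact: pf_differentiable.
- rewrite (_ : partial _ _ = fun x => p x * partial i q x + q x * partial i p x).
    by apply: pf_add; exact: pf_mul.
  by apply/funext => x; rewrite -partialM //; exact: pf_differentiable.
Qed.

Lemma pf_partialC i j p : pf p -> partial i (partial j p) = partial j (partial i p).
Proof.
elim=> [c|k|{}p q pp hp pq hq|{}p q pp hp pq hq].
- by rewrite !partial_cst.
- by rewrite !partial_coor !partial_cst.
- have e k : partial k (fun x => p x + q x) = partial k p + partial k q.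
    apply/funext => x.
    exact: (partialD k (pf_differentiable x pp) (pf_differentiable x pq)).
  have dd k r : pf r -> forall x, differentiable (partial k r) x.
    by move=> hr x; apply: pf_differentiable; exact: pf_partial.
  apply/funext => x; rewrite (e i) (e j).
  rewrite (partialD i (dd j _ pp x) (dd j _ pq x)) (partialD j (dd i _ pp x) (dd i _ pq x)).
  by rewrite hp hq.
- have e k : partial k (fun x => p x * q x) = p * partial k q + q * partial k p.
    apply/funext => x.
    exact: (partialM k (pf_differentiable x pp) (pf_differentiable x pq)).
  have dd k r : pf r -> forall x, differentiable (partial k r) x.
    by move=> hr x; apply: pf_differentiable; exact: pf_partial.
  have d0 r : pf r -> forall x, differentiable r x by move=> hr x; exact: pf_differentiable.
  have dm k l r r' : pf r -> pf r' -> forall x, partial l (r * partial k r') x =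
      r x * partial l (partial k r') x + partial k r' x * partial l r x.
    by move=> hr hr' x; exact: (partialM l (d0 _ hr x) (dd k _ hr' x)).
  have dM k r r' : pf r -> pf r' -> forall x, differentiable (r * partial k r') x.
    by move=> hr hr' x; apply: differentiableM; [exact: d0|exact: dd].
  apply/funext => x; rewrite (e i) (e j).
  rewrite (partialD i (dM j _ _ pp pq x) (dM j _ _ pq pp x)).
  rewrite (partialD j (dM i _ _ pp pq x) (dM i _ _ pq pp x)).
  rewrite (dm j i p q pp pq) (dm j i q p pq pp) (dm i j p q pp pq) (dm i j q p pq pp) hp hq.
  move: (partial j (partial i p) x) (partial j (partial i q) x) => a c.
  move: (partial i p x) (partial i q x) (partial j p x) (partial j q x) (p x) (q x) => *; ring.
Qed.

Lemma pf_lip (D : set E) p : bounded_set D -> pf p ->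
  lipD D p /\ exists B, forall x, D x -> `|p x| <= B.
Proof.
move=> bD hp; suff h : lipD D p by split => //; exact: lipD_bounded.
elim: hp => [c|i|{}p q pp hp pq hq|{}p q pp hp pq hq].
- exact: lipD_cst.
- exact: lipD_coor.
- exact: lipDD.
- by apply: lipDM => //; exact: lipD_bounded.
Qed.

Lemma pf_continuous p : pf p -> continuous p.
Proof. by move=> hp x; apply: differentiable_continuous; exact: pf_differentiable. Qed.

End polynomials.

(** * Functions with Lipschitz pieces on a convex set *)

Section piecewise.
Variables (R : realType) (n : nat).
Local Notation E := 'rV[R]_n.

Lemma eq_on_closure (D T : set E) (f g : E -> R) x : open D -> D x -> closure T x ->
  {for x, continuous f} -> {for x, continuous g} ->
  (forall y, T y -> f y = g y) -> f x = g x.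
Proof.
move=> oD Dx Tx cf cg fg; apply/eqP; rewrite -subr_eq0; apply/negP => /negP nz.
have c : {for x, continuous (f - g)} by exact: continuousB.
have : nbhs x ((f - g) @^-1` [set z | z != 0]).
  by apply: c; apply: open_nbhs_nbhs; split => //; exact: open_neq.
by move=> /Tx[y [Ty /=]]; rewrite !fctE fg // subrr eqxx.
Qed.

(** On a segment between two points the closed pieces cover, and [chained_lipschitz] applies. Each
    piece extends to its closure by continuity of f; the sum of the constants serves as a common
    bound. *)
Lemma piecewise_lip (D : set E) (N : nat) (T : 'I_N -> set E) (f : E -> R) (g : 'I_N -> E -> R) :
  open D -> convexD D ->
  (forall x, D x -> exists j, closure (T j) x) ->
  (forall x, D x -> {for x, continuous f}) ->
  (forall j, lipD D (g j)) ->
  (forall j x, T j x -> f x = g j x) -> lipD D f.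
Proof.
move=> oD cD cov cf lg fg.
pose L j := sval (cid2 (lg j)).
have [L0 hL] : (forall j, 0 <= L j) /\ (forall j x y, D x -> D y -> `|g j x - g j y| <= L j * `|x - y|).
  by split=> j; rewrite /L; case: cid2.
have fgc j x : D x -> closure (T j) x -> f x = g j x.
  move=> Dx Tx; 
  exact: (eq_on_closure oD Dx Tx (cf _ Dx) (lipD_continuous oD (lg j) Dx) (fg j)).
exists (\sum_j L j); first by rewrite sumr_ge0.
move=> x y Dx Dy; pose v := x - y; pose l (t : R) := y + t *: v.
have Dl t : 0 <= t <= 1 -> D (l t) by exact: cD.
have cl : continuous l.
  move=> t; apply: cvgD; first exact: cvg_cst.
  by apply: cvgZ; [exact: cvg_id|exact: cvg_cst].
have ln s t : `|l s - l t| = `|s - t| * `|v|.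
  by rewrite /l opprD addrACA subrr add0r -scalerBl normrZ.
have l1 : l 1 = x by rewrite /l scale1r /v subrKC.
have l0 : l 0 = y by rewrite /l scale0r addr0.
rewrite -{1}l1 -{1}l0.
apply: (@chained_lipschitz R N (fun j => l @^-1` closure (T j)) (fun t => f (l t))).
- by rewrite mulr_ge0 // sumr_ge0.
- by move=> j; apply: closed_comp => //; exact: closed_closure.
- by move=> t /Dl /cov.
- move=> j s t Fs Ft s01 t01; rewrite (fgc j (l s) (Dl _ s01) Fs) (fgc j (l t) (Dl _ t01) Ft).
  apply: le_trans (hL j _ _ (Dl _ s01) (Dl _ t01)) _.
  rewrite ln -/v mulrA mulrAC ler_wpM2r // ler_wpM2r //.
  by rewrite (bigD1 j) //= lerDl sumr_ge0.
- move=> t t01 e e0.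
  have c : {for t, continuous (f \o l)}.
    by apply: continuous_comp; [exact: cl|exact: cf _ (Dl _ t01)].
  have : \forall s \near t, `|(f \o l) t - (f \o l) s| < e.
    by move/cvgrPdist_lt : c; apply.
  move=> /nbhs_ballP[d /= d0 hd]; exists d => // s _ st.
  by rewrite distrC; apply: hd; rewrite /ball /= distrC.
Qed.

End piecewise.

(** * Intersections of half-spaces and their boundaries *)

Section halfspaces_facts.
Variables (R : realType) (n : nat).
Local Notation E := 'rV[R]_n.
Implicit Types (x y nu : E).

Lemma dotD nu x y : dot nu (x + y) = dot nu x + dot nu y.
Proof. by rewrite /dot -big_split; apply: eq_bigr => i _; rewrite mxE mulrDr. Qed.

Lemma dotZ nu (c : R) x : dot nu (c *: x) = c * dot nu x.
Proof. by rewrite /dot mulr_sumr; apply: eq_bigr => i _; rewrite mxE mulrCA. Qed.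

Lemma dot0l x : dot 0 x = 0 :> R.
Proof. by rewrite /dot big1 // => i _; rewrite mxE mul0r. Qed.

Lemma dot_pf nu : pf (dot nu).
Proof.
by apply: pf_sum => i _; apply: pf_mul; [exact: pf_cst|exact: pf_coor].
Qed.

Lemma continuous_dot nu : continuous (dot nu).
Proof. exact/pf_continuous/dot_pf. Qed.

Variables (m : nat) (nu : 'I_m -> E) (b : 'I_m -> R).

Lemma open_halfspaces : open (halfspaces nu b).
Proof.
rewrite openE => x h; apply: (@filter_forall _ _ _ (nbhs x) (nbhs_filter x)) => i.
apply: (@continuous_dot (nu i) x [set z | z < b i]); apply: open_nbhs_nbhs.
by split; [exact: open_lt|exact: h].
Qed.

Lemma convex_halfspaces : convexD (halfspaces nu b).
Proof.
move=> x y t Dx Dy /andP[t0 t1] i; have hx := Dx i; have hy := Dy i.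
rewrite dotD dotZ dotD -scaleN1r dotZ mulN1r.
have [->|tn] := eqVneq t 0; first by rewrite mul0r addr0.
have tp : 0 < t by rewrite lt_neqAle eq_sym tn.
have : t * dot (nu i) x < t * b i by rewrite ltr_pM2l.
have : (1 - t) * dot (nu i) y <= (1 - t) * b i by apply: ler_wpM2l; [lra|exact: ltW].
lra.
Qed.

Lemma closure_halfspaces x : closure (halfspaces nu b) x -> forall i, dot (nu i) x <= b i.
Proof.
move=> cx i; have : closure [set z | dot (nu i) z <= b i] x.
  by apply: closure_subset cx => z h; exact: ltW (h i).
rewrite -(closure_id _).1 //; apply: (@closed_comp _ _ (dot (nu i)) [set z | z <= b i]).
  by move=> z _; exact: continuous_dot.
exact: closed_le.
Qed.

(** A point of the closure outside the open set violates a strict inequality while satisfying the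
    weak one, so it lies on one of finitely many hyperplanes. *)
Lemma null_boundary : halfspaces nu b !=set0 ->
  (vol R n).-negligible (closure (halfspaces nu b) `\` halfspaces nu b).
Proof.
move=> [x0 h0].
(* Elements of a mesh may be described with zero normals. Such a constraint holds at one point,
   hence everywhere, and contributes no boundary. *)
pose A (i : 'I_m) := if nu i == 0 then set0 else [set x | dot (nu i) x = b i].
have mA i : measurable (A i).
  by rewrite /A; case: ifP => _ //; exact: measurable_hyperplane.
have A0 i : vol R n (A i) = 0%E.
  by rewrite /A; case: ifPn => h; [rewrite measure0|exact: vol_hyperplane].
apply: (@negligibleS _ _ _ _ (\big[setU/set0]_(i < m) A i)); last first.
  elim/big_ind: _ => [||i _]; [exact: negligible_set0|exact: negligibleU|].
  by apply/negligibleP; [exact: mA|exact: A0].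
move=> x [cx nx].
have [i hi] : exists i, ~ (dot (nu i) x < b i).
  by apply: contrapT => h; apply: nx => i; apply: contrapT => hi; apply: h; exists i.
rewrite (bigD1 i) //=; left; rewrite /A; case: ifPn => [/eqP nu0|_] /=.
  by apply: hi; rewrite nu0 dot0l; have := h0 i; rewrite nu0 dot0l.
by apply/eqP; rewrite eq_le (closure_halfspaces cx) leNgt; exact/negP.
Qed.

End halfspaces_facts.

(** * Finite element functions *)


Section bmf_matrix.
Variables (R : realType) (n : nat).
Local Notation E := 'rV[R]_n.
Variable D : set E.

Lemma bmf_det k (A : E -> 'M[R]_k) : (forall i j, bmf D (fun x => A x i j)) ->
  bmf D (fun x => \det (A x)).
Proof.
move=> h; apply: bmf_sum => s _; apply: bmfM; first exact: bmf_cst.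
by apply: bmf_prod => i _; exact: h.
Qed.

Lemma bmf_cofactor k (A : E -> 'M[R]_k) : (forall i j, bmf D (fun x => A x i j)) ->
  forall i j, bmf D (fun x => cofactor (A x) i j).
Proof.
move=> h i j; apply: bmfM; first exact: bmf_cst.
apply: bmf_det => a c; apply: bmf_eq (h (lift i a) (lift j c)) => x _.
by rewrite !mxE.
Qed.

End bmf_matrix.

Section finite_elements.
Variables (R : realType) (n : nat).
Local Notation E := 'rV[R]_n.
Local Notation mu := (vol R n).
Variables (D : set E) (m : nat) (nu : 'I_m -> E) (b : 'I_m -> R).
Hypothesis hD : polyhedral_domain D nu b.
Variables (N : nat) (T : 'I_N -> set E).
Hypothesis hT : mesh D T.
Variables (d : nat) (V : set (E -> R)).
Hypothesis hV : fe_space D d T V.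
Implicit Types (u v w : E -> R).

Lemma domain_open : open D.
Proof. by rewrite (pd_halfspaces hD); exact: open_halfspaces. Qed.

Lemma domain_convex : convexD D.
Proof. by rewrite (pd_halfspaces hD); exact: convex_halfspaces. Qed.

Lemma domain_measurable : measurable D.
Proof. by apply: open_measurable_rV; exact: domain_open. Qed.

Lemma domain_finite : (mu D < +oo)%E.
Proof. exact: bounded_vol domain_measurable (pd_bounded hD). Qed.

Lemma domain_vol_gt0 : 0 < fine (mu D).
Proof.
have [x Dx] := pd_nonempty hD.
have /nbhs_ballP[e /= e0 he] : nbhs x D by exact: open_nbhs_nbhs (conj domain_open Dx).
have mB := measurable_ball_rV x e.
rewrite fine_gt0 // domain_finite andbT.
apply: (@lt_le_trans _ _ (mu (ball x e))).
  by rewrite [X in (_ < X)%E](vol_ball x e0) lte_fin exprn_gt0 // mulrn_wgt0.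
by apply: le_measure; rewrite ?inE //; exact: domain_measurable.
Qed.

Lemma elem_open j : open (T j).
Proof. by have [/(_ j)[_ _ [k [c [a ->]]]] _ _] := hT; exact: open_halfspaces. Qed.

Lemma elem_cover x : D x -> exists j, closure (T j) x.
Proof.
have [_ _ e] := hT => /subset_closure; rewrite e => -[j _ h]; by exists j.
Qed.

(** The mesh only places T j in the closure of D. As T j is open, a small move along an outward unit
    normal stays in T j and raises the product with this normal, so the inequalities defining D are
    strict on T j. *)
Lemma elem_sub j : T j `<=` D.
Proof.
move=> x Tx; rewrite (pd_halfspaces hD) => i.
have cD y : T j y -> dot (nu i) y <= b i.
  move=> Ty; apply: (@closure_halfspaces R n m nu b).
  by rewrite -(pd_halfspaces hD); have [_ _ ->] := hT; exists j => //; exact: subset_closure.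
have /nbhs_ballP[e /= e0 he] : nbhs x (T j).
  by apply: open_nbhs_nbhs; split; [exact: elem_open|exact: Tx].
have n0 : 0 < `|nu i| + 1 by apply: ltr_pwDr.
pose s := e / 2 / (`|nu i| + 1).
have s0 : 0 < s by rewrite !divr_gt0.
have := cD (x + s *: nu i) (he _ _); rewrite dotD dotZ (pd_unit hD) mulr1.
have hb : ball x e (x + s *: nu i).
  rewrite mx_norm_ball /ball_ /= opprD addrA subrr sub0r normrN normrZ gtr0_norm //.
  apply: (@le_lt_trans _ _ (e / 2)); last by lra.
  by rewrite /s -[leRHS](@divfK _ (`|nu i| + 1)) ?gt_eqF // ler_wpM2l ?lerDl // ltW.
by move=> /(_ hb); lra.
Qed.

Lemma elem_uniq i j x : T i x -> T j x -> i = j.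
Proof.
have [_ + _] := hT => /trivIsetP h Ti Tj; apply: contrapT => /eqP ij.
by have /seteqP[+ _] := h i j I I ij => /(_ x (conj Ti Tj)).
Qed.

Lemma ae_elem : {ae mu, forall x, D x -> exists j, T j x}.
Proof.
have hj j : mu.-negligible (closure (T j) `\` T j).
  have [/(_ j)[T0 _ [k [c [a e]]]] _ _] := hT; rewrite e; apply: null_boundary.
  by rewrite -e.
apply: (@negligibleS _ _ _ _ (\big[setU/set0]_(j < N) (closure (T j) `\` T j))); last first.
  by elim/big_ind: _ => [||i _]; [exact: negligible_set0|exact: negligibleU|exact: hj].
move=> x /= /not_implyP[Dx nT]; have [j Tj] := elem_cover Dx.
by rewrite (bigD1 j) //=; left; split => // Tx; apply: nT; exists j.
Qed.

Lemma fe_zero : V 0.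
Proof.
have [[k [e ->]] _] := hV; exists (fun=> 0).
by rewrite big1 // => i _; rewrite scale0r.
Qed.

Lemma fe_add v w : V v -> V w -> V (v + w).
Proof.
have [[k [e ->]] _] := hV => -[c ->] [a ->]; exists (fun i => c i + a i).
by rewrite -big_split; apply: eq_bigr => i _; rewrite scalerDl.
Qed.

Lemma fe_scale (c : R) v : V v -> V (c *: v).
Proof.
have [[k [e ->]] _] := hV => -[a ->]; exists (fun i => c * a i).
by rewrite scaler_sumr; apply: eq_bigr => i _; rewrite scalerA.
Qed.

Lemma fe_sub v w : V v -> V w -> V (v - w).
Proof. by move=> hv hw; rewrite -scaleN1r; apply: fe_add => //; exact: fe_scale. Qed.

Lemma fe_sum (k : nat) (F : 'I_k -> E -> R) : (forall i, V (F i)) -> V (\sum_i F i).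
Proof. by move=> h; elim/big_ind: _ => //; [exact: fe_zero|exact: fe_add]. Qed.

Lemma fe_outside v x : V v -> ~ D x -> v x = 0.
Proof. by have [_ h] := hV => /h[_ _]; exact. Qed.

Lemma fe_C1 v : V v -> C1 D v.
Proof. by have [_ h] := hV => /h[]. Qed.

Lemma fe_pieces v : V v -> exists P : 'I_N -> E -> R,
  (forall j, pf (P j)) /\ forall j x, T j x -> v x = P j x.
Proof.
have [_ h] := hV => /h[_ hp _].
exists (fun j => sval (cid2 (hp j))); split=> j; case: cid2 => p /= hpp //.
by move=> _; exact: polyfun_pf hpp.
Qed.

Lemma fe_differentiable v x : V v -> D x -> differentiable v x.
Proof. by move=> /fe_C1[h _ _ _]; exact: h. Qed.

Lemma elem_near_eq j (f g : E -> R) x : T j x -> (forall y, T j y -> f y = g y) -> {near x, f =1 g}.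
Proof. by move=> Tx; apply: open_near_eq => //; exact: elem_open. Qed.

Lemma fe_nice v : V v -> nice D v.
Proof.
move=> hv; have [dv cv _ _] := fe_C1 hv; split => //.
have [P [pP eP]] := fe_pieces hv.
apply: (@piecewise_lip _ _ D N T v P domain_open domain_convex elem_cover) => //.
  by move=> x Dx; apply: differentiable_continuous; exact: dv.
by move=> j; have [] := pf_lip (pd_bounded hD) (pP j).
Qed.

(** Continuity of the gradient across interfaces turns the elementwise bounds into a global one: V
    consists of W^{2,oo} functions. This is all the second order regularity that the difference
    quotients use. *)
Lemma fe_partial_lip v i : V v -> lipD D (partial i v).
Proof.
move=> hv; have [dv cv _ _] := fe_C1 hv.
have [P [pP eP]] := fe_pieces hv.
apply: (@piecewise_lip _ _ D N T _ (fun j => partial i (P j)) domain_open domain_convex elem_cover).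
- by move=> x Dx; exact: cv.
- by move=> j; have [] := pf_lip (pd_bounded hD) (pf_partial i (pP j)).
- by move=> j x Tx; apply: partial_near; apply: (elem_near_eq Tx) => y; exact: eP.
Qed.

Lemma fe_bmf v : V v -> bmf D v.
Proof. by move=> hv; apply: nice_bmf (fe_nice hv); [exact: domain_open|exact: pd_bounded hD]. Qed.

Lemma fe_partial_bmf v i : V v -> bmf D (partial i v).
Proof. by move=> hv; apply: nice_partial_bmf (fe_nice hv); exact: domain_open. Qed.

Lemma fe_partial_differentiable v i j x : V v -> T j x -> differentiable (partial i v) x.
Proof.
move=> hv Tx; have [P [pP eP]] := fe_pieces hv.
apply: (@near_differentiable _ _ (partial i (P j))); last exact/pf_differentiable/pf_partial.
apply: (elem_near_eq Tx) => y Ty; apply: partial_near.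
by apply: (elem_near_eq Ty) => z /eP.
Qed.

Lemma hess_in j v x k l : T j x -> hess T v x k l = partial k (partial l v) x.
Proof. by move=> Tx; rewrite /hess asboolT ?mxE //; exists j. Qed.

Lemma hess_out v x : ~ (exists j, T j x) -> hess T v x = 0.
Proof. by move=> nT; rewrite /hess asboolF. Qed.

Lemma hess_piece j v (P : E -> R) x k l : (forall y, T j y -> v y = P y) -> T j x ->
  hess T v x k l = partial k (partial l P) x.
Proof.
move=> eP Tx; rewrite (hess_in _ _ _ Tx); apply: partial_near.
apply: (elem_near_eq Tx) => y Ty; apply: partial_near.
by apply: (elem_near_eq Ty).
Qed.

Lemma hess_sym v x k l : V v -> hess T v x k l = hess T v x l k.
Proof.
move=> hv; have [[j Tx]|nT] := pselect (exists j, T j x); last by rewrite hess_out // !mxE.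
have [P [pP eP]] := fe_pieces hv.
by rewrite !(hess_piece _ _ (eP j) Tx) (pf_partialC k l (pP j)).
Qed.

Lemma hess_bmf v k l : V v -> bmf D (fun x => hess T v x k l).
Proof.
move=> hv; have [P [pP eP]] := fe_pieces hv.
(* Elements being disjoint, at most one term is nonzero, and off the elements both sides are 0. *)
apply: (@bmf_eq _ _ _ (fun x => \sum_j \1_(T j) x * partial k (partial l (P j)) x)).
  move=> x Dx; have [[j Tx]|nT] := pselect (exists j, T j x); last first.
    rewrite hess_out // mxE big1 // => j _; rewrite indicE memNset ?mul0r //.
    by move=> Tx; apply: nT; exists j.
  rewrite (hess_piece _ _ (eP j) Tx) (bigD1 j) //= indicE mem_set // mul1r big1 ?addr0 //.
  move=> i ij; rewrite indicE memNset ?mul0r // => Ti.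
  by move: ij; rewrite (elem_uniq Ti Tx) eqxx.
apply: bmf_sum => j _; apply: bmfM.
  split; first by apply: measurable_indic; apply: open_measurable_rV; exact: elem_open.
  by exists 1 => x _; rewrite indicE; case: (_ \in _); rewrite ?normr1 ?normr0.
apply: lipD_bmf domain_open (pd_bounded hD) _.
by have [] := pf_lip (pd_bounded hD) (pf_partial k (pf_partial l (pP j))).
Qed.

Lemma partial_fe_add v w i x : V v -> V w -> D x -> partial i (v + w) x = partial i v x + partial i w x.
Proof. by move=> hv hw Dx; apply: partialD; exact: fe_differentiable. Qed.

Lemma partial_fe_scale (c : R) v i x : V v -> D x -> partial i (c *: v) x = c * partial i v x.
Proof. by move=> hv Dx; apply: partialZ; exact: fe_differentiable. Qed.

Lemma hess_add v w x : V v -> V w -> hess T (v + w) x = hess T v x + hess T w x.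
Proof.
move=> hv hw; have [[j Tx]|nT] := pselect (exists j, T j x); last by rewrite !hess_out ?addr0.
apply/matrixP => k l; transitivity (hess T v x k l + hess T w x k l); last by rewrite [RHS]mxE.
apply: (etrans (hess_in (v + w) k l Tx)).
apply: (etrans _ (congr2 +%R (esym (hess_in v k l Tx)) (esym (hess_in w k l Tx)))).
apply: (etrans _ (partialD k (fe_partial_differentiable l hv Tx) (fe_partial_differentiable l hw Tx))).
apply: partial_near; apply: (open_near_eq domain_open (elem_sub Tx)) => y Dy.
exact: partial_fe_add.
Qed.

Lemma hess_scale (c : R) v x : V v -> hess T (c *: v) x = c *: hess T v x.
Proof.
move=> hv; have [[j Tx]|nT] := pselect (exists j, T j x); last by rewrite !hess_out ?scaler0.
apply/matrixP => k l; transitivity (c * hess T v x k l); last by rewrite [RHS]mxE.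
apply: (etrans (hess_in (c *: v) k l Tx)).
apply: (etrans _ (congr1 ( *%R c) (esym (hess_in v k l Tx)))).
apply: (etrans _ (partialZ k c (fe_partial_differentiable l hv Tx))).
apply: partial_near; apply: (open_near_eq domain_open (elem_sub Tx)) => y Dy.
exact: partial_fe_scale.
Qed.

End finite_elements.

(** * The H^1 norm and H^1_0 *)


Section extension_by_zero.
Variables (R : realType) (n : nat).
Local Notation E := 'rV[R]_n.
Variable D : set E.
Hypothesis oD : open D.

(** Derivatives are uncontrolled outside D, whereas difference quotients are evaluated at every
    point of the space. *)
Definition ext0 (f : E -> R) : E -> R := fun x => if `[< D x >] then f x else 0.

Lemma ext0_in f x : D x -> ext0 f x = f x.
Proof. by move=> Dx; rewrite /ext0 asboolT. Qed.

Lemma ext0_near f x : D x -> {near x, f =1 ext0 f}.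
Proof. by move=> Dx; apply: (open_near_eq oD Dx) => y Dy; rewrite ext0_in. Qed.

Lemma ext0_lip f : lipD D f -> lipD D (ext0 f).
Proof. by apply: lipD_eq => x Dx; rewrite ext0_in. Qed.

Lemma ext0_bmf f : bmf D f -> bmf setT (ext0 f).
Proof. by apply: bmf_patch; exact: open_measurable_rV. Qed.

Lemma ext0_differentiable f x : D x -> differentiable f x -> differentiable (ext0 f) x.
Proof. by move=> Dx; apply: near_differentiable; exact: ext0_near. Qed.

Lemma ext0_derive f x v : D x -> 'D_v (ext0 f) x = 'D_v f x.
Proof. by move=> Dx; apply/esym/near_eq_derive; exact: ext0_near. Qed.

End extension_by_zero.

(** * Multi-indices of degree at most one *)

Section multi_indices.
Variables (R : realType) (n : nat).
Local Notation E := 'rV[R]_n.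

Lemma mdeg_size (a : 'I_n -> nat) :
  size (flatten [seq nseq (a i) i | i <- enum 'I_n]) = mdeg a.
Proof.
rewrite size_flatten /shape -map_comp sumnE big_map /mdeg big_enum /=.
by apply: eq_bigr => i _; rewrite size_nseq.
Qed.

Lemma mpartial_le1 (a : 'I_n -> nat) : (mdeg a <= 1)%N ->
  (mdeg a = 0%N /\ forall f : E -> R, mpartial a f = f) \/
  (mdeg a = 1%N /\ exists2 i, (0 < a i)%N & forall f : E -> R, mpartial a f = partial i f).
Proof.
rewrite /mpartial => ha; have := mdeg_size a.
case e : (flatten _) => [|i [|j s]] /= h; rewrite -h.
- by left.
- right; split => //; exists i => //.
  have : i \in flatten [seq nseq (a i) i | i <- enum 'I_n] by rewrite e inE.
  move=> /flattenP[s /mapP[k _ ->]]; rewrite mem_nseq => /andP[k0 /eqP ik].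
  by rewrite ik.
- by rewrite -h in ha.
Qed.

Lemma mpartial_delta (i : 'I_n) : exists2 a : {ffun 'I_n -> 'I_2},
  (mdeg (mindex a) <= 1)%N & forall f : E -> R, mpartial (mindex a) f = partial i f.
Proof.
pose a : {ffun 'I_n -> 'I_2} := [ffun k => if k == i then inord 1 else inord 0].
have ai k : mindex a k = (k == i).
  by rewrite /mindex /a ffunE; case: eqP => _; rewrite inordK.
have ha : mdeg (mindex a) = 1%N.
  rewrite /mdeg (bigD1 i) //= ai eqxx big1 // => k /negbTE ki.
  by rewrite ai ki.
exists a; first by rewrite ha.
move=> f; have [|[]|[_ [k]]] := @mpartial_le1 (mindex a); first by rewrite ha.
  by rewrite ha.
by rewrite ai; case: eqP => [-> _|//]; exact.
Qed.

Lemma mpartial_zero : exists2 a : {ffun 'I_n -> 'I_2},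
  (mdeg (mindex a) <= 1)%N & forall f : E -> R, mpartial (mindex a) f = f.
Proof.
pose a : {ffun 'I_n -> 'I_2} := [ffun k => inord 0].
have ha : mdeg (mindex a) = 0%N.
  by rewrite /mdeg big1 // => k _; rewrite /mindex /a ffunE inordK.
exists a; first by rewrite ha.
move=> f; have [|[_]|[]] := @mpartial_le1 (mindex a); first by rewrite ha.
  exact.
by rewrite ha.
Qed.

End multi_indices.

Section sobolev.
Variables (R : realType) (n : nat).
Local Notation E := 'rV[R]_n.
Local Notation mu := (vol R n).
Variable D : set E.
Hypotheses (oD : open D) (cD : convexD D) (bD : bounded_set D).
Local Notation integ := (Rintegral mu D).
Implicit Types (f g v phi : E -> R).

Let mD : measurable D. Proof. exact: open_measurable_rV. Qed.
Let fD : (mu D < +oo)%E. Proof. exact: bounded_vol. Qed.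

Lemma test_nice phi : test D phi -> nice D phi.
Proof. by move=> [s _ _]; exact: smooth_nice. Qed.

Lemma test_support phi x : ~ closure [set x | phi x != 0] x -> phi x = 0.
Proof.
move=> h; apply/eqP/negP => /negP p; apply: h; exact: subset_closure.
Qed.

(** The integrand is the derivative of v phi, which is Lipschitz and supported in the compact
    support of phi. *)
Lemma test_by_parts v phi i : nice D v -> test D phi ->
  integ (fun x => v x * partial i phi x + phi x * partial i v x) = 0.
Proof.
move=> hv tphi; have hphi := test_nice tphi; have [_ cK KD] := tphi.
have [lv dv _] := hv; have [lphi dphi _] := hphi.
have lm : lipD D (fun x => v x * phi x).
  by apply: lipDM => //; exact: lipD_bounded.
apply: (@null_lagrangian1 R n D oD bD _ (ext0 D (fun x => v x * phi x)) cK KD _ _ _ (delta_mx ord0 i)).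
- move=> x nK; rewrite /ext0 (test_support nK) mulr0; by case: ifP.
- by apply: ext0_bmf => //; exact: lipD_bmf.
- exact: ext0_lip.
- by apply: bmfD; (apply: bmfM; [exact: nice_bmf|exact: nice_partial_bmf]).
- apply: aeW => x Dx; split.
    by apply: ext0_differentiable => //; apply: differentiableM; [exact: dv|exact: dphi].
  rewrite ext0_derive //.
  by have := partialM i (dv x Dx) (dphi x Dx).
Qed.

Lemma nice_locint v : bmf D v -> locint D v.
Proof.
move=> hv; split; first by case: hv.
move=> K cK KD; apply: bmf_integrable; last exact: bmfS hv.
- rewrite -[K]setCK; apply: measurableC; apply: open_measurable_rV.
  apply: closed_openC; apply: compact_closed => //; exact: norm_hausdorff.
- apply: bounded_vol; last exact: compact_bounded.
  rewrite -[K]setCK; apply: measurableC; apply: open_measurable_rV.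
  apply: closed_openC; apply: compact_closed => //; exact: norm_hausdorff.
Qed.

Lemma mpartial_bmf (a : 'I_n -> nat) v : nice D v -> (mdeg a <= 1)%N -> bmf D (mpartial a v).
Proof.
move=> hv /(@mpartial_le1 R)[[_ ->]|[_ [i _ ->]]]; first exact: nice_bmf.
exact: nice_partial_bmf.
Qed.

(** Puts [wderiv] in its first branch, so that the H^1 norm of a [nice] function is computed from
    its classical derivatives. *)
Lemma nice_wderiv (a : 'I_n -> nat) v : nice D v -> (mdeg a <= 1)%N ->
  is_wderiv D a v (mpartial a v).
Proof.
move=> hv ha; split.
- by apply: nice_locint; exact: nice_bmf.
- by apply: nice_locint; exact: mpartial_bmf.
move=> phi tphi; have hphi := test_nice tphi.
have [[-> e]|[-> [i _ e]]] := @mpartial_le1 R n a ha; rewrite !e.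
  by rewrite expr0 mul1r.
rewrite expr1 mulN1r; apply/eqP; rewrite -addr_eq0; apply/eqP.
rewrite -integD //.
- rewrite -[RHS](test_by_parts i hv tphi); apply: integ_eq => x _.
  by rewrite [X in _ + X]mulrC.
- by apply: bmfM; [exact: nice_bmf|exact: nice_partial_bmf].
- by apply: bmfM; [exact: nice_partial_bmf|exact: nice_bmf].
Qed.

(** The square of the H^1 norm, as a real number, on [nice] functions. *)
Definition energy v : R :=
  \sum_(a : {ffun 'I_n -> 'I_2} | (mdeg (mindex a) <= 1)%N) integ (fun x => mpartial (mindex a) v x ^+ 2).

Let sq_bmf f : bmf D f -> bmf D (fun x => f x ^+ 2).
Proof. by move=> h; apply: bmf_eq (bmfM h h) => x _; rewrite expr2. Qed.

Lemma energy_ge0 v : 0 <= energy v.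
Proof. by apply: sumr_ge0 => a _; apply: Rintegral_ge0 => x _; exact: sqr_ge0. Qed.

Lemma L2normE g : bmf D g ->
  ('N[mu]_(2%:E)[(EFin \o g) \_ D] `^ 2 = (integ (fun x => g x ^+ 2))%:E)%E.
Proof.
move=> hg; rewrite powR_Lnorm //.
have ig := bmf_integrable mD fD (sq_bmf hg).
rewrite /Rintegral fineK; last exact: integrable_fin_num.
rewrite [RHS]integral_mkcond; apply: eq_integral => x _.
rewrite /restrict /patch; case: ifP => _ /=.
  by rewrite powR_mulrn // real_normK ?num_real.
by rewrite normr0 powR0.
Qed.

Lemma snorm_energy v : nice D v -> snorm D 1 2%:E v = (Num.sqrt (energy v))%:E.
Proof.
move=> hv; rewrite /snorm /bnorm /=.
rewrite big_const /= card_unit /= adde0.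
rewrite (eq_bigr (fun a : {ffun 'I_n -> 'I_2} => (integ (fun x => mpartial (mindex a) v x ^+ 2))%:E)).
  rewrite sumEFin poweR_EFin -powR12_sqrt //; exact: energy_ge0.
move=> a ha; have hw := nice_wderiv hv ha.
by rewrite /wderiv asboolT // L2normE //; exact: mpartial_bmf.
Qed.

Lemma snorm_le v r : nice D v -> 0 <= r ->
  (snorm D 1 2%:E v <= r%:E)%E <-> energy v <= r ^+ 2.
Proof.
move=> hv r0; rewrite snorm_energy // lee_fin; split => h.
  by rewrite -(sqr_sqrtr (energy_ge0 v)) ler_pXn2r ?nnegrE ?sqrtr_ge0.
by apply: le_trans (ler_wsqrtr h) _; rewrite sqrtr_sqr ger0_norm.
Qed.

Lemma nice_Sobolev v : nice D v -> Sobolev D 1 2%:E v.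
Proof.
move=> hv; split; last by rewrite snorm_energy // ltry.
by move=> a ha; exists (mpartial a v); exact: nice_wderiv.
Qed.

Lemma mpartialB (a : 'I_n -> nat) f g x : nice D f -> nice D g -> (mdeg a <= 1)%N -> D x ->
  mpartial a (f - g) x = mpartial a f x - mpartial a g x.
Proof.
move=> [_ df _] [_ dg _] ha Dx.
have [[_ e]|[_ [i _ e]]] := @mpartial_le1 R n a ha; rewrite !e //.
by apply: partialB; [exact: df|exact: dg].
Qed.

Lemma energyB f g : nice D f -> nice D g -> energy (f - g) <= 2 * energy f + 2 * energy g.
Proof.
move=> hf hg; rewrite /energy !mulr_sumr -big_split; apply: ler_sum => a ha /=.
have bf := mpartial_bmf hf ha; have bg := mpartial_bmf hg ha.
rewrite -(integZ mD fD 2 (sq_bmf bf)) -(integZ mD fD 2 (sq_bmf bg)) -integD //; try by apply: bmfZ; exact: sq_bmf.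
apply: integ_le => //.
- exact: (sq_bmf (mpartial_bmf (niceB oD hf hg) ha)).
- by apply: bmfD; apply: bmfZ; exact: sq_bmf.
- move=> x Dx; rewrite mpartialB //.
  have := sqr_ge0 (mpartial (mindex a) f x + mpartial (mindex a) g x).
  by move: (mpartial _ f x) (mpartial _ g x) => y z; nra.
Qed.

Lemma energy_term (a : {ffun 'I_n -> 'I_2}) v : (mdeg (mindex a) <= 1)%N ->
  integ (fun x => mpartial (mindex a) v x ^+ 2) <= energy v.
Proof.
move=> ha; rewrite /energy (bigD1 a) //= lerDl; apply: sumr_ge0 => k _.
by apply: Rintegral_ge0 => x _; exact: sqr_ge0.
Qed.

(** From |g| <= e + g^2 / e, a substitute for the Cauchy-Schwarz inequality that is enough because
    only proportionality to e matters. *)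
Lemma L1_small g e : bmf D g -> 0 < e -> integ (fun x => g x ^+ 2) <= e ^+ 2 ->
  integ (fun x => `|g x|) <= e * (fine (mu D) + 1).
Proof.
move=> hg e0 he.
apply: (@le_trans _ _ (integ (fun x => e + e^-1 * g x ^+ 2))).
  apply: integ_le => //; first exact: bmf_norm.
    by apply: bmfD; [exact: bmf_cst|apply: bmfZ; exact: sq_bmf].
  move=> x _; rewrite -(ler_pM2l e0) mulrDr mulrA divff ?gt_eqF // mul1r.
  rewrite -real_normK ?num_real //; have := sqr_ge0 (e - `|g x|); have := normr_ge0 (g x).
  by move: `|g x| => y; nra.
rewrite integD //; [|exact: bmf_cst|by apply: bmfZ; exact: sq_bmf].
rewrite Rintegral_cst // (integZ mD fD _ (sq_bmf hg)) [leRHS]mulrDr lerD2l mulr1.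
by rewrite mulrC ler_pdivrMr // -expr2.
Qed.

Definition L1_energy v e := forall g, g = v \/ (exists i, g = partial i v) ->
  integ (fun x => `|g x|) <= e * (fine (mu D) + 1).

Lemma energy_L1 v e : nice D v -> 0 < e -> energy v <= e ^+ 2 -> L1_energy v e.
Proof.
move=> hv e0 he g hg.
have [a ha ga] : exists2 a : {ffun 'I_n -> 'I_2}, (mdeg (mindex a) <= 1)%N & g = mpartial (mindex a) v.
  case: hg => [->|[i ->]].
    by have [a ha e1] := @mpartial_zero R n; exists a.
  by have [a ha e1] := @mpartial_delta R n i; exists a.
apply: L1_small => //; first by rewrite ga; exact: mpartial_bmf.
by apply: le_trans he; rewrite ga; exact: energy_term.
Qed.

Definition functional (a0 : E -> R) (a : 'I_n -> E -> R) v : R :=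
  integ (fun x => a0 x * v x + \sum_i a i x * partial i v x).

Lemma functional_bound a0 a : bmf D a0 -> (forall i, bmf D (a i)) ->
  exists2 C, 0 <= C & forall v e, nice D v -> 0 < e -> energy v <= e ^+ 2 ->
    `|functional a0 a v| <= C * e.
Proof.
move=> h0 ha; have [_ [M0 hM0]] := h0.
pose M i := sval (cid (proj2 (ha i))).
have hM i x : D x -> `|a i x| <= M i by rewrite /M; case: cid => /= ?; exact.
pose B := `|M0| + \sum_i `|M i|.
have B0 : 0 <= B by rewrite addr_ge0 // sumr_ge0.
have vD0 : 0 <= fine (mu D) by rewrite fine_ge0.
exists (B * (fine (mu D) + 1) * n.+1%:R); first by rewrite !mulr_ge0 // addr_ge0.
move=> v e hv e0 he; have h := energy_L1 hv e0 he.
have bv := nice_bmf oD bD hv; have bp i := nice_partial_bmf i oD hv.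
apply: (@le_trans _ _ (integ (fun x => B * (`|v x| + \sum_i `|partial i v x|)))).
  apply: integ_abs_le => //.
  - by apply: bmfD; [exact: bmfM|apply: bmf_sum => i _; exact: bmfM].
  - by apply: bmfZ; apply: bmfD; [exact: bmf_norm|apply: bmf_sum => i _; exact: bmf_norm].
  move=> x Dx; apply: le_trans (ler_normD _ _) _; rewrite mulrDr; apply: lerD.
    rewrite normrM ler_wpM2r //; apply: le_trans (hM0 _ Dx) _; apply: le_trans (ler_norm _) _.
    by rewrite /B lerDl sumr_ge0.
  apply: le_trans (ler_norm_sum _ _ _) _; rewrite mulr_sumr; apply: ler_sum => i _.
  rewrite normrM ler_wpM2r //; apply: le_trans (hM _ _ Dx) _; apply: le_trans (ler_norm _) _.
  by rewrite /B (bigD1 i) //= addrCA lerDl addr_ge0 // sumr_ge0.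
rewrite integZ //; last first.
  by apply: bmfD; [exact: bmf_norm|apply: bmf_sum => i _; exact: bmf_norm].
rewrite -!mulrA ler_wpM2l // integD //; [|exact: bmf_norm|by apply: bmf_sum => i _; exact: bmf_norm].
rewrite integ_sum //; last by move=> i _; exact: bmf_norm.
rewrite [leRHS](_ : _ = e * (fine (mu D) + 1) + \sum_(i < n) e * (fine (mu D) + 1)); last first.
  rewrite sumr_const card_ord -[X in _ = _ + X]mulr_natr -natr1; ring.
apply: lerD; first by apply: h; left.
by apply: ler_sum => i _; apply: h; right; exists i.
Qed.

(** The functional is bounded in the H^1 norm, so its vanishing passes from test functions to their
    closure. *)
Lemma functional_H10 a0 a v : bmf D a0 -> (forall i, bmf D (a i)) ->
  (forall phi, test D phi -> functional a0 a phi = 0) ->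
  nice D v -> H10 D v -> functional a0 a v = 0.
Proof.
move=> h0 ha Lphi hv [_ hH]; have [C C0 hC] := functional_bound h0 ha.
apply/eqP; rewrite -normr_le0 leNgt; apply/negP => L0.
(* Chosen so that (C + 1) e is half of the supposedly nonzero value. *)
pose e := `|functional a0 a v| / (C + 1) / 2.
have C1 : 0 < C + 1 by apply: ltr_wpDl.
have e0 : 0 < e by rewrite !divr_gt0.
have [phi tphi hphi] := hH e e0.
have np := test_nice tphi; have nvp := niceB oD hv np.
have he : energy (v - phi) <= e ^+ 2 by apply/(snorm_le nvp (ltW e0)); exact: ltW.
have := hC _ _ nvp e0 he.
have -> : functional a0 a (v - phi) = functional a0 a v.
  rewrite -[RHS]subr0 -(Lphi _ tphi) /functional -integB //.
  - apply: integ_eq => x Dx; have [_ dv _] := hv; have [_ dp _] := np.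
    transitivity (a0 x * (v x - phi x) +
      (\sum_i a i x * partial i v x - \sum_i a i x * partial i phi x)); last by ring.
    congr (_ + _); rewrite -sumrB; apply: eq_bigr => i _.
    by rewrite partialB ?mulrBr //; [exact: dv|exact: dp].
  - by apply: bmfD; [apply: bmfM => //; exact: nice_bmf|apply: bmf_sum => i _; apply: bmfM => //; exact: nice_partial_bmf].
  - by apply: bmfD; [apply: bmfM => //; exact: nice_bmf|apply: bmf_sum => i _; apply: bmfM => //; exact: nice_partial_bmf].
move=> h; have : (C + 1) * e < `|functional a0 a v|.
  have -> : (C + 1) * e = `|functional a0 a v| / 2 by rewrite /e; field; rewrite gt_eqF.
  by lra.
rewrite mulrDl mul1r; lra.
Qed.

Lemma testB phi psi : test D phi -> test D psi -> test D (phi - psi).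
Proof.
move=> [s1 c1 d1] [s2 c2 d2].
have e s : dpart s (phi - psi) = dpart s phi - dpart s psi.
  elim: s => [//|i s IH]; rewrite /= IH; apply/funext => x.
  by apply: partialB; [exact: s1|exact: s2].
have sub : closure [set x | (phi - psi) x != 0] `<=`
    closure [set x | phi x != 0] `|` closure [set x | psi x != 0].
  rewrite -closureU; apply: closure_subset => x /= h.
  have [p0|p0] := eqVneq (phi x) 0; last by left.
  by right; move: h; rewrite !fctE p0 sub0r oppr_eq0.
split.
- by move=> s x; rewrite e; apply: differentiableB; [exact: s1|exact: s2].
- apply: (@subclosed_compact _ _ (closure [set x | phi x != 0] `|` closure [set x | psi x != 0])) => //.
    exact: closed_closure.
  exact: compactU.
- by apply: subset_trans sub _ => x [/d1|/d2].
Qed.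

Lemma H10_sub v w : nice D v -> nice D w -> H10 D v -> H10 D w -> H10 D (v - w).
Proof.
move=> hv hw [_ h1] [_ h2]; split; first by apply: nice_Sobolev; exact: niceB.
(* With e / 4, [energyB] bounds the energy by 4 (e / 4)^2 = (e / 2)^2, which leaves room for the
   strict inequality. *)
move=> e e0; have e2 : 0 < e / 4 by rewrite divr_gt0.
have [p tp hp] := h1 _ e2; have [q tq hq] := h2 _ e2.
exists (p - q); first exact: testB.
have np := niceB oD hv (test_nice tp); have nq := niceB oD hw (test_nice tq).
have -> : v - w - (p - q) = (v - p) - (w - q) by apply/funext => x; rewrite !fctE; ring.
apply: (@le_lt_trans _ _ (e / 2)%:E); last by rewrite lte_fin; lra.
apply/snorm_le; [exact: niceB|lra|].
have hp' : energy (v - p) <= (e / 4) ^+ 2 by apply/(snorm_le np (ltW e2)); exact: ltW.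
have hq' : energy (w - q) <= (e / 4) ^+ 2 by apply/(snorm_le nq (ltW e2)); exact: ltW.
by apply: le_trans (energyB np nq) _; nra.
Qed.

End sobolev.

(** * The cofactor form *)


Section cofactor_columns.
Variable R : realType.

Let o2 (i : nat) (h : (i < 2)%N) : 'I_2 := Ordinal h.
Let o3 (i : nat) (h : (i < 3)%N) : 'I_3 := Ordinal h.

Lemma cofactor2 (A : 'M[R]_2) (i j i' j' : 'I_2) : i' != i -> j' != j ->
  cofactor A i j = (-1) ^+ (i + j) * A i' j'.
Proof.
move=> hi hj; rewrite /cofactor det_mx11 !mxE; congr (_ * A _ _).
  by apply/val_inj; case: i i' hi => -[|[|//]] ? [] [|[|//]].
by apply/val_inj; case: j j' hj => -[|[|//]] ? [] [|[|//]].
Qed.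

Lemma det2 (A : 'M[R]_2) : \det A = A 0 0 * A 1 1 - A 0 1 * A 1 0.
Proof.
have -> : (0 : 'I_2) = @o2 0 isT by exact/val_inj.
have -> : (1 : 'I_2) = @o2 1 isT by exact/val_inj.
rewrite (expand_det_row _ (@o2 0 isT)) !big_ord_recl big_ord0 addr0.
have -> : ord0 = @o2 0 isT by exact/val_inj.
have -> : lift (@o2 0 isT) ord0 = @o2 1 isT by exact/val_inj.
rewrite (@cofactor2 A (@o2 0 isT) (@o2 0 isT) (@o2 1 isT) (@o2 1 isT)) //.
rewrite (@cofactor2 A (@o2 0 isT) (@o2 1 isT) (@o2 1 isT) (@o2 0 isT)) //=.
by rewrite expr0 expr1; ring.
Qed.

Lemma cofactor3 (A : 'M[R]_3) (i j a a' c c' : 'I_3) : (a < a')%N -> (c < c')%N ->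
  a != i -> a' != i -> c != j -> c' != j ->
  cofactor A i j = (-1) ^+ (i + j) * (A a c * A a' c' - A a c' * A a' c).
Proof.
move=> aa cc ai ai' cj cj'.
have l0 (k e e' : 'I_3) : (e < e')%N -> e != k -> e' != k -> lift k (0 : 'I_2) = e /\ lift k (1 : 'I_2) = e'.
  by case: k e e' => -[|[|[|//]]] ? [] [|[|[|//]]] ? [] [|[|[|//]]] //= ? _ _ _; split; exact/val_inj.
have [e1 e2] := l0 i a a' aa ai ai'; have [e3 e4] := l0 j c c' cc cj cj'.
by rewrite /cofactor det2 !mxE e1 e2 e3 e4.
Qed.

(** The pairing takes the shape of the two-factor null Lagrangian. The cyclic shift of two columns
    is odd, hence the remaining sign. *)
Lemma sum_cof2 (A : 'M[R]_2) (z : 'I_2 -> R) (l : 'I_2) :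
  \sum_k cofactor A k l * z k =
    (-1) ^+ l * (z (@o2 0 isT) * A (@o2 1 isT) (ordS l) - z (@o2 1 isT) * A (@o2 0 isT) (ordS l)).
Proof.
rewrite !big_ord_recl big_ord0 addr0.
have -> : ord0 = @o2 0 isT by exact/val_inj.
have -> : lift (@o2 0 isT) ord0 = @o2 1 isT by exact/val_inj.
have hl : ordS l != l by case: l => -[|[|//]].
rewrite (@cofactor2 A _ l (@o2 1 isT) (ordS l)) // (@cofactor2 A _ l (@o2 0 isT) (ordS l)) //=.
rewrite exprD exprD expr1 expr0; ring.
Qed.

(** The sum is the determinant with column l replaced by z. Taking the two other columns in cyclic
    order absorbs all cofactor signs, and the expansion is the integrand of the three-factor null
    Lagrangian. *)
Lemma sum_cof3 (A : 'M[R]_3) (z : 'I_3 -> R) (l : 'I_3) :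
  let p i := A i (ordS l) in let q i := A i (ordS (ordS l)) in
  let i0 := @o3 0 isT in let i1 := @o3 1 isT in let i2 := @o3 2 isT in
  \sum_k cofactor A k l * z k =
     z i0 * (p i1 * q i2 - p i2 * q i1) + z i1 * (p i2 * q i0 - p i0 * q i2)
     + z i2 * (p i0 * q i1 - p i1 * q i0).
Proof.
move=> p q i0 i1 i2; rewrite !big_ord_recl big_ord0 addr0.
have -> : ord0 = i0 by exact/val_inj.
have -> : lift i0 ord0 = i1 by exact/val_inj.
have -> : lift i0 (lift ord0 ord0) = i2 by exact/val_inj.
rewrite /p /q; case: l {p q} => -[|[|[|//]]] hl.
- have -> : ordS (Ordinal hl) = i1 by exact/val_inj.
  have -> : ordS i1 = i2 by exact/val_inj.
  rewrite (@cofactor3 A i0 (Ordinal hl) i1 i2 i1 i2) // (@cofactor3 A i1 (Ordinal hl) i0 i2 i1 i2) //.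
  rewrite (@cofactor3 A i2 (Ordinal hl) i0 i1 i1 i2) //= !addn0 !expr0 expr1 expr2; ring.
- have -> : ordS (Ordinal hl) = i2 by exact/val_inj.
  have -> : ordS i2 = i0 by exact/val_inj.
  rewrite (@cofactor3 A i0 (Ordinal hl) i1 i2 i0 i2) // (@cofactor3 A i1 (Ordinal hl) i0 i2 i0 i2) //.
  rewrite (@cofactor3 A i2 (Ordinal hl) i0 i1 i0 i2) //= !exprS !expr0; ring.
- have -> : ordS (Ordinal hl) = i0 by exact/val_inj.
  have -> : ordS i0 = i1 by exact/val_inj.
  rewrite (@cofactor3 A i0 (Ordinal hl) i1 i2 i0 i1) // (@cofactor3 A i1 (Ordinal hl) i0 i2 i0 i1) //.
  rewrite (@cofactor3 A i2 (Ordinal hl) i0 i1 i0 i1) //= !exprS !expr0; ring.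
Qed.

End cofactor_columns.

Section cofactor_divergence.
Variables (R : realType) (n : nat).
Local Notation E := 'rV[R]_n.
Local Notation mu := (vol R n).
Variables (D : set E) (m : nat) (nu : 'I_m -> E) (b : 'I_m -> R).
Hypothesis hD : polyhedral_domain D nu b.
Variables (N : nat) (T : 'I_N -> set E).
Hypothesis hT : mesh D T.
Variables (d : nat) (V : set (E -> R)).
Hypothesis hV : fe_space D d T V.
Variables (u w phi : E -> R) (l : 'I_n).
Hypotheses (Vu : V u) (Vw : V w) (tphi : test D phi).
Local Notation integ := (Rintegral mu D).
Let oD : open D := domain_open hD.
Let bD : bounded_set D := pd_bounded hD.
Let nphi : nice D phi := test_nice (domain_convex hD) bD tphi.

(** The compactly supported factor of the null Lagrangian; off the interelement boundaries its
    derivative is [cof_dzeta], by the product rule. *)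
Definition cof_zeta := ext0 D (fun x => phi x * partial l w x).
Definition cof_grad (a : 'I_n) := ext0 D (partial a u).
Definition cof_dzeta (k : 'I_n) x := phi x * hess T w x k l + partial l w x * partial k phi x.

Lemma cof_zetaK x : ~ closure [set x | phi x != 0] x -> cof_zeta x = 0.
Proof. by move=> nK; rewrite /cof_zeta /ext0 (test_support nK) mul0r; case: ifP. Qed.

Lemma cof_zeta_lip0 : lipD D (fun x => phi x * partial l w x).
Proof.
have [lphi _ _] := nphi; have lw := fe_partial_lip hD hT hV l Vw.
by apply: lipDM => //; exact: lipD_bounded.
Qed.

Lemma cof_zeta_lip : lipD D cof_zeta. Proof. exact/ext0_lip/cof_zeta_lip0. Qed.

Lemma cof_zeta_bmf : bmf setT cof_zeta.
Proof. by apply: (ext0_bmf oD); apply: lipD_bmf => //; exact: cof_zeta_lip0. Qed.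

Lemma cof_grad_lip a : lipD D (cof_grad a).
Proof. exact/ext0_lip/(fe_partial_lip hD hT hV a Vu). Qed.

Lemma cof_grad_bmf a : bmf setT (cof_grad a).
Proof. exact/(ext0_bmf oD)/(fe_partial_bmf hD hT hV a Vu). Qed.

Lemma cof_zeta_derive j x k : T j x ->
  differentiable cof_zeta x /\ 'D_(delta_mx ord0 k) cof_zeta x = cof_dzeta k x.
Proof.
move=> Tx; have Dx := elem_sub hD hT Tx; have [_ dphi _] := nphi.
have dw := fe_partial_differentiable hT hV l Vw Tx.
split; first by apply: (ext0_differentiable oD Dx); apply: differentiableM => //; exact: dphi.
rewrite (ext0_derive oD _ _ Dx) /cof_dzeta (hess_in w k l Tx).
exact: (partialM k (dphi x Dx) dw).
Qed.

Lemma cof_grad_derive j x a k : T j x ->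
  differentiable (cof_grad a) x /\ 'D_(delta_mx ord0 k) (cof_grad a) x = hess T u x k a.
Proof.
move=> Tx; have Dx := elem_sub hD hT Tx.
have du := fe_partial_differentiable hT hV a Vu Tx.
split; first exact: (ext0_differentiable oD Dx).
by rewrite (ext0_derive oD _ _ Dx) (hess_in u k a Tx).
Qed.

(** Formally the divergence of [cof_zeta] times the l-th column of cof D^2 u, the derivatives
    falling on [cof_zeta] alone. *)
Definition cof_div x := \sum_k cofactor (hess T u x) k l * cof_dzeta k x.

Lemma cof_div_bmf : bmf D cof_div.
Proof.
apply: bmf_sum => k _; apply: bmfM.
  by apply: bmf_cofactor => a c; exact: (hess_bmf hD hT hV a c Vu).
apply: bmfD; apply: bmfM.
- exact: (nice_bmf oD bD nphi).
- exact: (hess_bmf hD hT hV k l Vw).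
- exact: (fe_partial_bmf hD hT hV l Vw).
- exact: (nice_partial_bmf k oD nphi).
Qed.

End cofactor_divergence.

(* Weak form of the fact that the columns of cof D^2 u are divergence free,
   tested against phi times a derivative of w. *)
Lemma cof_div_integral (R : realType) (n : nat) (D : set 'rV[R]_n) (m : nat)
  (nu : 'I_m -> 'rV[R]_n) (b : 'I_m -> R) (hD : polyhedral_domain D nu b) (N : nat)
  (T : 'I_N -> set 'rV[R]_n) (hT : mesh D T) (d : nat) (V : set ('rV[R]_n -> R))
  (hV : fe_space D d T V) (u w phi : 'rV[R]_n -> R) (l : 'I_n) :
  n = 2%N \/ n = 3%N -> V u -> V w -> test D phi ->
  Rintegral (vol R n) D (cof_div T u w phi l) = 0.
Proof.
move=> hn; case: hn D m nu b hD N T hT d V hV u w phi l => ->.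
- move=> D m nu b hD N T hT d V hV u w phi l Vu Vw tphi.
  have [_ cK KD] := tphi.
  (* The sign left by [sum_cof2] is squared away, so that the integrand becomes exactly the
     two-factor null Lagrangian. *)
  have -> : Rintegral (vol R 2) D (cof_div T u w phi l) =
     (-1) ^+ l * Rintegral (vol R 2) D (fun x => (-1) ^+ l * cof_div T u w phi l x).
    rewrite -(integZ (domain_measurable hD) (domain_finite hD)); last first.
      by apply: bmfZ; exact: (cof_div_bmf hD hT hV l Vu Vw tphi).
    by apply: integ_eq => x _; rewrite mulrA -exprD addnn -mul2n exprM sqrrN !expr1n mul1r.
  suff -> : Rintegral (vol R 2) D (fun x => (-1) ^+ l * cof_div T u w phi l x) = 0 by rewrite mulr0.
  apply: (@null_lagrangian2 R 2 D (domain_open hD) (pd_bounded hD) _ (cof_zeta D w phi l) cK KD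
    (@cof_zetaK R 2 D w phi l) (cof_zeta_bmf hD hT hV l Vw tphi) (cof_zeta_lip hD hT hV l Vw tphi)
    (cof_grad D u (ordS l)) (delta_mx ord0 (Ordinal (isT : (0 < 2)%N)))
    (delta_mx ord0 (Ordinal (isT : (1 < 2)%N)))) => //.
  + exact: (cof_grad_bmf hD hT hV Vu _).
  + exact: (cof_grad_lip hD hT hV Vu _).
  + by apply: bmfZ; exact: (cof_div_bmf hD hT hV l Vu Vw tphi).
  + apply: filterS (ae_elem hT) => x h Dx; have [j Tx] := h Dx.
    have z k := cof_zeta_derive hD hT hV l Vw tphi k Tx.
    have p a k := cof_grad_derive hD hT hV Vu a k Tx.
    split; [by case: (z (Ordinal (isT : (0 < 2)%N)))|by case: (p (ordS l) (Ordinal (isT : (0 < 2)%N)))|].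
    rewrite /cof_div sum_cof2 (proj2 (z _)) (proj2 (z _)) (proj2 (p _ _)) (proj2 (p _ _)).
    by rewrite mulrA -exprD addnn -mul2n exprM sqrrN !expr1n mul1r.
- move=> D m nu b hD N T hT d V hV u w phi l Vu Vw tphi.
  have [_ cK KD] := tphi.
  apply: (@null_lagrangian3 R 3 D (domain_open hD) (pd_bounded hD) _ (cof_zeta D w phi l) cK KD
    (@cof_zetaK R 3 D w phi l) (cof_zeta_bmf hD hT hV l Vw tphi) (cof_zeta_lip hD hT hV l Vw tphi)
    (cof_grad D u (ordS l)) (cof_grad D u (ordS (ordS l)))
    (delta_mx ord0 (Ordinal (isT : (0 < 3)%N))) (delta_mx ord0 (Ordinal (isT : (1 < 3)%N)))
    (delta_mx ord0 (Ordinal (isT : (2 < 3)%N)))) => //.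
  + exact: (cof_grad_bmf hD hT hV Vu _).
  + exact: (cof_grad_lip hD hT hV Vu _).
  + exact: (cof_grad_bmf hD hT hV Vu _).
  + exact: (cof_grad_lip hD hT hV Vu _).
  + exact: (cof_div_bmf hD hT hV l Vu Vw tphi).
  + apply: filterS (ae_elem hT) => x h Dx; have [j Tx] := h Dx.
    have z k := cof_zeta_derive hD hT hV l Vw tphi k Tx.
    have p a k := cof_grad_derive hD hT hV Vu a k Tx.
    split; [by case: (z (Ordinal (isT : (0 < 3)%N)))|by case: (p (ordS l) (Ordinal (isT : (0 < 3)%N)))
      |by case: (p (ordS (ordS l)) (Ordinal (isT : (0 < 3)%N)))|].
    rewrite /cof_div sum_cof3 !(proj2 (z _)).
    by congr (_ * (_ * _ - _ * _) + _ * (_ * _ - _ * _) + _ * (_ * _ - _ * _));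
      apply/esym; exact: (proj2 (p _ _)).
Qed.

Section cofactor_form.
Variables (R : realType) (n : nat).
Local Notation E := 'rV[R]_n.
Local Notation mu := (vol R n).
Hypothesis hn : n = 2%N \/ n = 3%N.
Variables (D : set E) (m : nat) (nu : 'I_m -> E) (b : 'I_m -> R).
Hypothesis hD : polyhedral_domain D nu b.
Variables (N : nat) (T : 'I_N -> set E).
Hypothesis hT : mesh D T.
Variables (d : nat) (V : set (E -> R)).
Hypothesis hV : fe_space D d T V.
Implicit Types (u w v z : E -> R).
Local Notation integ := (Rintegral mu D).
Let oD : open D := domain_open hD.
Let bD : bounded_set D := pd_bounded hD.

Lemma cof_formE u w v x : cof_form T u w v x =
  \sum_k (\sum_l cofactor (hess T u x) k l * partial l w x) * partial k v x.
Proof.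
rewrite /cof_form /dot; apply: eq_bigr => k _; rewrite !mxE; congr (_ * _).
by apply: eq_bigr => l _; rewrite !mxE mulrC.
Qed.

Definition hess_pair u w x : R := \sum_k \sum_l cofactor (hess T u x) k l * hess T w x k l.

(** Laplace expansion along each of the n rows. *)
Lemma hess_pair_diag u x : hess_pair u u x = n%:R * \det (hess T u x).
Proof.
rewrite /hess_pair (eq_bigr (fun=> \det (hess T u x))).
  by rewrite sumr_const card_ord mulr_natl.
by move=> k _; rewrite (expand_det_row _ k); apply: eq_bigr => l _; rewrite mulrC.
Qed.

Lemma cofactor_hess_bmf u k l : V u -> bmf D (fun x => cofactor (hess T u x) k l).
Proof. by move=> Vu; apply: bmf_cofactor => a c; exact: (hess_bmf hD hT hV a c Vu). Qed.

Lemma hess_pair_bmf u w : V u -> V w -> bmf D (hess_pair u w).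
Proof.
move=> Vu Vw; do 2 (apply: bmf_sum => ? _); apply: bmfM; first exact: cofactor_hess_bmf.
exact: (hess_bmf hD hT hV _ _ Vw).
Qed.

Lemma cof_coef_bmf u w k : V u -> V w ->
  bmf D (fun x => \sum_l cofactor (hess T u x) k l * partial l w x).
Proof.
move=> Vu Vw; apply: bmf_sum => l _; apply: bmfM; first exact: cofactor_hess_bmf.
exact: (fe_partial_bmf hD hT hV l Vw).
Qed.

Lemma cof_form_bmf u w v : V u -> V w -> V v -> bmf D (cof_form T u w v).
Proof.
move=> Vu Vw Vv; apply: (@bmf_eq _ _ _ (fun x => \sum_k (\sum_l cofactor (hess T u x) k l * partial l w x) * partial k v x)).
  by move=> x _; rewrite cof_formE.
apply: bmf_sum => k _; apply: bmfM; first exact: cof_coef_bmf.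
exact: (fe_partial_bmf hD hT hV k Vv).
Qed.

(** The sum of the two integrals is a first order functional of v with bounded coefficients. For a
    test function its integrand is the sum of [cof_div] over the columns, which integrates to 0;
    density extends this to v. *)
Lemma cof_form_by_parts u w v : V u -> V w -> V v -> H10 D v ->
  integ (cof_form T u w v) = - integ (fun x => hess_pair u w x * v x).
Proof.
move=> Vu Vw Vv Hv; have nv := fe_nice hD hT hV Vv.
have := @functional_H10 R n D oD (domain_convex hD) bD (hess_pair u w)
  (fun k x => \sum_l cofactor (hess T u x) k l * partial l w x) v
  (hess_pair_bmf Vu Vw) (fun k => cof_coef_bmf k Vu Vw) _ nv Hv.
have step : forall phi, test D phi -> functional D (hess_pair u w)
  (fun k x => \sum_l cofactor (hess T u x) k l * partial l w x) phi = 0.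
  move=> phi tphi; rewrite /functional.
  transitivity (integ (fun x => \sum_l cof_div T u w phi l x)).
    apply: integ_eq => x Dx; rewrite /hess_pair /cof_div exchange_big /= mulr_suml.
    rewrite [X in _ + X](eq_bigr (fun k => \sum_l cofactor (hess T u x) k l * partial l w x * partial k phi x)); last first.
      by move=> k _; rewrite mulr_suml.
    rewrite [X in _ + X]exchange_big -big_split /=; apply: eq_bigr => l _.
    rewrite mulr_suml -big_split /=; apply: eq_bigr => k _.
    by rewrite /cof_dzeta; ring.
  rewrite (integ_sum (domain_measurable hD) (domain_finite hD)).
    by rewrite big1 // => l _; exact: (cof_div_integral hD hT hV).
  by move=> l _; exact: (cof_div_bmf hD hT hV l Vu Vw tphi).
move=> /(_ step); rewrite /functional (integD (domain_measurable hD) (domain_finite hD)).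
- move=> /eqP; rewrite addr_eq0 => /eqP e; rewrite e opprK.
  by apply: integ_eq => x _; rewrite cof_formE.
- by apply: bmfM; [exact: hess_pair_bmf|exact: (fe_bmf hD hT hV Vv)].
- apply: bmf_sum => k _; apply: bmfM; first exact: cof_coef_bmf.
  exact: (fe_partial_bmf hD hT hV k Vv).
Qed.

End cofactor_form.

(** * Coercivity *)


Section positive_definite.
Variable R : realType.

Lemma dotC n (x y : 'rV[R]_n) : dot x y = dot y x.
Proof. by apply: eq_bigr => i _; rewrite mulrC. Qed.

Lemma dotDl n (x y z : 'rV[R]_n) : dot (x + y) z = dot x z + dot y z.
Proof. by rewrite dotC dotD !(dotC z). Qed.

Lemma dotZl n (c : R) (x z : 'rV[R]_n) : dot (c *: x) z = c * dot x z.
Proof. by rewrite dotC dotZ dotC. Qed.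

Lemma dot_ge0 n (x : 'rV[R]_n) : 0 <= dot x x.
Proof. by apply: sumr_ge0 => i _; rewrite -expr2 sqr_ge0. Qed.

Lemma dot_eq0 n (x : 'rV[R]_n) : dot x x = 0 -> x = 0.
Proof.
move=> h; apply/rowP => i; rewrite mxE; apply/eqP; rewrite -sqrf_eq0; apply/eqP.
have e k : x ord0 k * x ord0 k = x ord0 k ^+ 2 by rewrite expr2.
move: h; rewrite /dot (eq_bigr _ (fun k _ => e k)) => h.
by apply: (psumr_eq0P _ h) => // k _; exact: sqr_ge0.
Qed.

Definition posdef n (H : 'M[R]_n) : Prop := forall x : 'rV[R]_n, x != 0 -> 0 < dot (x *m H) x.

Lemma quad_pf n (H : 'M[R]_n) : pf (fun x : 'rV[R]_n => dot (x *m H) x).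
Proof.
apply: pf_sum => j _; apply: pf_mul; last exact: pf_coor.
rewrite (_ : (fun _ => _) = fun x : 'rV[R]_n => \sum_i x ord0 i * H i j).
  by apply: pf_sum => i _; apply: pf_mul; [exact: pf_coor|exact: pf_cst].
by apply/funext => x; rewrite mxE.
Qed.

(* The minimum of the Rayleigh quotient is an eigenvalue. *)
Lemma eigenvalue_posdef n (H : 'M[R]_n.+1) : H^T = H ->
  (forall a, eigenvalue H a -> 0 < a) -> posdef H.
Proof.
move=> sH eH.
pose q (x : 'rV[R]_n.+1) := dot (x *m H) x.
pose S := [set x : 'rV[R]_n.+1 | dot x x = 1].
have cq : continuous q by apply: pf_continuous; exact: quad_pf.
have cdd : continuous (fun x : 'rV[R]_n.+1 => dot x x).
  rewrite (_ : (fun x => _) = fun x : 'rV[R]_n.+1 => dot (x *m 1%:M) x).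
    by apply: pf_continuous; exact: quad_pf.
  by apply/funext => x; rewrite mulmx1.
have S0 : S !=set0.
  exists (delta_mx ord0 ord0); rewrite /S /= /dot (bigD1 ord0) //= !mxE !eqxx mulr1.
  by rewrite big1 ?addr0 // => i /negbTE h; rewrite !mxE h mul0r.
have cS : compact S.
  apply: bounded_closed_compact; last first.
    apply: (@closed_comp _ _ (fun x : 'rV[R]_n.+1 => dot x x) [set 1]).
      by move=> x _; exact: cdd.
    exact: closed_eq.
  exists 1; split; rewrite ?num_real // => M M1 x Sx /=.
  rewrite [`|x|](_ : _ = mx_norm x) // mx_normrE; apply/bigmax_leP; split.
    by rewrite (le_trans ler01) // ltW.
  move=> [i j] _ /=; rewrite (ord1 i); apply: le_trans (ltW M1).
  rewrite -(ler_pXn2r (n := 2)) ?nnegrE // expr1n real_normK ?num_real //.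
  have Sx' : \sum_(i < n.+1) x ord0 i * x ord0 i = 1 := Sx.
  rewrite -Sx' (bigD1 j) //= expr2 lerDl; apply: sumr_ge0 => k _.
  by rewrite -expr2 sqr_ge0.
have [c cS' cmin] : exists2 c, c \in S & forall t, t \in S -> q c <= q t.
  by apply: EVT_min_rV => //; apply: continuous_subspaceT.
have Sc : dot c c = 1 by move: cS'; rewrite inE.
pose mu := q c.
have qge x : mu * dot x x <= q x.
  have [x0|xn0] := eqVneq x 0.
    by rewrite x0 /q mul0mx /dot !big1 ?mulr0 // => i _; rewrite !mxE mul0r.
  have dx : 0 < dot x x.
    rewrite lt_neqAle dot_ge0 andbT eq_sym; apply: contra_neq xn0; exact: dot_eq0.
  pose s := Num.sqrt (dot x x).
  have s2 : s * s = dot x x by rewrite -expr2 sqr_sqrtr // ltW.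
  have s0 : 0 < s by rewrite sqrtr_gt0.
  have Ss : (s^-1 *: x) \in S.
    by rewrite inE /S /= dotZl dotZ -s2; field; rewrite gt_eqF.
  have := cmin _ Ss; rewrite /q -scalemxAl dotZl dotZ mulrA -/mu.
  rewrite -invfM s2 mulrC ler_pdivlMr //.
have sym x y : dot (x *m H) y = dot (y *m H) x.
  rewrite /dot; under eq_bigr do rewrite mxE mulr_suml.
  rewrite exchange_big /=; apply: eq_bigr => i _; rewrite mxE mulr_suml.
  apply: eq_bigr => j _; rewrite -[in RHS]sH mxE; ring.
(* First variation at the minimiser: a quadratic in t that is nonnegative for all t and has no
   constant term has no linear term. *)
have crit y : dot (c *m H) y = mu * dot c y.
  apply/eqP; rewrite -subr_eq0; apply/negP => /negP b0.
  pose B := dot (c *m H) y - mu * dot c y.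
  pose r := q y - mu * dot y y.
  have r0 : 0 <= r by rewrite subr_ge0.
  have exp t : 0 <= 2 * t * B + t ^+ 2 * r.
    have := qge (c + t *: y); rewrite /q mulmxDl -scalemxAl !dotDl !dotD !dotZl !dotZ.
    rewrite (sym y c) (dotC y c) Sc -/(q c) -/(q y) -/mu /B /r.
    by rewrite -subr_ge0 => h; apply: le_trans h _; rewrite le_eqVlt; apply/orP; left; apply/eqP; ring.
  have r1 : 0 < r + 1 by lra.
  (* Close to the minimum of the quadratic in t; r + 1 replaces r to allow r = 0, and the value is
     still negative when B is nonzero. *)
  have := exp (- B / (r + 1)).
  have -> : 2 * (- B / (r + 1)) * B + (- B / (r + 1)) ^+ 2 * r = - (B ^+ 2 * (r + 2) / (r + 1) ^+ 2).
    by field; rewrite gt_eqF.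
  rewrite oppr_ge0 leNgt => /negP; apply.
  have B2 : 0 < B ^+ 2 by rewrite exprn_even_gt0.
  by rewrite divr_gt0 ?exprn_gt0 // mulr_gt0 //; lra.
have emu : eigenvalue H mu.
  apply/eigenvalueP; exists c; last first.
    by apply: contra_eq_neq Sc => ->; rewrite dot0l eq_sym oner_neq0.
  apply/rowP => i.
  have dd (v : 'rV[R]_n.+1) : dot v (delta_mx ord0 i) = v ord0 i.
    rewrite /dot (bigD1 i) //= mxE !eqxx mulr1 big1 ?addr0 // => k /negbTE h.
    by rewrite mxE h andbF mulr0.
  by rewrite -(dd (c *m H)) crit -(dd (mu *: c)) dotZl.
have mu0 := eH _ emu.
move=> x x0; apply: lt_le_trans (qge x); rewrite mulr_gt0 //.
rewrite lt_neqAle dot_ge0 andbT eq_sym; apply: contra_neq x0; exact: dot_eq0.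
Qed.

Lemma quad_cons n (H : 'M[R]_n.+1) (x : 'rV[R]_n) :
  dot (rV_cons (0, x) *m H) (rV_cons (0, x)) = dot (x *m row' ord0 (col' ord0 H)) x.
Proof.
rewrite /dot big_ord_recl rV_consE0 mulr0 add0r; apply: eq_bigr => j _.
rewrite rV_consES; congr (_ * _); rewrite !mxE big_ord_recl rV_consE0 mul0r add0r.
by apply: eq_bigr => i _; rewrite rV_consES !mxE.
Qed.

Lemma posdef_minor n (H : 'M[R]_n.+1) : posdef H -> posdef (row' ord0 (col' ord0 H)).
Proof.
move=> pH x x0; rewrite -quad_cons; apply: pH; apply: contra_neq x0 => h.
by apply/rowP => i; rewrite -[LHS](rV_consES (0, x)) h !mxE.
Qed.

(** For x the first row of the adjugate, x H = (det H) e_0, so the quadratic form at x is det H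
    times the principal minor, positive by induction. *)
Lemma posdef_det n (H : 'M[R]_n) : posdef H -> 0 < \det H.
Proof.
elim: n H => [|n IH] H pH; first by rewrite det_mx00.
have mpos := IH _ (posdef_minor pH).
pose x := row ord0 (\adj H).
have x0 : x ord0 ord0 = \det (row' ord0 (col' ord0 H)).
  by rewrite !mxE /cofactor addn0 expr0 mul1r.
have xH : x *m H = \det H *: delta_mx ord0 ord0.
  rewrite -row_mul mul_adj_mx; apply/rowP => i; rewrite !mxE eqxx /=.
  by rewrite eq_sym mulr_natr.
have xn0 : x != 0 by apply: contraTneq mpos => h; rewrite -x0 h mxE ltxx.
have := pH x xn0; rewrite xH dotZl /dot (bigD1 ord0) //= mxE !eqxx mul1r big1.
  by rewrite addr0 x0 pmulr_lgt0.
by move=> i /negbTE h; rewrite mxE h andbF mul0r.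
Qed.

(** The transpose of cof H is the adjugate; with x = g adj H one has x H = (det H) g, so the form at
    g equals that of H at x divided by det H. *)
Lemma posdef_cof n (H : 'M[R]_n) (g : 'rV[R]_n) : posdef H ->
  0 <= dot (g *m (cof H)^T) g /\ (dot (g *m (cof H)^T) g = 0 -> g = 0).
Proof.
move=> pH; have dH := posdef_det pH.
have -> : (cof H)^T = \adj H by apply/matrixP => i j; rewrite !mxE.
pose x := g *m \adj H.
have xH : x *m H = \det H *: g by rewrite /x -mulmxA mul_adj_mx mul_mx_scalar.
have e : dot (g *m \adj H) g = (\det H)^-1 * dot (x *m H) x.
  by rewrite xH dotZl mulrA mulVf ?gt_eqF // mul1r dotC.
have [x0|xn0] := eqVneq x 0.
  have g0 : g = 0.
    move: xH; rewrite x0 mul0mx => /esym/eqP; rewrite scaler_eq0 gt_eqF //= => /eqP//.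
  by rewrite e x0 mul0mx dot0l mulr0.
have p : 0 < dot (g *m \adj H) g by rewrite e mulr_gt0 ?invr_gt0 //; exact: pH.
by split; [exact: ltW|move=> h; rewrite h ltxx in p].
Qed.

End positive_definite.

(** Off the elements the Hessian is set to 0; its cofactors vanish because its minors are nonempty,
    whence the bound on k, the empty determinant being 1. *)
Lemma det0_pred (R : realType) k : (1 < k)%N -> \det (0 : 'M[R]_k.-1) = 0.
Proof. by case: k => [//|[//|k]] _; rewrite det0. Qed.

Section coercivity.
Variables (R : realType) (n : nat).
Local Notation E := 'rV[R]_n.
Local Notation mu := (vol R n).
Hypothesis hn : (1 < n)%N.
Variables (D : set E) (m : nat) (nu : 'I_m -> E) (b : 'I_m -> R).
Hypothesis hD : polyhedral_domain D nu b.
Variables (N : nat) (T : 'I_N -> set E).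
Hypothesis hT : mesh D T.
Variables (d : nat) (V : set (E -> R)).
Hypothesis hV : fe_space D d T V.
Implicit Types (u w v z : E -> R).
Local Notation integ := (Rintegral mu D).
Let oD : open D := domain_open hD.
Let bD : bounded_set D := pd_bounded hD.

Lemma pf_det k (A : E -> 'M[R]_k) : (forall i j, pf (fun x => A x i j)) ->
  pf (fun x => \det (A x)).
Proof.
move=> h; apply: pf_sum => s _; apply: pf_mul; first exact: pf_cst.
by apply: pf_prod => a _; exact: h.
Qed.

Lemma pf_cofactor k (A : E -> 'M[R]_k) : (forall i j, pf (fun x => A x i j)) ->
  forall i j, pf (fun x => cofactor (A x) i j).
Proof.
move=> h i j; apply: pf_mul; first exact: pf_cst.
apply: pf_det => a c; rewrite (_ : (fun _ => _) = fun x => A x (lift i a) (lift j c)) //.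
by apply/funext => x; rewrite !mxE.
Qed.

Lemma cof_form_continuous u z j x : V u -> V z -> T j x ->
  {for x, continuous (cof_form T u z z)}.
Proof.
move=> Vu Vz Tx; have [P [pP eP]] := fe_pieces hV Vu; have [Q [pQ eQ]] := fe_pieces hV Vz.
pose F y := \sum_k (\sum_l cofactor (\matrix_(k, l) partial k (partial l (P j)) y) k l * partial l (Q j) y) * partial k (Q j) y.
apply: (@near_continuous _ _ F).
  apply: (elem_near_eq hT Tx) => y Ty; rewrite cof_formE /F.
  have eq k : partial k z y = partial k (Q j) y.
    by apply: partial_near; apply: (elem_near_eq hT Ty); exact: eQ.
  have eh : hess T u y = \matrix_(k, l) partial k (partial l (P j)) y.
    by apply/matrixP => k l; rewrite (hess_piece hT _ _ (eP j) Ty) mxE.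
  by rewrite eh; apply: eq_bigr => k _; rewrite eq; congr (_ * _); apply: eq_bigr => l _; rewrite eq.
apply: pf_continuous; apply: pf_sum => k _; apply: pf_mul; last exact: pf_partial.
apply: pf_sum => l _; apply: pf_mul; last exact: pf_partial.
apply: pf_cofactor => a c.
rewrite (_ : (fun _ => _) = partial a (partial c (P j))).
  by do 2 apply: pf_partial; exact: pP.
by apply/funext => y; rewrite mxE.
Qed.

Lemma cof_form_out u w v x : ~ (exists j, T j x) -> cof_form T u w v x = 0.
Proof.
move=> nT; rewrite cof_formE big1 // => k _; rewrite big1 ?mul0r // => l _.
rewrite hess_out // /cofactor (_ : row' _ _ = 0).
  by rewrite det0_pred // mulr0 mul0r.
by apply/matrixP => a c; rewrite !mxE.
Qed.

Section definiteness.
Variable u : E -> R.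
Hypothesis Vu : V u.
Hypothesis eigu : forall j x, T j x -> forall a, eigenvalue (hess T u x) a -> 0 < a.

Lemma hess_posdef j x : T j x -> posdef (hess T u x).
Proof.
move=> Tx.
have sH : (hess T u x)^T = hess T u x.
  by apply/matrixP => k l; rewrite mxE; exact: (hess_sym hT hV).
have := eigu Tx; move: (hess T u x) sH.
by case: n hn => [//|k] _ H sH; exact: eigenvalue_posdef.
Qed.

Lemma cof_form_ge0 z x : 0 <= cof_form T u z z x.
Proof.
have [[j Tx]|nT] := pselect (exists j, T j x); last by rewrite cof_form_out.
by have [] := posdef_cof (grad z x) (hess_posdef Tx).
Qed.

(** A nonnegative integrand with zero integral vanishes inside each element, so the gradient of z
    does; by continuity it vanishes on D, z is constant there, and a constant in H^1_0 is 0. *)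
Lemma cof_form_definite z : V z -> H10 D z -> integ (cof_form T u z z) = 0 -> z = 0.
Proof.
move=> Vz Hz I0; have nz := fe_nice hD hT hV Vz.
have g0 j x k : T j x -> partial k z x = 0.
  move=> Tx.
  have f0 : cof_form T u z z x = 0.
    apply: (@integ_eq0_open R n D (domain_measurable hD) (domain_finite hD) _ (T j)) => //.
    - exact: (cof_form_bmf hD hT hV).
    - by move=> y _; exact: cof_form_ge0.
    - exact: (elem_open hT).
    - exact: (elem_sub hD hT).
    - by move=> y Ty; exact: (cof_form_continuous Vu Vz Ty).
  have [_ h] := posdef_cof (grad z x) (hess_posdef Tx).
  by have /rowP/(_ k) := h f0; rewrite !mxE.
have gD k x : D x -> partial k z x = 0.
  move=> Dx; have [j cT] := elem_cover hT Dx.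
  have [_ _ cz] := nz.
  apply: (eq_on_closure oD Dx cT (cz k x Dx) (g := fun=> 0)).
    exact: cst_continuous.
  by move=> y Ty; exact: g0 Ty.
have [x0 Dx0] := pd_nonempty hD.
have zc x : D x -> z x = z x0.
  move=> Dx; have [_ dz _] := nz.
  have := @mean_value_bound R n D z 0 (domain_convex hD) (lexx _) dz _ x x0 Dx Dx0.
  have h i y : D y -> `|partial i z y| <= 0 by move=> Dy; rewrite gD // normr0.
  by move=> /(_ h); rewrite mulr0 mul0r normr_le0 subr_eq0 => /eqP.
pose i0 : 'I_n := Ordinal (ltnW hn).
have ncoor : nice D (fun x : E => x ord0 i0).
  have p : pf (fun x : E => x ord0 i0) by exact: pf_coor.
  split; [exact: lipD_coor|by move=> x _; exact: pf_differentiable|].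
  by move=> i x _; apply: pf_continuous; exact: pf_partial.
(* Integral of the derivative of x_0 z in the first direction: zero for test functions, hence for z.
   For constant z it is that constant times the volume of D. *)
have F0 : functional D (fun=> 1) (fun i x => if i == i0 then x ord0 i0 else 0) z = 0.
  apply: (functional_H10 oD (domain_convex hD) bD) => //.
  - exact: bmf_cst.
  - by move=> i; case: (i == i0); [exact: (nice_bmf oD bD ncoor)|exact: bmf_cst].
  move=> phi tphi; apply: etrans (test_by_parts oD (domain_convex hD) bD i0 ncoor tphi).
  apply: integ_eq => x Dx; rewrite (bigD1 i0) //= ?eqxx big1 ?addr0.
    by rewrite partial_coor eqxx mulr1 mul1r addrC.
  by move=> i /negbTE ->; rewrite mul0r.
have z0 : z x0 = 0.
  have : functional D (fun=> 1) (fun i x => if i == i0 then x ord0 i0 else 0) z = z x0 * fine (mu D).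
    rewrite -(Rintegral_cst mu (domain_measurable hD) (z x0)).
    apply: integ_eq => x Dx; rewrite big1 ?addr0 ?mul1r ?zc // => i _.
    by rewrite gD ?mulr0.
  rewrite F0 => /esym/eqP; rewrite mulf_eq0 => /orP[/eqP //|].
  by rewrite gt_eqF // (domain_vol_gt0 hD).
apply/funext => x; have [Dx|nD] := pselect (D x); first by rewrite zc.
exact: (fe_outside hV Vz nD).
Qed.

End definiteness.

End coercivity.

(** * Newton iteration in finite dimension *)


Section geometric_sequences.
Variables (R : realType) (k : nat).
Implicit Types (c : nat -> 'rV[R]_k).

(** The last factor is the sum of the first j powers of 1/2. *)
Lemma geometric_tail c (s : R) : (forall i, `|c i.+1 - c i| <= s * 2^-1 ^+ i) ->
  forall i j, `|c (i + j)%N - c i| <= s * 2^-1 ^+ i * (2 - 2 * 2^-1 ^+ j).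
Proof.
move=> h i; elim=> [|j IH]; first by rewrite addn0 subrr normr0 expr0 mulr1 subrr mulr0.
have -> : c (i + j.+1)%N - c i = (c (i + j).+1 - c (i + j)%N) + (c (i + j)%N - c i).
  by rewrite addnS addrA subrK.
apply: le_trans (ler_normD _ _) _; apply: le_trans (lerD (h _) IH) _.
by rewrite exprD exprS le_eqVlt; apply/orP; left; apply/eqP; field.
Qed.

Lemma half_exp_small (e : R) : 0 < e -> exists i, 2^-1 ^+ i < e :> R.
Proof.
move=> e0; have := @cvg_geometric R 1 2^-1; rewrite ger0_norm ?invr_ge0 // => /(_ _).
have h : 2^-1 < 1 :> R by lra.
move=> /(_ h) /cvgrPdist_lt /(_ _ e0) [i _ hi]; exists i.
by have := hi i (leqnn _); rewrite /geometric /= mul1r sub0r normrN ger0_norm ?exprn_ge0 ?invr_ge0.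
Qed.

Lemma geometric_limit c (s : R) : 0 <= s -> (forall i, `|c i.+1 - c i| <= s * 2^-1 ^+ i) ->
  exists l : 'rV[R]_k, c @ \oo --> l /\ forall i, `|l - c i| <= 2 * s * 2^-1 ^+ i.
Proof.
move=> s0 h.
have tail i j : (i <= j)%N -> `|c j - c i| <= 2 * s * 2^-1 ^+ i.
  move=> /subnKC <-; apply: le_trans (geometric_tail h i _) _.
  have p l : 0 <= 2^-1 ^+ l :> R by rewrite exprn_ge0.
  by have := mulr_ge0 (mulr_ge0 s0 (p i)) (p (j - i)%N); lra.
have cv : cvg (c @ \oo).
  apply: cauchy_cvg; apply: cauchy_exP => e e0.
  have s1 : 0 < 2 * s + 1 by lra.
  have [i hi] := half_exp_small (divr_gt0 e0 s1).
  exists (c i); exists i => // j /= ij.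
  rewrite mx_norm_ball /ball_ /= distrC; apply: le_lt_trans (tail _ _ ij) _.
  apply: (@le_lt_trans _ _ ((2 * s + 1) * 2^-1 ^+ i)).
    by apply: ler_wpM2r; [rewrite exprn_ge0|lra].
  by rewrite mulrC -ltr_pdivlMr.
exists (lim (c @ \oo)); split => // i.
have h2 : (fun j => `|c j - c i|) @ \oo --> `|lim (c @ \oo) - c i|.
  by apply: cvg_norm; apply: cvgB; [exact: cv|exact: cvg_cst].
by apply: (cvgr_to_le h2); exists i => // j /= ij; exact: tail.
Qed.

End geometric_sequences.

Section newton.
Variables (R : realType) (k : nat).
Local Notation X := 'rV[R]_k.
Variables (F : R -> X -> X) (M : R -> X -> 'M[R]_k) (N0 K : R).
Hypotheses (N1 : 1 <= N0) (K1 : 1 <= K).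
Hypothesis M0inj : forall x : X, `|x| <= N0 * `|x *m M 0 0|.
Hypothesis Mlip : forall (e : R) (c x : X), 0 <= e <= 1 -> `|c| <= 1 ->
  `|x *m M e c - x *m M 0 0| <= K * (e + `|c|) * `|x|.
Hypothesis Mbnd : forall (e : R) (c x : X), 0 <= e <= 1 -> `|c| <= 1 -> `|x *m M e c| <= K * `|x|.
Hypothesis taylor : forall (e : R) (c c' : X), 0 <= e <= 1 -> `|c| <= 1 -> `|c'| <= 1 ->
  `|F e c' - F e c - (c' - c) *m M e c| <= K * `|c' - c| ^+ 2.
Hypothesis F0 : forall e : R, 0 <= e <= 1 -> `|F e 0| <= K * e.

(** For e and |c| at most r the derivative moves from [M 0 0] by a factor at most 2 K r = 1/(4 N0),
    so the bound N0 on the inverse at most doubles. *)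
Definition newton_radius : R := (8 * N0 * K)^-1.
Local Notation r := newton_radius.

Lemma newton_NK1 : 1 <= N0 * K. Proof. by rewrite -[1]mulr1 ler_pM. Qed.
Lemma newton_NKr : N0 * K * r = 8^-1.
Proof.
have N00 : N0 != 0 by rewrite gt_eqF // (lt_le_trans ltr01 N1).
have K00 : K != 0 by rewrite gt_eqF // (lt_le_trans ltr01 K1).
by rewrite /newton_radius; field; rewrite K00 N00.
Qed.

Lemma newton_radius_gt0 : 0 < r.
Proof. by rewrite invr_gt0 -mulrA mulr_gt0 //; apply: lt_le_trans newton_NK1. Qed.

Lemma newton_r1 : r <= 8^-1.
Proof. by rewrite -newton_NKr ler_peMl ?newton_NK1 // ltW // newton_radius_gt0. Qed.

Lemma newton_inj (e : R) (c x : X) : 0 <= e <= r -> `|c| <= r -> `|x| <= 2 * N0 * `|x *m M e c|.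
Proof.
have N00 : 0 < N0 by apply: lt_le_trans N1.
have K00 : 0 < K by apply: lt_le_trans K1.
have nk0 : 0 <= N0 * K by rewrite ltW // mulr_gt0.
have r0 := newton_radius_gt0; have r1 := newton_r1.
move=> /andP[e0 er] cr; have e1 : 0 <= e <= 1 by rewrite e0 /=; lra.
have c1 : `|c| <= 1 by lra.
have h1 := M0inj x; have h2 := Mlip x e1 c1.
have h3 : `|x *m M 0 0| <= `|x *m M e c| + K * (e + `|c|) * `|x|.
  have -> : x *m M 0 0 = x *m M e c - (x *m M e c - x *m M 0 0) by rewrite subKr.
  by apply: le_trans (ler_normB _ _) _; rewrite lerD2l.
have h4 : N0 * (K * (e + `|c|) * `|x|) <= 4^-1 * `|x|.
  rewrite mulrA ler_wpM2r // mulrA.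
  apply: (@le_trans _ _ (N0 * K * (r + r))).
    by rewrite ler_wpM2l ?lerD //; lra.
  by rewrite mulrDr newton_NKr; lra.
have h5 : N0 * `|x *m M 0 0| <= N0 * `|x *m M e c| + 4^-1 * `|x|.
  apply: le_trans (_ : N0 * (`|x *m M e c| + K * (e + `|c|) * `|x|) <= _).
    by rewrite ler_wpM2l //; lra.
  by rewrite mulrDr lerD2l.
have := normr_ge0 x; rewrite -mulrA; lra.
Qed.

Lemma newton_unit (e : R) (c : X) : 0 <= e <= r -> `|c| <= r -> M e c \in unitmx.
Proof.
move=> he hc; rewrite -row_free_unit -kermx_eq0; apply/eqP/row_matrixP => i.
rewrite row0; apply/eqP; rewrite -normr_le0.
apply: le_trans (newton_inj _ he hc) _.
by rewrite -row_mul mulmx_ker row0 normr0 mulr0.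
Qed.

(** Both residuals vanish, so the Taylor bound and the inverse bound give |c' - c| <= 2 N0 K |c' -
    c|^2; as |c' - c| <= 2 r, the right side is at most half the left one. *)
Lemma newton_unique (e : R) (c c' : X) : 0 <= e <= r -> `|c| <= r -> `|c'| <= r ->
  F e c = 0 -> F e c' = 0 -> c = c'.
Proof.
have N00 : 0 < N0 by apply: lt_le_trans N1.
have K00 : 0 < K by apply: lt_le_trans K1.
have nk0 : 0 <= N0 * K by rewrite ltW // mulr_gt0.
have r0 := newton_radius_gt0; have r1 := newton_r1.
move=> he hc hc' Fc Fc'; apply/eqP; rewrite eq_sym -subr_eq0 -normr_le0.
have e1 : 0 <= e <= 1 by have /andP[-> ?] := he; rewrite /=; lra.
have c1 : `|c| <= 1 by lra.
have c1' : `|c'| <= 1 by lra.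
have := taylor e1 c1 c1'; rewrite Fc Fc' subrr sub0r normrN => h.
have := newton_inj (c' - c) he hc.
have hd : `|c' - c| <= r + r by apply: le_trans (ler_normB _ _) _; exact: lerD.
have d0 := normr_ge0 (c' - c).
have h2 : 2 * N0 * `|(c' - c) *m M e c| <= 2^-1 * `|c' - c|.
  apply: le_trans (_ : 2 * N0 * (K * `|c' - c| ^+ 2) <= _).
    by rewrite ler_wpM2l // mulr_ge0 //; lra.
  rewrite expr2 (_ : 2 * N0 * (K * (`|c' - c| * `|c' - c|)) = 2 * (N0 * K * `|c' - c|) * `|c' - c|); last ring.
  rewrite ler_wpM2r //.
  have : N0 * K * `|c' - c| <= N0 * K * (r + r) by rewrite ler_wpM2l //; lra.
  by rewrite mulrDr newton_NKr; lra.
lra.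
Qed.

Definition newton_step (e : R) (c : X) : X := c - F e c *m invmx (M e c).

Lemma newton_stepP (e : R) (c : X) : 0 <= e <= r -> `|c| <= r ->
  (newton_step e c - c) *m M e c = - F e c.
Proof.
move=> he hc; rewrite /newton_step addrAC subrr sub0r mulNmx mulmxKV //.
exact: newton_unit.
Qed.

Lemma newton_size (e : R) (c : X) : 0 <= e <= r -> `|c| <= r ->
  `|newton_step e c - c| <= 2 * N0 * `|F e c|.
Proof.
by move=> he hc; rewrite -[X in _ * X]normrN -newton_stepP //; exact: newton_inj.
Qed.

(** For e and |c0| at most this value the first step is at most 6 N0 K [rs] = 6 r / 32 < r / 4; the
    steps then sum to at most r / 2 and the sequence stays within r. *)
Definition newton_start : R := r / (32 * N0 * K).
Local Notation rs := newton_start.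

Lemma newton_NKs : N0 * K * rs = r / 32.
Proof.
have N00 : N0 != 0 by rewrite gt_eqF // (lt_le_trans ltr01 N1).
have K00 : K != 0 by rewrite gt_eqF // (lt_le_trans ltr01 K1).
by rewrite /newton_start; field; rewrite K00 N00.
Qed.

Lemma newton_start_gt0 : 0 < rs.
Proof. by rewrite divr_gt0 ?newton_radius_gt0 // -mulrA mulr_gt0 //; apply: lt_le_trans newton_NK1. Qed.

Lemma newton_rsr : rs <= r / 32. Proof. by rewrite -newton_NKs ler_peMl ?newton_NK1 // ltW // newton_start_gt0. Qed.

Definition newton_seq (e : R) (c0 : X) : nat -> X := fun i => iter i (newton_step e) c0.

(** After a Newton step of length D the linear part of the residual cancels, leaving at most K D^2;
    the next step is at most 2 N0 K D^2 <= D / 2 because D <= r / 4. This linear rate is all that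
    convergence uses. *)
Lemma newton_seq_bound (e : R) (c0 : X) : 0 <= e <= rs -> `|c0| <= rs ->
  let s := `|newton_seq e c0 1 - c0| in
  s <= 2 * N0 * K * (e + 2 * `|c0|) /\
  forall i, `|newton_seq e c0 i.+1 - newton_seq e c0 i| <= s * 2^-1 ^+ i /\
    `|newton_seq e c0 i| <= r.
Proof.
have N00 : 0 < N0 by apply: lt_le_trans N1.
have K00 : 0 < K by apply: lt_le_trans K1.
have nk0 : 0 <= N0 * K by rewrite ltW // mulr_gt0.
have r0 := newton_radius_gt0; have r1 := newton_r1.
have rs0 := newton_start_gt0; have rsr := newton_rsr.
move=> /andP[e0 es] hc s.
have he : 0 <= e <= r by rewrite e0 /=; lra.
have e1 : 0 <= e <= 1 by rewrite e0 /=; lra.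
have hcr : `|c0| <= r by lra.
have c01 : `|c0| <= 1 by lra.
have z1 : `|0 : X| <= 1 by rewrite normr0.
have cg := normr_ge0 c0.
have sb : s <= 2 * N0 * K * (e + 2 * `|c0|).
  apply: le_trans (newton_size he hcr) _; rewrite -[X in _ <= X]mulrA ler_wpM2l //; first by rewrite mulr_ge0 //; lra.
  have -> : F e c0 = (F e c0 - F e 0 - (c0 - 0) *m M e 0) + F e 0 + c0 *m M e 0.
    by rewrite subr0 [X in _ = X + _]addrAC subrK subrK.
  apply: le_trans (ler_normD _ _) _; apply: le_trans (lerD (ler_normD _ _) (lexx _)) _.
  have t1 := taylor e1 z1 c01; have t2 := F0 e1; have t3 := Mbnd c0 e1 z1.
  rewrite subr0 in t1; rewrite subr0.
  have : K * `|c0| ^+ 2 <= K * `|c0|.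
    by rewrite ler_wpM2l //; [lra|rewrite expr2 ler_piMr].
  lra.
have sr : s <= r / 4.
  apply: le_trans sb _.
  have : N0 * K * (e + 2 * `|c0|) <= N0 * K * (rs + 2 * rs) by rewrite ler_wpM2l //; lra.
  have -> : N0 * K * (rs + 2 * rs) = 3 * (r / 32) by rewrite -newton_NKs; ring.
  lra.
split => // .
have s0 : 0 <= s by exact: normr_ge0.
have claim i : (forall j, (j < i)%N -> `|newton_seq e c0 j.+1 - newton_seq e c0 j| <= s * 2^-1 ^+ j) ->
    `|newton_seq e c0 i| <= r.
  move=> h; have : `|newton_seq e c0 i| <= `|c0| + s * (2 - 2 * 2^-1 ^+ i).
    elim: i h => [|i IH] h; first by rewrite expr0 mulr1 subrr mulr0 addr0.
    have -> : newton_seq e c0 i.+1 = newton_seq e c0 i + (newton_seq e c0 i.+1 - newton_seq e c0 i).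
      by rewrite subrKC.
    apply: le_trans (ler_normD _ _) _.
    apply: le_trans (lerD (IH (fun j ji => h j (ltnW ji))) (h i (ltnSn i))) _.
    by rewrite -addrA lerD2l exprS le_eqVlt; apply/orP; left; apply/eqP; field.
  have : s * (2 - 2 * 2^-1 ^+ i) <= s * 2.
    by rewrite ler_wpM2l // gerBl mulr_ge0 // exprn_ge0.
  lra.
have step i : `|newton_seq e c0 i| <= r ->
    `|newton_seq e c0 i.+1 - newton_seq e c0 i| <= s * 2^-1 ^+ i ->
    `|newton_seq e c0 i.+1| <= r ->
    `|newton_seq e c0 i.+2 - newton_seq e c0 i.+1| <= s * 2^-1 ^+ i.+1.
  move=> hi hd hi1; apply: le_trans (newton_size he hi1) _.
  have n1 : `|newton_seq e c0 i| <= 1 by lra.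
  have n2 : `|newton_seq e c0 i.+1| <= 1 by lra.
  have := taylor e1 n1 n2; rewrite newton_stepP // opprK subrK => t.
  set D := `|_ - _| in hd t; have D0 : 0 <= D by exact: normr_ge0.
  apply: le_trans (_ : 2 * N0 * (K * D ^+ 2) <= _).
    by rewrite ler_wpM2l // mulr_ge0 //; lra.
  have p1 : 2^-1 ^+ i <= 1 :> R by rewrite exprn_ile1 //; lra.
  have Ds : D <= r / 4.
    by apply: le_trans hd _; apply: le_trans sr; rewrite ler_piMr.
  have -> : 2 * N0 * (K * D ^+ 2) = (2 * (N0 * K * D)) * D by ring.
  have h8 : 2 * (N0 * K * D) <= 2^-1.
    have : N0 * K * D <= N0 * K * (r / 4) by rewrite ler_wpM2l //; lra.
    rewrite mulrA newton_NKr; lra.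
  apply: le_trans (_ : 2^-1 * D <= _); first by rewrite ler_wpM2r.
  rewrite exprS mulrCA ler_wpM2l //; lra.
(* Step bounds up to i keep the iterates in the ball, and iterates in the ball give the next step
   bound; hence the induction on initial segments. *)
have all i : forall j, (j <= i)%N -> `|newton_seq e c0 j.+1 - newton_seq e c0 j| <= s * 2^-1 ^+ j.
  elim: i => [|i IH] j; first by rewrite leqn0 => /eqP ->; rewrite expr0 mulr1.
  rewrite leq_eqVlt => /orP[/eqP ->|]; last by rewrite ltnS; exact: IH.
  have c1 : `|newton_seq e c0 i| <= r by apply: claim => l li; apply: IH; exact: ltnW.
  have c2 : `|newton_seq e c0 i.+1| <= r by apply: claim => l li; apply: IH.
  by apply: step => //; exact: IH.
move=> i; split; first exact: (all i).
by apply: claim => j ji; exact: (all i _ (ltnW ji)).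
Qed.

Lemma newton_converges (e : R) (c0 : X) : 0 <= e <= rs -> `|c0| <= rs ->
  exists l : X, [/\ newton_seq e c0 @ \oo --> l, `|l| <= r, F e l = 0 &
    `|l - c0| <= 4 * N0 * K * (e + 2 * `|c0|)].
Proof.
have N00 : 0 < N0 by apply: lt_le_trans N1.
have K00 : 0 < K by apply: lt_le_trans K1.
have nk0 : 0 <= N0 * K by rewrite ltW // mulr_gt0.
have r0 := newton_radius_gt0; have r1 := newton_r1.
have rs0 := newton_start_gt0; have rsr := newton_rsr.
move=> hes hc; have [sb hb] := newton_seq_bound hes hc.
have /andP[e0 es] := hes.
have he : 0 <= e <= r by rewrite e0 /=; lra.
have e1 : 0 <= e <= 1 by rewrite e0 /=; lra.
move: sb hb; set s := `|_ - c0| => sb hb.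
have s0 : 0 <= s by exact: normr_ge0.
have [l [cl hl]] := geometric_limit s0 (fun i => proj1 (hb i)).
have lr : `|l| <= r.
  by apply: (cvgr_to_le (cvg_norm cl)); apply: nearW => i; exact: (proj2 (hb i)).
have l1 : `|l| <= 1 by lra.
exists l; split => //; last first.
  have := hl 0%N; rewrite expr0 mulr1 /newton_seq /= => h; lra.
apply/eqP; rewrite -normr_le0; apply/ler_addgt0Pr => eps eps0; rewrite add0r.
(* The Taylor bound at the iterates stands in for continuity of F. It gives |F e l| <= K (4 s^2 + 3
   s) 2^-i, and 8 (s + 1)^2 dominates the coefficient. *)
have C0 : 0 < 8 * K * (s + 1) ^+ 2 by rewrite mulr_gt0 ?exprn_gt0 //; lra.
have [i hi] := half_exp_small (divr_gt0 eps0 C0).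
have [hd hn] := hb i; have n1 : `|newton_seq e c0 i| <= 1 by lra.
have t := taylor e1 n1 l1; have hli := hl i.
have Fi : `|F e (newton_seq e c0 i)| <= K * (s * 2^-1 ^+ i).
  rewrite -normrN -newton_stepP //; apply: le_trans (Mbnd _ e1 n1) _.
  by rewrite ler_wpM2l //; lra.
have Ml := Mbnd (l - newton_seq e c0 i) e1 n1.
set ci := newton_seq e c0 i in Fi Ml t hli.
have -> : F e l = (F e l - F e ci - (l - ci) *m M e ci) + F e ci + (l - ci) *m M e ci.
  by rewrite [X in _ = X + _]addrAC subrK subrK.
apply: le_trans (ler_normD _ _) _; apply: le_trans (lerD (ler_normD _ _) (lexx _)) _.
apply: le_trans (lerD (lerD t Fi) Ml) _.
set p := 2^-1 ^+ i in hi hli *; set q := `|l - ci| in hli *.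
have p0 : 0 <= p by rewrite exprn_ge0.
have p1 : p <= 1 by rewrite exprn_ile1 //; lra.
have q0 : 0 <= q by exact: normr_ge0.
have hi' : 8 * K * (s + 1) ^+ 2 * p <= eps by rewrite mulrC -ler_pdivlMr // ltW.
apply: le_trans hi'.
have q2 : q ^+ 2 <= 4 * s ^+ 2 * p.
  apply: (@le_trans _ _ ((2 * s * p) ^+ 2)).
    by rewrite ler_pXn2r // nnegrE // !mulr_ge0.
  rewrite (_ : (2 * s * p) ^+ 2 = 4 * s ^+ 2 * (p * p)); last ring.
  by rewrite ler_wpM2l ?ler_piMr // mulr_ge0 // sqr_ge0.
have -> : K * q ^+ 2 + K * (s * p) + K * q = K * (q ^+ 2 + s * p + q) by ring.
have -> : 8 * K * (s + 1) ^+ 2 * p = K * (8 * (s + 1) ^+ 2 * p) by ring.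
rewrite ler_wpM2l //; first lra.
apply: (@le_trans _ _ (4 * s ^+ 2 * p + s * p + 2 * s * p)); first lra.
have -> : 4 * s ^+ 2 * p + s * p + 2 * s * p = (4 * s ^+ 2 + 3 * s) * p by ring.
rewrite ler_wpM2r //; have := sqr_ge0 s; nra.
Qed.

(** The sequence started at 0 locates the zero at distance O(e); sequences started elsewhere
    converge to a zero in the ball of radius r, which is the same one by uniqueness. *)
Theorem newton_theorem (e : R) : 0 <= e <= rs -> exists l : X,
  [/\ F e l = 0, `|l| <= 4 * N0 * K * e, `|l| <= r &
      forall c0 : X, `|c0| <= rs -> newton_seq e c0 @ \oo --> l /\ forall i, `|newton_seq e c0 i| <= r].
Proof.
have N00 : 0 < N0 by apply: lt_le_trans N1.
have K00 : 0 < K by apply: lt_le_trans K1.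
have nk0 : 0 <= N0 * K by rewrite ltW // mulr_gt0.
have r0 := newton_radius_gt0; have r1 := newton_r1.
have rs0 := newton_start_gt0; have rsr := newton_rsr.
move=> hes; have z0 : `|0 : X| <= rs by rewrite normr0 ltW.
have /andP[e0 es] := hes; have he : 0 <= e <= r by rewrite e0 /=; lra.
have [l [_ lr Fl hl]] := newton_converges hes z0.
exists l; split => //; first by move: hl; rewrite subr0 normr0 mulr0 addr0.
move=> c0 hc; have [l' [cl' lr' Fl' _]] := newton_converges hes hc.
rewrite (newton_unique he lr lr' Fl Fl'); split => // i.
by have [_ hb] := newton_seq_bound hes hc; exact: (proj2 (hb i)).
Qed.

End newton.

(** * Bases and perturbation of determinants *)


Section basis.
Variables (R : realType) (L : lmodType R).

Definition lincomb k (x : 'I_k -> L) (c : 'rV[R]_k) : L := \sum_i c ord0 i *: x i.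

Lemma lincombD k (x : 'I_k -> L) c c' : lincomb x (c + c') = lincomb x c + lincomb x c'.
Proof.
by rewrite /lincomb -big_split; apply: eq_bigr => i _; rewrite mxE scalerDl.
Qed.

Lemma lincombZ k (x : 'I_k -> L) a c : lincomb x (a *: c) = a *: lincomb x c.
Proof.
by rewrite /lincomb scaler_sumr; apply: eq_bigr => i _; rewrite mxE scalerA.
Qed.

Lemma lincomb0 k (x : 'I_k -> L) : lincomb x 0 = 0.
Proof. by rewrite /lincomb big1 // => i _; rewrite mxE scale0r. Qed.

Definition independent k (x : 'I_k -> L) : Prop := forall c, lincomb x c = 0 -> c = 0.

Lemma independent_le (M k : nat) (e : 'I_M -> L) (x : 'I_k -> L) :
  (forall i, exists c : 'I_M -> R, x i = \sum_j c j *: e j) -> independent x -> (k <= M)%N.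
Proof.
move=> xe ind; rewrite leqNgt; apply/negP => Mk.
pose A : 'M[R]_(k, M) := \matrix_(i, j) (sval (cid (xe i))) j.
have xA i : x i = \sum_j A i j *: e j.
  rewrite [LHS](svalP (cid (xe i))); apply: eq_bigr => j _; by rewrite mxE.
have : kermx A != 0.
  rewrite kermx_eq0 /row_free; apply: contraTneq Mk => h.
  by rewrite -leqNgt -h rank_leq_col.
move=> /eqP; apply; apply/row_matrixP => i; rewrite row0; apply: ind.
rewrite /lincomb (eq_bigr (fun a => \sum_j (row i (kermx A) ord0 a * A a j) *: e j)); last first.
  by move=> a _; rewrite xA scaler_sumr; apply: eq_bigr => j _; rewrite scalerA.
rewrite exchange_big big1 //= => j _; rewrite -scaler_suml.
have -> : \sum_a row i (kermx A) ord0 a * A a j = (row i (kermx A) *m A) ord0 j by rewrite mxE.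
by rewrite -row_mul mulmx_ker row0 mxE scale0r.
Qed.

(** A maximal independent family in X spans X; lengths are bounded by M. The generators e need not
    belong to X, so none can simply be extracted from them. *)
Lemma finite_basis (M : nat) (e : 'I_M -> L) (X : set L) :
  (forall a v w, X v -> X w -> X (a *: v + w)) ->
  (forall v, X v -> exists c : 'I_M -> R, v = \sum_j c j *: e j) ->
  exists k (x : 'I_k -> L), [/\ forall i, X (x i),
    forall v, X v -> exists c, v = lincomb x c & independent x].
Proof.
move=> Xlin Xe.
pose P k := `[< exists x : 'I_k -> L, (forall i, X (x i)) /\ independent x >].
have P0 : exists k, P k.
  exists 0%N; apply/asboolP; exists (fun=> 0); split; first by case.
  by move=> c _; exact: thinmx0.
have PM k : P k -> (k <= M)%N.
  by move=> /asboolP[x [Xx ix]]; apply: independent_le ix => i; exact: Xe.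
case: (ex_maxnP P0 PM) => k /asboolP[x [Xx ix]] kmax.
exists k, x; split => // v Xv.
apply: contrapT => nv.
suff /kmax : P k.+1 by rewrite ltnn.
apply/asboolP; exists (fun i : 'I_k.+1 => if unlift ord0 i is Some j then x j else v); split.
  by move=> i; case: (unlift ord0 i).
move=> c; rewrite /lincomb big_ord_recl unlift_none.
under eq_bigr do rewrite liftK.
have -> : \sum_(i < k) c ord0 (lift ord0 i) *: x i = lincomb x (rtail c).
  by apply: eq_bigr => i _; rewrite mxE.
move=> h; have [c0|c0] := eqVneq (c ord0 ord0) 0.
  move: h; rewrite c0 scale0r add0r => /ix t0.
  apply/rowP => i; rewrite mxE; have [j ->|->] := unliftP ord0 i => //.
  by have /rowP/(_ j) := t0; rewrite !mxE.
case: nv; exists (- (c ord0 ord0)^-1 *: rtail c).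
move/eqP: h; rewrite addr_eq0 => /eqP h.
rewrite lincombZ scaleNr -scalerN -h scalerA mulVf // scale1r //.
Qed.

End basis.

Section det_perturbation.
Variable R : realType.

Lemma prod_bound k (a : 'I_k -> R) B : 0 <= B -> (forall i, `|a i| <= B) ->
  `|\prod_i a i| <= B ^+ k.
Proof.
move=> B0 h; rewrite normr_prod -[k in B ^+ k]card_ord -prodr_const.
by apply: ler_prod => i _; rewrite normr_ge0 h.
Qed.

(** Telescoping: the factors are changed one at a time. *)
Lemma prod_lip k (a c : 'I_k -> R) B z : 1 <= B -> 0 <= z -> (forall i, `|a i| <= B) ->
  (forall i, `|c i| <= B) -> (forall i, `|c i - a i| <= z) ->
  `|\prod_i c i - \prod_i a i| <= k%:R * B ^+ k * z.
Proof.
move=> B1 z0; have B0 : 0 <= B by lra.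
elim: k a c => [|k IH] a c ha hc hz.
  by rewrite !big_ord0 subrr normr0 !mul0r.
rewrite !big_ord_recl.
set pc := \prod_(i < k) _; set pa := \prod_(i < k) _.
have -> : c ord0 * pc - a ord0 * pa = c ord0 * (pc - pa) + (c ord0 - a ord0) * pa by ring.
apply: le_trans (ler_normD _ _) _; rewrite !normrM.
have h1 : `|pc - pa| <= k%:R * B ^+ k * z by apply: IH => i.
have h2 : `|pa| <= B ^+ k by apply: prod_bound.
have Bk : 0 <= B ^+ k by exact: exprn_ge0.
have BB : B ^+ k <= B * B ^+ k by rewrite ler_peMl.
apply: (@le_trans _ _ (B * (k%:R * B ^+ k * z) + z * (B * B ^+ k))).
  by apply: lerD; apply: ler_pM => //; exact: le_trans h2 BB.
by rewrite exprS -natr1 le_eqVlt; apply/orP; left; apply/eqP; ring.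
Qed.

Lemma det_bound k (A : 'M[R]_k) B : 0 <= B -> (forall i j, `|A i j| <= B) ->
  `|\det A| <= k`!%:R * B ^+ k.
Proof.
move=> B0 h; apply: le_trans (ler_norm_sum _ _ _) _.
apply: (@le_trans _ _ (\sum_(s : 'S_k) B ^+ k)).
  by apply: ler_sum => s _; rewrite normrM normr_sign mul1r; apply: prod_bound.
by rewrite sumr_const card_Sn -[X in X <= _]mulr_natl.
Qed.

Lemma det_lip k (A C : 'M[R]_k) B z : 1 <= B -> 0 <= z -> (forall i j, `|A i j| <= B) ->
  (forall i j, `|C i j| <= B) -> (forall i j, `|C i j - A i j| <= z) ->
  `|\det C - \det A| <= k`!%:R * (k%:R * B ^+ k) * z.
Proof.
move=> B1 z0 hA hC hz; rewrite /determinant -sumrB; apply: le_trans (ler_norm_sum _ _ _) _.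
apply: (@le_trans _ _ (\sum_(s : 'S_k) (k%:R * B ^+ k * z))).
  apply: ler_sum => s _; rewrite -mulrBr normrM normr_sign mul1r; exact: prod_lip.
by rewrite sumr_const card_Sn -[X in X <= _]mulr_natl mulrA.
Qed.

Lemma cofactor_bound k (A : 'M[R]_k) B i j : 0 <= B -> (forall i j, `|A i j| <= B) ->
  `|cofactor A i j| <= (k.-1)`!%:R * B ^+ k.-1.
Proof.
move=> B0 h; rewrite /cofactor normrM normrX normrN1 expr1n mul1r.
by apply: det_bound => // a c; rewrite !mxE.
Qed.

Lemma cofactor_lip k (A C : 'M[R]_k) B z i j : 1 <= B -> 0 <= z -> (forall i j, `|A i j| <= B) ->
  (forall i j, `|C i j| <= B) -> (forall i j, `|C i j - A i j| <= z) ->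
  `|cofactor C i j - cofactor A i j| <= (k.-1)`!%:R * (k.-1%:R * B ^+ k.-1) * z.
Proof.
move=> B1 z0 hA hC hz; rewrite /cofactor -mulrBr normrM normrX normrN1 expr1n mul1r.
by apply: det_lip => // a c; rewrite !mxE.
Qed.

(** The derivative of the determinant at A in the direction Z. *)
Definition cof_pair k (A Z : 'M[R]_k) : R := \sum_i \sum_j cofactor A i j * Z i j.

Lemma cof_pairC k (A Z : 'M[R]_k) : cof_pair A Z = \sum_j \sum_i cofactor A i j * Z i j.
Proof. by rewrite /cof_pair exchange_big. Qed.

Lemma cof_pair_bound k (A Z : 'M[R]_k) a z : (forall i j, `|cofactor A i j| <= a) ->
  (forall i j, `|Z i j| <= z) -> `|cof_pair A Z| <= k%:R * (k%:R * (a * z)).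
Proof.
move=> ha hz; apply: le_trans (ler_norm_sum _ _ _) _.
apply: (@le_trans _ _ (\sum_(i < k) k%:R * (a * z))).
  apply: ler_sum => i _; apply: le_trans (ler_norm_sum _ _ _) _.
  apply: (@le_trans _ _ (\sum_(j < k) (a * z))).
    by apply: ler_sum => j _; rewrite normrM; apply: ler_pM.
  by rewrite sumr_const card_ord -[X in X <= _]mulr_natl.
by rewrite sumr_const card_ord -[X in X <= _]mulr_natl.
Qed.

Lemma det2_expand (A Z : 'M[R]_2) : \det (A + Z) = \det A + cof_pair A Z + \det Z.
Proof.
rewrite cof_pairC big_ord_recl big_ord_recl big_ord0 addr0 !sum_cof2 !det2 !mxE.
set i0 := Ordinal _; set i1 := Ordinal _.
have -> : (0 : 'I_2) = i0 by exact/val_inj.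
have -> : (1 : 'I_2) = i1 by exact/val_inj.
have -> : ord0 = i0 by exact/val_inj.
have -> : lift i0 ord0 = i1 by exact/val_inj.
have -> : ordS i0 = i1 by exact/val_inj.
have -> : ordS i1 = i0 by exact/val_inj.
by rewrite /= expr0 expr1; ring.
Qed.

(** By the symmetry between A and Z, the part quadratic in Z is the cofactor pairing with the roles
    exchanged. *)
Lemma det3_expand (A Z : 'M[R]_3) :
  \det (A + Z) = \det A + cof_pair A Z + cof_pair Z A + \det Z.
Proof.
pose i0 : 'I_3 := Ordinal (isT : (0 < 3)%N).
pose i1 : 'I_3 := Ordinal (isT : (1 < 3)%N).
pose i2 : 'I_3 := Ordinal (isT : (2 < 3)%N).
have e0 : ord0 = i0 by exact/val_inj.
have e1 : lift i0 ord0 = i1 by exact/val_inj.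
have e2 : lift i0 (lift ord0 ord0) = i2 by exact/val_inj.
have s0 : ordS i0 = i1 by exact/val_inj.
have s1 : ordS i1 = i2 by exact/val_inj.
have s2 : ordS i2 = i0 by exact/val_inj.
have detE (B : 'M[R]_3) : \det B =
     B i0 i0 * (B i1 i1 * B i2 i2 - B i2 i1 * B i1 i2)
   + B i1 i0 * (B i2 i1 * B i0 i2 - B i0 i1 * B i2 i2)
   + B i2 i0 * (B i0 i1 * B i1 i2 - B i1 i1 * B i0 i2).
  rewrite (expand_det_col _ i0) (eq_bigr (fun k => cofactor B k i0 * B k i0)).
    by rewrite sum_cof3 /= s0 s1.
  by move=> k _; rewrite mulrC.
have sum3 (F : 'I_3 -> R) : \sum_j F j = F i0 + F i1 + F i2.
  by rewrite !big_ord_recl big_ord0 e0 e1 e2 addr0 addrA.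
rewrite !cof_pairC (eq_bigr _ (fun j _ => sum_cof3 A (fun i => Z i j) j)) sum3.
rewrite (eq_bigr _ (fun j _ => sum_cof3 Z (fun i => A i j) j)) sum3 /=.
rewrite !(s0, s1, s2) !detE !mxE.
by ring.
Qed.

End det_perturbation.

(** * Linear functionals on the finite element space *)


Section lipschitz_closure.
Variables (R : realType) (n : nat).
Local Notation E := 'rV[R]_n.
Local Notation mu := (vol R n).

(** Superlevel sets are relatively open in S: around each of their points the Lipschitz bound leaves
    a ball, and S meets the union of these balls exactly in the superlevel set. *)
Lemma lipD_measurable (S : set E) (f : E -> R) : measurable S -> lipD S f -> measurable_fun S f.
Proof.
move=> mS [L L0 h]; have L1 : 0 < L + 1 by lra.
apply: (measurability _ (RGenOInfty.measurableE R)).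
move=> _ -[_ [a ->] <-].
pose U := \bigcup_(x in S `&` [set x | a < f x]) ball x ((f x - a) / (L + 1)).
rewrite (_ : _ `&` _ = S `&` U).
  apply: measurableI => //; apply: open_measurable_rV; apply: bigcup_open => x [_ /= ax].
  by apply: ball_open; rewrite divr_gt0 // subr_gt0.
apply/seteqP; split => x [Sx] /= hx; split => //=.
- rewrite in_itv /= andbT in hx; exists x; [by split|by apply: ballxx; rewrite divr_gt0 // subr_gt0].
- case: hx => y [Sy /= ay]; rewrite mx_norm_ball /ball_ /= => hb.
  have := le_trans (ler_norm _) (h _ _ Sy Sx).
  have : L * `|y - x| <= (L + 1) * `|y - x| by rewrite ler_wpM2r //; lra.
  have : (L + 1) * `|y - x| < f y - a by rewrite mulrC -ltr_pdivlMr.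
  rewrite in_itv /= andbT; lra.
Qed.

Lemma bounded_closure (D : set E) : bounded_set D -> bounded_set (closure D).
Proof.
move=> [r [rr hr]]; exists r; split => // M rM x cx.
have cl : closed [set y : E | `|y| <= M].
  by apply: (@closed_comp _ _ (fun y : E => `|y|) [set t : R | t <= M]); [move=> y _; exact: (@norm_continuous R E)|exact: closed_le].
by apply: cl; move: x cx; apply: closure_subset; exact: (hr M rM).
Qed.

(** The boundary values are approximated at nearby points of D, where the bound is known; L + 1
    replaces L only to have a positive divisor. *)
Lemma lipD_trace (D : set E) (F : E -> R) (L : R) : 0 <= L ->
  (forall x y, D x -> D y -> `|F x - F y| <= L * `|x - y|) ->
  (forall y, closure D y -> cvg (F @ within D (nbhs y))) ->
  lipD (closure D) (fun y => lim (F @ within D (nbhs y))).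
Proof.
move=> L0 h hc; exists (L + 1); first lra.
move=> y z cy cz; apply/ler_addgt0Pr => e e0.
have near_pt w : closure D w -> exists x, [/\ D x, `|w - x| < e / 4 / (L + 1) &
    `|lim (F @ within D (nbhs w)) - F x| < e / 4].
  move=> cw; have PF := within_nbhs_proper cw.
  have e4 : 0 < e / 4 by lra.
  have e5 : 0 < e / 4 / (L + 1) by rewrite divr_gt0 //; lra.
  have /cvgrPdist_lt /(_ _ e4) h1 := hc w cw.
  have h2 : within D (nbhs w) [set x | `|w - x| < e / 4 / (L + 1)].
    have : nbhs w (ball w (e / 4 / (L + 1))) by exact: nbhsx_ballx.
    by rewrite /within /=; apply: filterS => x; rewrite mx_norm_ball.
  have h3 : within D (nbhs w) D by exact: withinT.
  have [x [[a1 a2] a3]] := filter_ex (filterI (filterI h1 h2) h3).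
  by exists x.
have [y' [Dy hy1 hy2]] := near_pt y cy; have [z' [Dz hz1 hz2]] := near_pt z cz.
have h1 := h _ _ Dy Dz.
set ly := lim _ in hy2 *; set lz := lim _ in hz2 *.
have t1 : `|ly - lz| <= `|ly - F y'| + `|F y' - F z'| + `|lz - F z'|.
  have -> : ly - lz = (ly - F y') + (F y' - F z') - (lz - F z') by ring.
  by apply: le_trans (ler_normB _ _) _; rewrite lerD2r; exact: ler_normD.
have t2 : `|y' - z'| <= `|y - z| + `|y - y'| + `|z - z'|.
  have -> : y' - z' = (y - z) - (y - y') + (z - z').
    by apply/rowP => i; rewrite !mxE; ring.
  apply: le_trans (ler_normD _ _) _; rewrite lerD2r; exact: ler_normB.
have t3 : (L + 1) * `|y - y'| < e / 4 by rewrite mulrC -ltr_pdivlMr //; lra.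
have t4 : (L + 1) * `|z - z'| < e / 4 by rewrite mulrC -ltr_pdivlMr //; lra.
have t5 : L * `|y' - z'| <= (L + 1) * (`|y - z| + `|y - y'| + `|z - z'|).
  apply: le_trans (_ : L * (`|y - z| + `|y - y'| + `|z - z'|) <= _); first by rewrite ler_wpM2l.
  by rewrite ler_wpM2r ?addr_ge0 //; lra.
lra.
Qed.

End lipschitz_closure.

Section linear_functionals.
Variables (R : realType) (n : nat).
Local Notation E := 'rV[R]_n.

(** Linearity is restricted to V because integrals add only for integrable functions and derivatives
    only for differentiable ones. *)
Definition linear_on (V : set (E -> R)) (L : (E -> R) -> R) : Prop :=
  forall a v w, V v -> V w -> L (a *: v + w) = a * L v + L w.

Lemma linear_on_lincomb (V : set (E -> R)) L k (x : 'I_k -> E -> R) c :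
  V 0 -> (forall a v w, V v -> V w -> V (a *: v + w)) -> linear_on V L ->
  (forall i, V (x i)) -> L (lincomb x c) = \sum_i c ord0 i * L (x i).
Proof.
move=> V0 Vlin hL Vx.
have L0 : L 0 = 0.
  have := hL 1 0 0 V0 V0; rewrite scale1r addr0 mul1r => h.
  by apply: (addrI (L 0)); rewrite addr0 -h.
suff [] : V (lincomb x c) /\ L (lincomb x c) = \sum_i c ord0 i * L (x i) by [].
rewrite /lincomb; elim: (index_enum _) => [|i s [IH1 IH2]]; first by rewrite !big_nil.
by rewrite !big_cons; split; [exact: Vlin|rewrite hL // IH2].
Qed.

Lemma linear_onZ (V : set (E -> R)) L (e : R) : linear_on V L -> linear_on V (fun v => e * L v).
Proof. by move=> hL a v w Vv Vw; rewrite hL //; ring. Qed.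

Lemma linear_onD (V : set (E -> R)) L L' : linear_on V L -> linear_on V L' ->
  linear_on V (fun v => L v + L' v).
Proof. by move=> hL hL' a v w Vv Vw; rewrite hL // hL' //; ring. Qed.

Lemma linear_onB (V : set (E -> R)) L L' : linear_on V L -> linear_on V L' ->
  linear_on V (fun v => L v - L' v).
Proof. by move=> hL hL' a v w Vv Vw; rewrite hL // hL' //; ring. Qed.

End linear_functionals.

Section finite_element_functionals.
Variables (R : realType) (n : nat).
Local Notation E := 'rV[R]_n.
Local Notation mu := (vol R n).
Variables (D : set E) (m : nat) (nu : 'I_m -> E) (b : 'I_m -> R).
Hypothesis hD : polyhedral_domain D nu b.
Variables (N : nat) (T : 'I_N -> set E).
Hypothesis hT : mesh D T.
Variables (d : nat) (V : set (E -> R)).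
Hypothesis hV : fe_space D d T V.
Implicit Types (u w v z : E -> R).
Local Notation integ := (Rintegral mu D).
Let oD : open D := domain_open hD.
Let bD : bounded_set D := pd_bounded hD.
Let mD : measurable D := domain_measurable hD.
Let fD : (mu D < +oo)%E := domain_finite hD.

Lemma fe_lin a v w : V v -> V w -> V (a *: v + w).
Proof. by move=> hv hw; apply: (fe_add hV) => //; exact: (fe_scale hV). Qed.

Lemma partial_lin a v w i x : V v -> V w -> D x ->
  partial i (a *: v + w) x = a * partial i v x + partial i w x.
Proof.
move=> hv hw Dx; rewrite (partial_fe_add hV) //; last exact: (fe_scale hV).
by rewrite (partial_fe_scale hV).
Qed.

Lemma hess_lin a v w x : V v -> V w -> hess T (a *: v + w) x = a *: hess T v x + hess T w x.
Proof.
move=> hv hw; rewrite (hess_add hD hT hV) //; last exact: (fe_scale hV).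
by rewrite (hess_scale hD hT hV).
Qed.

Lemma lap_lin a v w x : V v -> V w -> lap T (a *: v + w) x = a * lap T v x + lap T w x.
Proof. by move=> hv hw; rewrite /lap hess_lin // mxtraceD mxtraceZ. Qed.

Lemma lap_bmf v : V v -> bmf D (lap T v).
Proof. by move=> hv; apply: bmf_sum => i _; exact: (hess_bmf hD hT hV). Qed.

Lemma linear_integ (Phi : (E -> R) -> E -> R) :
  (forall v, V v -> bmf D (Phi v)) ->
  (forall a v w x, V v -> V w -> D x -> Phi (a *: v + w) x = a * Phi v x + Phi w x) ->
  linear_on V (fun v => integ (Phi v)).
Proof.
move=> hb hl a v w Vv Vw; rewrite -(integZ mD fD a (hb v Vv)) -(integD mD fD) //.
- by apply: integ_eq => x Dx; exact: hl.
- by apply: bmfZ; exact: hb.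
- exact: hb.
Qed.

Lemma lap_linear u : V u -> linear_on V (fun v => integ (fun x => lap T u x * lap T v x)).
Proof.
move=> Vu; apply: linear_integ => [v Vv|a v w x Vv Vw _].
  by apply: bmfM; exact: lap_bmf.
by rewrite (lap_lin a x Vv Vw); move: (lap T u x) (lap T v x) (lap T w x) => p q r; ring.
Qed.

Lemma lap_linear_l u : V u -> linear_on V (fun v => integ (fun x => lap T v x * lap T u x)).
Proof.
move=> Vu; apply: linear_integ => [v Vv|a v w x Vv Vw _].
  by apply: bmfM; exact: lap_bmf.
by rewrite (lap_lin a x Vv Vw); move: (lap T u x) (lap T v x) (lap T w x) => p q r; ring.
Qed.

Lemma bmf_linear g : bmf D g -> linear_on V (fun v => integ (fun x => g x * v x)).
Proof.
move=> hg; apply: linear_integ => [v Vv|a v w x Vv Vw _].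
  by apply: bmfM => //; exact: (fe_bmf hD hT hV).
by rewrite -[(a *: v + w) x]/(a * v x + w x); ring.
Qed.

(** Here f is integrable but possibly unbounded; the product is integrable because v is bounded. *)
Lemma integrable_linear f : mu.-integrable D (EFin \o f) ->
  linear_on V (fun v => integ (fun x => f x * v x)).
Proof.
move=> hf a v w Vv Vw.
have hi z : V z -> mu.-integrable D (EFin \o (fun x => f x * z x)).
  move=> Vz; have [mz [B hB]] := fe_bmf hD hT hV Vz.
  apply: (integrableMl mD hf mz); exists B; split; first exact: num_real.
  by move=> M BM x Dx /=; apply: le_trans (hB _ Dx) (ltW BM).
rewrite -RintegralZl //; last exact: hi.
rewrite -RintegralD //.
- by apply: integ_eq => x _; rewrite -[(a *: v + w) x]/(a * v x + w x); ring.
- rewrite (_ : _ \o _ = (fun x => a%:E * (f x * v x)%:E)%E) //.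
  by apply: integrableZl => //; exact: hi.
- exact: hi.
Qed.

Lemma cof_form_linear u w : V u -> V w -> linear_on V (fun v => integ (cof_form T u w v)).
Proof.
move=> Vu Vw; apply: linear_integ => [v Vv|a v z x Vv Vz Dx].
  exact: (cof_form_bmf hD hT hV).
rewrite !cof_formE mulr_sumr -big_split; apply: eq_bigr => k _ /=.
by rewrite partial_lin //; ring.
Qed.

Lemma cof_form_linear_mid u v : V u -> V v -> linear_on V (fun w => integ (cof_form T u w v)).
Proof.
move=> Vu Vv; apply: linear_integ => [w Vw|a w z x Vw Vz Dx].
  exact: (cof_form_bmf hD hT hV).
rewrite !cof_formE mulr_sumr -big_split; apply: eq_bigr => k _ /=.
rewrite (eq_bigr (fun l => a * (cofactor (hess T u x) k l * partial l w x) +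
  cofactor (hess T u x) k l * partial l z x)); last first.
  by move=> l _; rewrite partial_lin //; ring.
by rewrite big_split -mulr_sumr /=; ring.
Qed.

(** * The normal derivative and its integral over a face *)

Section normal_derivative.
Variable e : E.

Lemma nderiv_quot_lip v : V v -> lipD D (fun z : E => dot (grad v z) e).
Proof.
move=> Vv; rewrite /dot.
suff : forall s : seq 'I_n, lipD D (fun z : E => \sum_(i <- s) grad v z ord0 i * e ord0 i) by apply.
elim=> [|i s IH].
  by apply: lipD_eq (lipD_cst _ 0) => x _; rewrite big_nil.
apply: (@lipD_eq _ _ _ (fun z : E => e ord0 i * partial i v z + \sum_(j <- s) grad v z ord0 j * e ord0 j)).
  by move=> x _; rewrite big_cons mxE mulrC.
by apply: lipDD => //; apply: lipDZ; exact: (fe_partial_lip hD hT hV).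
Qed.

Lemma nderiv_cvg v y : V v -> closure D y -> cvg ((fun z : E => dot (grad v z) e) @ within D (nbhs y)).
Proof.
move=> Vv cy; have [_ _ _ h] := fe_C1 hV Vv; have PF := within_nbhs_proper cy.
apply/cvg_ex; exists (\sum_i lim (partial i v @ within D (nbhs y)) * e ord0 i).
apply: (@cvg_big R _ +%R) => [|i _]; first exact: add_continuous.
apply: cvgM; last exact: cvg_cst.
rewrite (_ : (fun x => grad v x ord0 i) = partial i v); first exact: h.
by apply/funext => x; rewrite mxE.
Qed.

Lemma nderiv_lip v : V v -> lipD (closure D) (nderiv D e v).
Proof.
move=> Vv; have [L L0 h] := nderiv_quot_lip Vv; apply: (lipD_trace L0) => //.
by move=> y; exact: nderiv_cvg.
Qed.

Lemma nderiv_lin a v w y : V v -> V w -> closure D y ->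
  nderiv D e (a *: v + w) y = a * nderiv D e v y + nderiv D e w y.
Proof.
move=> Vv Vw cy; have PF := within_nbhs_proper cy.
apply: cvg_lim => //.
have h : (fun z : E => a * dot (grad v z) e + dot (grad w z) e) @ within D (nbhs y) -->
    a * nderiv D e v y + nderiv D e w y.
  apply: cvgD; last exact: nderiv_cvg.
  by apply: cvgM; [exact: cvg_cst|exact: nderiv_cvg].
apply: cvg_trans h; apply: near_eq_cvg.
apply: (filterS _ (withinT D (nbhs_filter y))) => y' Dy'.
rewrite /dot mulr_sumr -big_split; apply: eq_bigr => i _ /=.
by rewrite !mxE partial_lin //; ring.
Qed.

Variable c : R.
Let S := [set x | 0 < dot e x - c < 1 /\ closure D (hproj e c x)].

Let hproj_lip : exists2 L : R, 0 <= L & forall x y : E, `|hproj e c x - hproj e c y| <= L * `|x - y|.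
Proof.
exists (1 + n%:R * `|e| * `|e|); first by rewrite addr_ge0 // !mulr_ge0.
move=> x y.
have -> : hproj e c x - hproj e c y = (x - y) - dot e (x - y) *: e.
  have -> : dot e (x - y) = dot e x - dot e y by rewrite -scaleN1r dotD dotZ mulN1r.
  by apply/rowP => i; rewrite !mxE; ring.
apply: le_trans (ler_normB _ _) _; rewrite mulrDl mul1r lerD2l normrZ.
rewrite [leRHS]mulrAC ler_wpM2r // dotC.
by apply: norm_sum_coord => // i; exact: le_coord_norm.
Qed.

Lemma prism_measurable : measurable S.
Proof.
have [L L0 hL] := hproj_lip.
have ch : continuous (hproj e c).
  move=> x; apply/(@cvgrPdist_lt R E _ (nbhs x) (nbhs_filter x)) => r r0.
  have L1 : 0 < L + 1 by lra.
  have : nbhs x (ball x (r / (L + 1))) by apply: nbhsx_ballx; rewrite divr_gt0.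
  apply: filterS => y; rewrite mx_norm_ball /ball_ /= => hy.
  apply: le_lt_trans (hL _ _) _; apply: (@le_lt_trans _ _ ((L + 1) * `|x - y|)).
    by rewrite ler_wpM2r //; lra.
  by rewrite mulrC -ltr_pdivlMr.
rewrite (_ : S = [set x | 0 < dot e x - c < 1] `&` (hproj e c @^-1` closure D)) //.
apply: measurableI.
  rewrite (_ : [set _ | _] = dot e @^-1` `]c, c + 1[%classic).
    by rewrite -[X in measurable X]setTI; apply: measurable_dot.
  by apply/seteqP; split => x /=; rewrite in_itv /=; lra.
rewrite -[X in measurable X]setCK; apply: measurableC; apply: open_measurable_rV.
apply: closed_openC; apply: closed_comp; last exact: closed_closure.
by move=> x _; exact: ch.
Qed.

Lemma prism_bounded : bounded_set S.
Proof.
have [r [_ hr]] := bounded_closure bD.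
exists (`|r| + 1 + `|e|); split; first exact: num_real.
move=> M hM x [/andP[h0 h1] cx]; apply: le_trans (ltW hM).
have -> : x = hproj e c x + (dot e x - c) *: e by rewrite /hproj subrK.
apply: le_trans (ler_normD _ _) _; apply: lerD.
  by apply: hr cx; rewrite (le_lt_trans (ler_norm _)) // ltrDl.
by rewrite normrZ ler_piMl // ger0_norm; lra.
Qed.

(** The trace of the gradient is Lipschitz on the closure of D and the projection on the hyperplane
    is Lipschitz, so the integrand of [face_int] is Lipschitz on a bounded prism. *)
Lemma nderiv_hproj_bmf v : V v -> bmf S (fun x => nderiv D e v (hproj e c x)).
Proof.
move=> Vv; have [L L0 hL] := hproj_lip; have [K K0 hK] := nderiv_lip Vv.
have hl : lipD S (fun x => nderiv D e v (hproj e c x)).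
  exists (K * L); first exact: mulr_ge0.
  move=> x y [_ cx] [_ cy]; apply: le_trans (hK _ _ cx cy) _.
  by rewrite -mulrA ler_wpM2l.
split; first by apply: lipD_measurable => //; exact: prism_measurable.
exact: lipD_bounded prism_bounded hl.
Qed.

Lemma face_int_linear : linear_on V (fun v => face_int D e c (nderiv D e v)).
Proof.
move=> a v w Vv Vw; rewrite /face_int.
have fS : (mu S < +oo)%E := bounded_vol prism_measurable prism_bounded.
rewrite -(integZ prism_measurable fS a (nderiv_hproj_bmf Vv)).
rewrite -(integD prism_measurable fS); first last.
- exact: nderiv_hproj_bmf.
- by apply: bmfZ; exact: nderiv_hproj_bmf.
by apply: integ_eq => x [_ cx]; exact: nderiv_lin.
Qed.

End normal_derivative.

(** Lets the boundary term be evaluated in coordinates, from its values on a basis. *)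
Lemma flux_linear : linear_on V (flux D nu b).
Proof.
move=> a v w Vv Vw; rewrite /flux mulr_sumr -big_split; apply: eq_bigr => i _.
exact: face_int_linear.
Qed.

End finite_element_functionals.

Section row_norm.
Variable R : realType.

Lemma norm_le_coord k (x : 'rV[R]_k) (B : R) : 0 <= B -> (forall i, `|x ord0 i| <= B) -> `|x| <= B.
Proof.
move=> B0 h; rewrite [`|x|]mx_normrE; apply: bigmax_le => //= -[i j] _ /=.
by rewrite ord1.
Qed.

Lemma mulmx_norm_bound k (A : 'M[R]_k) : exists2 B : R, 0 <= B & forall x : 'rV[R]_k, `|x *m A| <= B * `|x|.
Proof.
pose B := \sum_i \sum_j `|A i j|.
have B0 : 0 <= B by apply: sumr_ge0 => i _; apply: sumr_ge0.
have hA i j : `|A i j| <= B.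
  rewrite /B (bigD1 i) //= (bigD1 j) //= -addrA lerDl.
  by apply: addr_ge0; repeat (apply: sumr_ge0 => ? _ //).
exists (k%:R * B); first exact: mulr_ge0.
move=> x; apply: norm_le_coord => [|j]; first by rewrite !mulr_ge0.
by rewrite mxE; apply: norm_sum_coord.
Qed.

Lemma unitmx_norm_bound k (A : 'M[R]_k) : A \in unitmx ->
  exists2 B : R, 1 <= B & forall x : 'rV[R]_k, `|x| <= B * `|x *m A|.
Proof.
move=> uA; have [B B0 hB] := mulmx_norm_bound (invmx A).
exists (B + 1); first lra.
move=> x; rewrite -{1}(mulmxK uA x); apply: le_trans (hB _) _.
by rewrite ler_wpM2r //; lra.
Qed.

Lemma det_quadratic k (B : R) : k = 2%N \/ k = 3%N -> 1 <= B -> exists2 C : R, 0 <= C &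
  forall (A Z : 'M[R]_k) (z : R), (forall i j, `|A i j| <= B) -> (forall i j, `|Z i j| <= z) ->
    0 <= z <= 2 * B -> `|\det (A + Z) - \det A - cof_pair A Z| <= C * z ^+ 2.
Proof.
(* In dimension three the remainder is at most 18 B z^2 + 6 z^3, and z <= 2 B bounds the cubic term
   by 12 B z^2; in dimension two it is at most 2 z^2. *)
move=> hk B1; exists (30 * B); first lra.
case: hk => -> A Z z hA hZ /andP[z0 zB].
- rewrite det2_expand (_ : _ - _ - _ = \det Z); last ring.
  apply: le_trans (det_bound z0 hZ) _; rewrite ler_wpM2r ?sqr_ge0 //.
  by rewrite (_ : 2`! = 2)%N //; lra.
- rewrite det3_expand (_ : _ - _ - _ = cof_pair Z A + \det Z); last ring.
  apply: le_trans (ler_normD _ _) _.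
  have h1 := det_bound z0 hZ.
  have h2 : `|cof_pair Z A| <= 3 * (3 * (2 * z ^+ 2 * B)).
    apply: cof_pair_bound => // i j; exact: (cofactor_bound i j z0 hZ).
  apply: le_trans (lerD h2 h1) _; rewrite (_ : 3`! = 6)%N //.
  have z2 := sqr_ge0 z.
  have : z ^+ 3 <= 2 * B * z ^+ 2 by rewrite exprS ler_wpM2r.
  by move: (z ^+ 3) (z ^+ 2) z2 => p q q0; nra.
Qed.

End row_norm.

(** * Linearity of H^1_0 and an upper bound for the energy *)

Section H10_linear.
Variables (R : realType) (n : nat).
Local Notation E := 'rV[R]_n.
Variable D : set E.
Hypotheses (oD : open D) (cD : convexD D) (bD : bounded_set D).
Implicit Types (v w phi : E -> R).

Let mD : measurable D. Proof. exact: open_measurable_rV. Qed.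
Let fD : (vol R n D < +oo)%E. Proof. exact: bounded_vol. Qed.

Lemma testZ (a : R) phi : test D phi -> test D (a *: phi).
Proof.
move=> [s1 c1 d1].
have e s : dpart s (a *: phi) = a *: dpart s phi.
  elim: s => [//|i s IH]; rewrite /= IH; apply/funext => x.
  by apply: partialZ; exact: s1.
have sub : closure [set x | (a *: phi) x != 0] `<=` closure [set x | phi x != 0].
  apply: closure_subset => x /=; apply: contra_neq => h.
  by rewrite -[LHS]/(a * phi x) h mulr0.
split.
- by move=> s x; rewrite e; apply: differentiableZ; exact: s1.
- by apply: (subclosed_compact _ c1) => //; exact: closed_closure.
- exact: subset_trans sub d1.
Qed.

Lemma mpartialZ (al : 'I_n -> nat) (a : R) v x : nice D v -> (mdeg al <= 1)%N -> D x ->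
  mpartial al (a *: v) x = a * mpartial al v x.
Proof.
move=> [_ dv _] ha Dx; have [[_ e]|[_ [i _ e]]] := @mpartial_le1 R n al ha; rewrite !e //.
by apply: partialZ; exact: dv.
Qed.

Lemma energyZ (a : R) v : nice D v -> energy D (a *: v) = a ^+ 2 * energy D v.
Proof.
move=> hv; rewrite /energy mulr_sumr; apply: eq_bigr => al hal.
have hb := mpartial_bmf oD bD hv hal.
rewrite -(integZ mD fD); last by apply: bmf_eq (bmfM hb hb) => x _; rewrite expr2.
by apply: integ_eq => x Dx; rewrite mpartialZ // exprMn.
Qed.

Lemma H10_scale (a : R) v : nice D v -> H10 D v -> H10 D (a *: v).
Proof.
move=> hv [_ h]; split; first exact/(nice_Sobolev oD cD bD)/niceZ.
move=> e e0; have a1 : 0 < `|a| + 1 by apply: ltr_pwDr.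
have e2 : 0 < e / 2 / (`|a| + 1) by rewrite !divr_gt0.
have [p tp hp] := h _ e2; exists (a *: p); first exact: testZ.
have np := niceB oD hv (test_nice cD bD tp).
have hE : energy D (v - p) <= (e / 2 / (`|a| + 1)) ^+ 2.
  by apply/(snorm_le oD cD bD np (ltW e2)); exact: ltW.
rewrite -scalerBr; apply: (@le_lt_trans _ _ (e / 2)%:E); last by rewrite lte_fin; lra.
apply/(snorm_le oD cD bD); [exact: niceZ|lra|].
rewrite energyZ //; apply: le_trans (ler_wpM2l (sqr_ge0 a) hE) _.
rewrite -exprMn -real_normK ?num_real // ler_pXn2r ?nnegrE //; last by lra.
rewrite normrM (gtr0_norm e2) mulrCA mulrC -[leRHS]mulr1.
by rewrite mulrC ler_wpM2l //; [lra|rewrite ler_pdivrMr // mul1r lerDl].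
Qed.

Lemma H10_lin (a : R) v w : nice D v -> nice D w -> H10 D v -> H10 D w -> H10 D (a *: v + w).
Proof.
move=> nv nw hv hw.
have -> : a *: v + w = a *: v - (-1) *: w by rewrite scaleN1r opprK.
by apply: (H10_sub oD cD bD); try exact: niceZ; exact: H10_scale.
Qed.

Lemma energy_bound v (s : R) : nice D v -> (forall x, D x -> `|v x| <= s) ->
  (forall i x, D x -> `|partial i v x| <= s) ->
  energy D v <= #|{ffun 'I_n -> 'I_2}|%:R * fine (vol R n D) * s ^+ 2.
Proof.
move=> hv h0 h1; rewrite /energy.
have V0 : 0 <= fine (vol R n D) by rewrite fine_ge0.
apply: (@le_trans _ _ (\sum_(a : {ffun 'I_n -> 'I_2}) fine (vol R n D) * s ^+ 2)).
  rewrite [leRHS](bigID (fun a => (mdeg (mindex a) <= 1)%N)) /= -[leLHS]addr0; apply: lerD.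
    apply: ler_sum => a ha; have hb := mpartial_bmf oD bD hv ha.
    rewrite mulrC; apply: le_trans (ler_norm _) _; apply: (integ_bound mD fD).
      by apply: bmf_eq (bmfM hb hb) => x _; rewrite expr2.
    move=> x Dx; rewrite normrX ler_pXn2r ?nnegrE //.
      by have [[_ ->]|[_ [i _ ->]]] := @mpartial_le1 R n (mindex a) ha; [exact: h0|exact: h1].
    exact: le_trans (h0 x Dx).
  by apply: sumr_ge0 => a _; rewrite mulr_ge0 // sqr_ge0.
by rewrite sumr_const -[X in X <= _]mulr_natl mulrA.
Qed.

End H10_linear.

(** * The discrete problem *)


Section bilinear_bound.
Variable R : realType.

Lemma bilinear_bound n (C : 'I_n -> 'I_n -> R) (p q : 'I_n -> R) (a s t : R) :
  (forall i j, `|C i j| <= a) -> (forall i, `|p i| <= s) -> (forall i, `|q i| <= t) ->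
  `|\sum_i (\sum_j C i j * p j) * q i| <= n%:R * (n%:R * (a * s) * t).
Proof.
move=> hC hp hq; apply: le_trans (ler_norm_sum _ _ _) _.
apply: (@le_trans _ _ (\sum_(i < n) n%:R * (a * s) * t)); last first.
  by rewrite sumr_const card_ord -[X in X <= _]mulr_natl.
apply: ler_sum => i _; rewrite normrM; apply: ler_pM => //.
apply: le_trans (ler_norm_sum _ _ _) _.
apply: (@le_trans _ _ (\sum_(j < n) a * s)); last first.
  by rewrite sumr_const card_ord -[X in X <= _]mulr_natl.
by apply: ler_sum => j _; rewrite normrM; apply: ler_pM.
Qed.

Lemma bmf_uniform n (D : set 'rV[R]_n) (I : finType) (F : I -> 'rV[R]_n -> R) :
  (forall i, bmf D (F i)) -> exists2 B : R, 0 <= B & forall i x, D x -> `|F i x| <= B.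
Proof.
move=> h; pose b i := sval (cid (proj2 (h i))).
exists (\sum_i `|b i|) => [|i x Dx]; first exact: sumr_ge0.
apply: (@le_trans _ _ `|b i|); last by rewrite (bigD1 i) //= lerDl sumr_ge0.
by apply: le_trans (ler_norm _); rewrite /b; case: cid => /= B; exact.
Qed.

Lemma le_sum4 (a b c d : R) : 0 <= a -> 0 <= b -> 0 <= c -> 0 <= d ->
  [/\ a <= 1 + (a + b + c + d), b <= 1 + (a + b + c + d), c <= 1 + (a + b + c + d) &
      d <= 1 + (a + b + c + d)].
Proof. by split; lra. Qed.

Lemma regularized_algebra (p q s t : R) : p - q = - s + t <-> p - q + s - t = 0.
Proof. by split; lra. Qed.

(** The unprimed letters belong to u, the primed ones to the next iterate, and [lz], [qz] to the
    correction. Replacing q by -n det turns the factor (n-1)/n into det - n det, whose second term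
    cancels the q on the left. *)
Lemma iterate_algebra (e n l' l lz q' q qz F g dt : R) : n != 0 ->
  l' = lz + l -> q' = qz + q -> q = - (n * dt) ->
  (e * l' + q' = - F + g + (n - 1) / n * q) <-> (e * lz + qz = - (e * l - dt + F - g)).
Proof.
move=> n0 -> -> ->; have -> : (n - 1) / n * - (n * dt) = dt - n * dt by field.
by split; lra.
Qed.

End bilinear_bound.

Section discrete_newton.
Variables (R : realType) (n : nat).
Local Notation E := 'rV[R]_n.
Local Notation mu := (vol R n).
Hypothesis hn : n = 2%N \/ n = 3%N.
Variables (D : set E) (m : nat) (nu : 'I_m -> E) (b : 'I_m -> R).
Hypothesis hD : polyhedral_domain D nu b.
Variables (N : nat) (T : 'I_N -> set E).
Hypothesis hT : mesh D T.
Variables (d : nat) (V : set (E -> R)).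
Hypothesis hV : fe_space D d T V.
Variable f : E -> R.
Hypothesis hf : mu.-integrable D (EFin \o f).
Variable ub : E -> R.
Hypothesis Vub : V ub.
Hypothesis ub_eig : forall j x, T j x -> forall a : R, eigenvalue (hess T ub x) a -> 0 < a.
Local Notation integ := (Rintegral mu D).
Hypothesis ub_MA : forall v, V v -> H10 D v ->
  integ (fun x => v x * \det (hess T ub x)) = integ (fun x => f x * v x).
Variables (k : nat) (x : 'I_k -> E -> R).
Hypotheses (Vx : forall i, V (x i)) (Hx : forall i, H10 D (x i)) (ind : independent x).
Let oD : open D := domain_open hD.
Let cD : convexD D := domain_convex hD.
Let bD : bounded_set D := pd_bounded hD.
Let mD : measurable D := domain_measurable hD.
Let fD : (mu D < +oo)%E := domain_finite hD.
Local Notation z := (lincomb x).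
Local Notation X := 'rV[R]_k.
Local Notation W := (fine (mu D)).

Definition shifted (c : X) : E -> R := ub + z c.
Local Notation U := shifted.

Definition bil (e : R) (u w v : E -> R) : R :=
  e * integ (fun y => lap T w y * lap T v y) + integ (cof_form T u w v).

Definition residual (e : R) (u v : E -> R) : R :=
  e * integ (fun y => lap T u y * lap T v y) - integ (fun y => \det (hess T u y) * v y)
  + integ (fun y => f y * v y) - e ^+ 3 * flux D nu b v.

(* [newtonF] and [newtonM] represent the residual of the regularized problem and its
   derivative in the basis [x] of V_h meet H^1_0, at the function [ub + z c]. *)
Definition newtonF (e : R) (c : X) : X := \row_j residual e (U c) (x j).
Definition newtonM (e : R) (c : X) : 'M[R]_k := \matrix_(i, j) bil e (U c) (x i) (x j).

Lemma lincomb_elem (L : (E -> R) -> R) c : linear_on V L -> L (z c) = \sum_i c ord0 i * L (x i).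
Proof. by move=> hL; apply: (linear_on_lincomb _ (fe_zero hV) (fe_lin hV) hL). Qed.

Lemma V_lincomb c : V (z c).
Proof. by apply: (fe_sum hV) => i; exact: (fe_scale hV). Qed.

Lemma V_shifted c : V (U c).
Proof. by apply: (fe_add hV) => //; exact: V_lincomb. Qed.

Lemma H10_zero : H10 D (0 : E -> R).
Proof.
split; first exact: (nice_Sobolev oD cD bD) (fe_nice hD hT hV (fe_zero hV)).
move=> e e0; exists (0 : E -> R).
  have e1 s : dpart s (0 : E -> R) = 0.
    elim: s => [//|i s IH]; rewrite /= IH; exact: (partial_cst i 0).
  have e2 : [set y : E | (0 : E -> R) y != 0] = set0.
    by apply/seteqP; split => // y /=; rewrite eqxx.
  split; first (by move=> s y; rewrite e1; exact: differentiable_cst); by rewrite e2 closure0 //; exact: compact0.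
rewrite subr0; apply: (@le_lt_trans _ _ (e / 2)%:E); last by rewrite lte_fin; lra.
have n0 := fe_nice hD hT hV (fe_zero hV).
apply/(snorm_le oD cD bD n0); first lra.
by have := energyZ oD bD 0 n0; rewrite scale0r expr0n mul0r => ->; exact: sqr_ge0.
Qed.

Lemma H10_lincomb c : H10 D (z c).
Proof.
suff [] : V (z c) /\ H10 D (z c) by [].
rewrite /lincomb; elim: (index_enum _) => [|i s [IH1 IH2]].
  by rewrite !big_nil; split; [exact: (fe_zero hV)|exact: H10_zero].
rewrite !big_cons; split; first exact: (fe_lin hV).
exact: (H10_lin oD cD bD _ (fe_nice hD hT hV (Vx i)) (fe_nice hD hT hV IH1) (Hx i) IH2).
Qed.

Lemma basis_lincomb j : x j = z (delta_mx ord0 j).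
Proof.
rewrite /lincomb (bigD1 j) //= mxE !eqxx scale1r big1 ?addr0 // => i ij.
by rewrite mxE (negbTE ij) andbF scale0r.
Qed.

Lemma norm_delta (j : 'I_k) : `|delta_mx ord0 j : X| <= 1.
Proof.
by apply: norm_le_coord => // i; rewrite mxE; case: (_ && _); rewrite ?normr1 ?normr0.
Qed.

Lemma shifted0 : U 0 = ub. Proof. by rewrite /shifted lincomb0 addr0. Qed.

Lemma shiftedD c c' : U c' = U c + z (c' - c).
Proof. by rewrite /shifted -addrA -lincombD subrKC. Qed.

(** Pointwise bounds by the coordinates: each quantity is linear on V, and finitely many basis
    functions are bounded on D. *)
Lemma element_bounds : exists2 B : R, 1 <= B & forall y, D y ->
  [/\ forall i j, `|hess T ub y i j| <= B,
      forall c i j, `|hess T (z c) y i j| <= B * `|c|,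
      forall c i, `|partial i (z c) y| <= B * `|c| &
      forall c, `|z c y| <= B * `|c|].
Proof.
have [b1 b10 h1] := @bmf_uniform R n D ('I_n * 'I_n)%type (fun ij y => hess T ub y ij.1 ij.2)
  (fun ij => hess_bmf hD hT hV ij.1 ij.2 Vub).
have [b2 b20 h2] := @bmf_uniform R n D ('I_n * 'I_n * 'I_k)%type
  (fun q y => hess T (x q.2) y q.1.1 q.1.2) (fun q => hess_bmf hD hT hV q.1.1 q.1.2 (Vx q.2)).
have [b3 b30 h3] := @bmf_uniform R n D ('I_n * 'I_k)%type
  (fun q y => partial q.1 (x q.2) y) (fun q => fe_partial_bmf hD hT hV q.1 (Vx q.2)).
have [b4 b40 h4] := @bmf_uniform R n D 'I_k x (fun q => fe_bmf hD hT hV (Vx q)).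
have k0 : 0 <= k%:R :> R by [].
exists (1 + b1 + k%:R * b2 + k%:R * b3 + k%:R * b4); first by have := mulr_ge0 k0 b20; have := mulr_ge0 k0 b30; have := mulr_ge0 k0 b40; lra.
set B := _ + _.
have p2 := mulr_ge0 k0 b20; have p3 := mulr_ge0 k0 b30; have p4 := mulr_ge0 k0 b40.
have B1 : b1 <= B by rewrite /B; lra.
have B2 : k%:R * b2 <= B by rewrite /B; lra.
have B3 : k%:R * b3 <= B by rewrite /B; lra.
have B4 : k%:R * b4 <= B by rewrite /B; lra.
have lin (L : (E -> R) -> R) c beta : linear_on V L -> 0 <= beta -> (forall i, `|L (x i)| <= beta) ->
    k%:R * beta <= B -> `|L (z c)| <= B * `|c|.
  move=> hL b0 hb hB; rewrite lincomb_elem //.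
  apply: le_trans (norm_sum_coord c b0 hb) _; exact: ler_wpM2r.
move=> y Dy; split.
- by move=> i j; apply: le_trans (h1 (i, j) y Dy) _.
- move=> c i j; apply: (lin (fun v => hess T v y i j) c b2) => //.
    by move=> a v w Vv Vw; rewrite (hess_lin hD hT hV) // !mxE.
  by move=> l; exact: (h2 (i, j, l) y Dy).
- move=> c i; apply: (lin (fun v => partial i v y) c b3) => //.
    by move=> a v w Vv Vw; exact: (partial_lin hV).
  by move=> l; exact: (h3 (i, l) y Dy).
- move=> c; apply: (lin (fun v => v y) c b4) => //.
  by move=> l; exact: (h4 l y Dy).
Qed.

Lemma bil_linear e u v : V u -> V v -> linear_on V (fun w => bil e u w v).
Proof.
move=> Vu Vv; apply: linear_onD; last exact: (cof_form_linear_mid hD hT hV Vu Vv).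
by apply: linear_onZ; exact: (lap_linear_l hD hT hV Vv).
Qed.

Lemma bil_linear_r e u w : V u -> V w -> linear_on V (bil e u w).
Proof.
move=> Vu Vw; apply: linear_onD; last exact: (cof_form_linear hD hT hV Vu Vw).
by apply: linear_onZ; exact: (lap_linear hD hT hV Vw).
Qed.

Lemma det_hess_bmf u : V u -> bmf D (fun y => \det (hess T u y)).
Proof. by move=> Vu; apply: bmf_det => i j; exact: (hess_bmf hD hT hV). Qed.

Lemma residual_linear e u : V u -> linear_on V (residual e u).
Proof.
move=> Vu; apply: linear_onB; last by apply: linear_onZ; exact: (flux_linear hD hT hV).
apply: linear_onD; last exact: (integrable_linear hD hT hV hf).
apply: linear_onB; first by apply: linear_onZ; exact: (lap_linear hD hT hV Vu).
exact: (bmf_linear hD hT hV (det_hess_bmf Vu)).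
Qed.

Lemma mul_newtonM e c y j : (y *m newtonM e c) ord0 j = bil e (U c) (z y) (x j).
Proof.
rewrite (lincomb_elem y (bil_linear e (V_shifted c) (Vx j))) mxE.
by apply: eq_bigr => i _; rewrite mxE.
Qed.

Lemma newtonM_test e c (y c' : X) : \sum_j (y *m newtonM e c) ord0 j * c' ord0 j = bil e (U c) (z y) (z c').
Proof.
rewrite (lincomb_elem c' (bil_linear_r e (V_shifted c) (V_lincomb y))).
by apply: eq_bigr => j _; rewrite mul_newtonM mulrC.
Qed.

Lemma newtonF_test e c (c' : X) : \sum_j newtonF e c ord0 j * c' ord0 j = residual e (U c) (z c').
Proof.
rewrite (lincomb_elem c' (residual_linear e (V_shifted c))).
by apply: eq_bigr => j _; rewrite mxE mulrC.
Qed.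

(** A vector y in the kernel, tested against itself, makes the cofactor form of [z y] at [ub]
    integrate to 0; definiteness gives [z y] = 0 and independence y = 0. *)
Lemma newtonM0_unit : newtonM 0 0 \in unitmx.
Proof.
rewrite -row_free_unit -kermx_eq0; apply/eqP/row_matrixP => i; rewrite row0.
apply: ind; apply: (@cof_form_definite R n _ D m nu b hD N T hT d V hV ub Vub ub_eig).
- by case: hn => ->.
- exact: V_lincomb.
- exact: H10_lincomb.
have := newtonM_test 0 0 (row i (kermx (newtonM 0 0))) (row i (kermx (newtonM 0 0))).
rewrite /bil shifted0 mul0r add0r => <-.
by rewrite -row_mul mulmx_ker row0 big1 // => j _; rewrite mxE mul0r.
Qed.

(** * Estimates for the residual and its derivative, uniform in e *)

Section estimates.
Variable B : R.
Hypothesis B1 : 1 <= B.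
Hypothesis hB : forall y, D y ->
  [/\ forall i j, `|hess T ub y i j| <= B,
      forall c i j, `|hess T (z c) y i j| <= B * `|c|,
      forall c i, `|partial i (z c) y| <= B * `|c| &
      forall c, `|z c y| <= B * `|c|].

Let B0 : 0 <= B. Proof. exact: le_trans ler01 B1. Qed.

Let W0 : 0 <= W. Proof. by rewrite fine_ge0. Qed.

Let delta_bound j : B * `|delta_mx ord0 j : X| <= B.
Proof. by rewrite ler_piMr //; exact: norm_delta. Qed.

Lemma basis_bound j y : D y ->
  [/\ forall i l, `|hess T (x j) y i l| <= B, forall i, `|partial i (x j) y| <= B & `|x j y| <= B].
Proof.
move=> Dy; have [_ h1 h2 h3] := hB Dy; have d1 := delta_bound j.
rewrite (basis_lincomb j); split => [i l|i|]; apply: le_trans d1; [exact: h1|exact: h2|exact: h3].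
Qed.

Lemma trace_bound (A : 'M[R]_n) (s : R) : (forall i j, `|A i j| <= s) -> `|\tr A| <= n%:R * s.
Proof.
move=> h; apply: le_trans (ler_norm_sum _ _ _) _.
apply: (@le_trans _ _ (\sum_(i < n) s)); first exact: ler_sum.
by rewrite sumr_const card_ord -[X in X <= _]mulr_natl.
Qed.

Lemma lap_pair_bound c j :
  `|integ (fun y => lap T (z c) y * lap T (x j) y)| <= n%:R * (B * `|c|) * (n%:R * B) * W.
Proof.
apply: (integ_bound mD fD).
  by apply: bmfM; [exact: (lap_bmf hD hT hV (V_lincomb c))|exact: (lap_bmf hD hT hV (Vx j))].
move=> y Dy; have [_ h1 _ _] := hB Dy; have [h2 _ _] := basis_bound j Dy.
by rewrite normrM; apply: ler_pM => //; apply: trace_bound; [exact: h1|exact: h2].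
Qed.

Lemma shifted_hess_bound c y i j : D y -> `|c| <= 1 -> `|hess T (U c) y i j| <= 2 * B.
Proof.
move=> Dy c1; have [h0 h1 _ _] := hB Dy.
rewrite (hess_add hD hT hV y Vub (V_lincomb c)).
rewrite -[X in `|X|]/((hess T ub y + hess T (z c) y) i j) mxE.
have h2 : B * `|c| <= B by rewrite ler_piMr.
apply: le_trans (ler_normD _ _) _; have -> : 2 * B = B + B by rewrite mulr_natl.
by apply: lerD; [exact: h0|exact: le_trans (h1 c i j) h2].
Qed.

Lemma shifted_hess_diff c c' y i j : D y ->
  `|hess T (U c') y i j - hess T (U c) y i j| <= B * `|c' - c|.
Proof.
move=> Dy; have [_ h1 _ _] := hB Dy.
have e : hess T (U c') y = hess T (U c) y + hess T (z (c' - c)) y.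
  by rewrite (shiftedD c c'); exact: (hess_add hD hT hV y (V_shifted c) (V_lincomb _)).
rewrite e -[X in `|X - _|]/((hess T (U c) y + hess T (z (c' - c)) y) i j) mxE.
have add_sub (p q : R) : p + q - p = q by ring.
by rewrite add_sub; exact: h1.
Qed.

Lemma newtonM_bound : exists2 K : R, 0 <= K & forall (e : R) (c y : X), 0 <= e <= 1 -> `|c| <= 1 ->
  `|y *m newtonM e c| <= K * `|y|.
Proof.
pose a := (n.-1)`!%:R * (2 * B) ^+ n.-1.
have B20 : 0 <= 2 * B by rewrite mulr_ge0.
have a0 : 0 <= a by rewrite mulr_ge0 // exprn_ge0.
have K0 : 0 <= n%:R * B * (n%:R * B) * W + n%:R * (n%:R * (a * B) * B) * W.
  by clearbody a; rewrite addr_ge0 // !mulr_ge0.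
exists (n%:R * B * (n%:R * B) * W + n%:R * (n%:R * (a * B) * B) * W) => //.
move=> e c y /andP[e0 e1] c1; apply: norm_le_coord => [|j]; first exact: mulr_ge0.
rewrite mul_newtonM /bil; apply: le_trans (ler_normD _ _) _; rewrite mulrDl; apply: lerD.
  rewrite normrM (ger0_norm e0); apply: le_trans (ler_piMl (normr_ge0 _) e1) _.
  by apply: le_trans (lap_pair_bound y j) _; rewrite le_eqVlt; apply/orP; left; apply/eqP; ring.
apply: (@le_trans _ _ (n%:R * (n%:R * (a * (B * `|y|)) * B) * W)); last first.
  by rewrite le_eqVlt; apply/orP; left; apply/eqP; ring.
apply: (integ_bound mD fD).
  exact: (cof_form_bmf hD hT hV (V_shifted c) (V_lincomb y) (Vx j)).
move=> w Dw; rewrite cof_formE; have [_ _ h2 _] := hB Dw; have [_ h3 _] := basis_bound j Dw.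
apply: bilinear_bound => [i l|l|i]; [|exact: h2|exact: h3].
by apply: cofactor_bound => // i' l'; exact: shifted_hess_bound.
Qed.

(** [K1] comes from the Laplacian term, which carries the factor e; [K2] from the cofactors,
    polynomial in the Hessian and so Lipschitz for |c| <= 1, where Hessian entries are at most 2 *
    B. *)
Lemma newtonM_lip : exists2 K : R, 0 <= K & forall (e : R) (c y : X), 0 <= e <= 1 -> `|c| <= 1 ->
  `|y *m newtonM e c - y *m newtonM 0 0| <= K * (e + `|c|) * `|y|.
Proof.
pose a := (n.-1)`!%:R * (n.-1%:R * (2 * B) ^+ n.-1).
have B20 : 0 <= 2 * B by rewrite mulr_ge0.
have a0 : 0 <= a by rewrite !mulr_ge0 // exprn_ge0.
pose K1 := n%:R * B * (n%:R * B) * W; pose K2 := n%:R * (n%:R * (a * B * B) * B) * W.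
have K10 : 0 <= K1 by rewrite !mulr_ge0.
have K20 : 0 <= K2 by rewrite /K2; clearbody a; rewrite !mulr_ge0.
exists (K1 + K2); first exact: addr_ge0.
move=> e c y /andP[e0 e1] c1; have cg := normr_ge0 c; have yg := normr_ge0 y.
apply: norm_le_coord => [|j]; first by rewrite !mulr_ge0 ?addr_ge0.
rewrite !mxE -[X in `|X - _|](_ : (y *m newtonM e c) ord0 j = _); last by rewrite mxE.
rewrite -[X in `|_ - X|](_ : (y *m newtonM 0 0) ord0 j = _); last by rewrite mxE.
have E1 := mul_newtonM e c y j; have E0 := mul_newtonM 0 0 y j; rewrite shifted0 in E0.
have alg (l q q0 : R) : e * l + q - (0 * l + q0) = e * l + (q - q0) by ring.
have E := etrans (congr2 (fun p q : R => p - q) E1 E0) (alg _ _ _).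
apply: (@le_trans _ _ (`|e * integ (fun w => lap T (z y) w * lap T (x j) w)| +
  `|integ (cof_form T (U c) (z y) (x j)) - integ (cof_form T ub (z y) (x j))|)).
  by apply: le_trans (ler_normD _ _); rewrite -E.
have h1 : `|e * integ (fun w => lap T (z y) w * lap T (x j) w)| <= K1 * e * `|y|.
  rewrite normrM (ger0_norm e0); apply: le_trans (ler_wpM2l e0 (lap_pair_bound y j)) _.
  by rewrite le_eqVlt; apply/orP; left; apply/eqP; rewrite /K1; ring.
suff h2 : `|integ (cof_form T (U c) (z y) (x j)) - integ (cof_form T ub (z y) (x j))| <= K2 * `|c| * `|y|.
  apply: le_trans (lerD h1 h2) _; rewrite -mulrDl ler_wpM2r //.
  by rewrite mulrDl; apply: lerD; rewrite ler_wpM2l // ?lerDl ?lerDr.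
have b1 := cof_form_bmf hD hT hV (V_shifted c) (V_lincomb y) (Vx j).
have b2 := cof_form_bmf hD hT hV Vub (V_lincomb y) (Vx j).
rewrite -(integB mD fD b1 b2).
apply: (@le_trans _ _ (n%:R * (n%:R * ((a * (B * `|c|)) * (B * `|y|)) * B) * W)); last first.
  by rewrite /K2 le_eqVlt; apply/orP; left; apply/eqP; ring.
apply: (integ_bound mD fD); first exact: bmfB.
move=> w Dw; rewrite !cof_formE; have [h0 _ h2 _] := hB Dw; have [_ h3 _] := basis_bound j Dw.
rewrite -sumrB (eq_bigr (fun i => (\sum_l (cofactor (hess T (U c) w) i l - cofactor (hess T ub w) i l) *
   partial l (z y) w) * partial i (x j) w)); last first.
  by move=> i _; rewrite -mulrBl -sumrB; congr (_ * _); apply: eq_bigr => l _; rewrite mulrBl.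
apply: bilinear_bound => [i l|l|i]; [|exact: h2|exact: h3].
apply: cofactor_lip => [|//|i' l'|i' l'|i' l'].
- by apply: le_trans B1 _; rewrite ler_peMl // ler1n.
- exact: mulr_ge0.
- by apply: le_trans (h0 i' l') _; rewrite ler_peMl // ler1n.
- exact: shifted_hess_bound.
- by have := shifted_hess_diff 0 c i' l' Dw; rewrite shifted0 subr0.
Qed.

(** The Laplacian term is linear in u and the data do not depend on it, so both cancel and the
    constant is independent of e. After integration by parts only the second order remainder of the
    determinant is left, tested against [x j]. *)
Lemma newtonF_taylor : exists2 K : R, 0 <= K & forall (e : R) (c c' : X), `|c| <= 1 -> `|c'| <= 1 ->
  `|newtonF e c' - newtonF e c - (c' - c) *m newtonM e c| <= K * `|c' - c| ^+ 2.
Proof.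
have [|C C0 hC] := @det_quadratic R n (2 * B) hn; first by apply: le_trans B1 _; rewrite ler_peMl // ler1n.
have K0 : 0 <= C * B ^+ 2 * B * W by repeat (apply: sqr_ge0 || apply: mulr_ge0).
exists (C * B ^+ 2 * B * W) => //.
move=> e c c' c1 c1'; apply: norm_le_coord => [|j]; first by rewrite mulr_ge0 // sqr_ge0.
pose dl := c' - c; rewrite -/dl.
have Vj := Vx j; have Vd := V_lincomb dl; have Vc := V_shifted c; have Vc' := V_shifted c'.
have hess' y : hess T (U c') y = hess T (U c) y + hess T (z dl) y.
  by rewrite (shiftedD c c'); exact: (hess_add hD hT hV y Vc Vd).
have i1 : integ (fun y => lap T (U c') y * lap T (x j) y) =
   integ (fun y => lap T (U c) y * lap T (x j) y) + integ (fun y => lap T (z dl) y * lap T (x j) y).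
  have := lap_linear_l hD hT hV Vj 1 Vc Vd; rewrite scale1r mul1r => <-.
  by rewrite -shiftedD.
have i2 := cof_form_by_parts hn hD hT hV Vc Vd Vj (Hx j).
have d1 := det_hess_bmf Vc; have d2 := det_hess_bmf Vc'.
have d3 := hess_pair_bmf hD hT hV Vc Vd; have bx := fe_bmf hD hT hV Vj.
have -> : (newtonF e c' - newtonF e c - dl *m newtonM e c) ord0 j =
   - integ (fun y => (\det (hess T (U c') y) - \det (hess T (U c) y) - hess_pair T (U c) (z dl) y) * x j y).
  have -> : integ (fun y => (\det (hess T (U c') y) - \det (hess T (U c) y) - hess_pair T (U c) (z dl) y) * x j y) =
     integ (fun y => \det (hess T (U c') y) * x j y) - integ (fun y => \det (hess T (U c) y) * x j y)
     - integ (fun y => hess_pair T (U c) (z dl) y * x j y).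
    rewrite -(integB mD fD (bmfM d2 bx) (bmfM d1 bx)).
    rewrite -(integB mD fD (bmfB (bmfM d2 bx) (bmfM d1 bx)) (bmfM d3 bx)).
    by apply: integ_eq => y _; rewrite !mulrBl.
  have -> : (newtonF e c' - newtonF e c - dl *m newtonM e c) ord0 j =
     residual e (U c') (x j) - residual e (U c) (x j) - bil e (U c) (z dl) (x j).
    by rewrite -mul_newtonM !mxE.
  have alg (l l' lz d1' d2' F fl q hp : R) : l' = l + lz -> q = - hp ->
      (e * l' - d2' + F - fl) - (e * l - d1' + F - fl) - (e * lz + q) = - (d2' - d1' - hp).
    by move=> -> ->; ring.
  exact: (alg _ _ _ _ _ _ _ _ _ i1 i2).
rewrite normrN; apply: (@le_trans _ _ (C * (B * `|dl|) ^+ 2 * B * W)); last first.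
  by rewrite le_eqVlt; apply/orP; left; apply/eqP; ring.
apply: (integ_bound mD fD).
  by apply: bmfM => //; apply: bmfB => //; exact: bmfB.
move=> y Dy; have [_ h1 _ _] := hB Dy; have [_ _ h3] := basis_bound j Dy.
rewrite normrM; apply: ler_pM => //; rewrite hess'.
apply: hC => [i l|i l|]; [exact: shifted_hess_bound|exact: h1|].
have hd : `|dl| <= 1 + 1 by apply: le_trans (ler_normB _ _) _; exact: lerD.
rewrite mulr_ge0 //=; apply: le_trans (ler_wpM2l B0 hd) _.
by rewrite mulrC ler_wpM2l // ler_peMl // ler1n.
Qed.

(** At [ub] the determinant and f cancel by the discrete Monge-Ampere equation; the rest carries e
    or e^3 <= e. *)
Lemma newtonF_zero : exists2 K : R, 0 <= K & forall e : R, 0 <= e <= 1 -> `|newtonF e 0| <= K * e.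
Proof.
pose a j := `|integ (fun y => lap T ub y * lap T (x j) y)| + `|flux D nu b (x j)|.
have a0 j : 0 <= a j by exact: addr_ge0.
exists (\sum_j a j); first exact: sumr_ge0.
move=> e /andP[e0 e1]; apply: norm_le_coord => [|j]; first by rewrite mulr_ge0 // sumr_ge0.
apply: (@le_trans _ _ (a j * e)); last first.
  by rewrite ler_wpM2r // (bigD1 j) //= lerDl sumr_ge0.
rewrite mxE shifted0 /residual.
have -> : integ (fun y => \det (hess T ub y) * x j y) = integ (fun y => f y * x j y).
  by rewrite -(ub_MA (Vx j) (Hx j)); apply: integ_eq => y _; exact: mulrC.
rewrite subrK; apply: le_trans (ler_normB _ _) _; rewrite /a mulrDl; apply: lerD.
  by rewrite normrM (ger0_norm e0) mulrC.
rewrite normrM mulrC ler_wpM2l // normrX (ger0_norm e0).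
by rewrite exprS ler_piMr // exprn_ile1.
Qed.

End estimates.

Hypothesis hspan : forall v, V v -> H10 D v -> exists c, v = z c.
Variable gh : E -> R.
Hypotheses (Vg : V gh) (ub_gh : eq_bnd D ub gh).

Lemma newton_constants : exists N0 K : R, [/\ 1 <= N0, 1 <= K,
  forall y : X, `|y| <= N0 * `|y *m newtonM 0 0|,
  forall (e : R) (c y : X), 0 <= e <= 1 -> `|c| <= 1 ->
    `|y *m newtonM e c - y *m newtonM 0 0| <= K * (e + `|c|) * `|y| /\ `|y *m newtonM e c| <= K * `|y| &
  (forall (e : R) (c c' : X), 0 <= e <= 1 -> `|c| <= 1 -> `|c'| <= 1 ->
    `|newtonF e c' - newtonF e c - (c' - c) *m newtonM e c| <= K * `|c' - c| ^+ 2) /\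
  forall e : R, 0 <= e <= 1 -> `|newtonF e 0| <= K * e].
Proof.
have [B B1 hB] := element_bounds; have [N0 N1 hN] := unitmx_norm_bound newtonM0_unit.
have [K1 k1 h1] := newtonM_bound B1 hB; have [K2 k2 h2] := newtonM_lip B1 hB.
have [K3 k3 h3] := newtonF_taylor B1 hB; have [K4 k4 h4] := newtonF_zero.
have K0 : 0 <= K1 + K2 + K3 + K4 by rewrite !addr_ge0.
have [l1 l2 l3 l4] := le_sum4 k1 k2 k3 k4.
exists N0, (1 + (K1 + K2 + K3 + K4)); split => //.
- by rewrite lerDl.
- move=> e c y he hc; split.
    apply: le_trans (h2 e c y he hc) _; rewrite ler_wpM2r // ler_wpM2r //.
      by have /andP[e0 _] := he; rewrite addr_ge0.
  by apply: le_trans (h1 e c y he hc) _; rewrite ler_wpM2r //; exact: l1.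
split.
- move=> e c c' _ hc hc'; apply: le_trans (h3 e c c' hc hc') _; rewrite ler_wpM2r ?sqr_ge0 //; exact: l3.
- move=> e he; apply: le_trans (h4 e he) _; have /andP[e0 _] := he; rewrite ler_wpM2r //; exact: l4.
Qed.

(* Coercivity of the cofactor form at [ub] bounds the coordinates by the H^1 norm. *)
Lemma coordinates_bound : exists2 C : R, 0 <= C &
  forall (c : X) (rho : R), 0 < rho -> energy D (z c) <= rho ^+ 2 -> `|c| <= C * rho.
Proof.
have [N0 N1 hN] := unitmx_norm_bound newtonM0_unit.
pose a j l y := \sum_i cofactor (hess T ub y) i l * partial i (x j) y.
have ha j l : bmf D (a j l).
  apply: bmf_sum => i _; apply: bmfM; first exact: (cofactor_hess_bmf hD hT hV).
  exact: (fe_partial_bmf hD hT hV).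
have hfun j := functional_bound oD bD (bmf_cst D 0) (ha j).
pose C j := s2val (cid2 (hfun j)).
have C0 j : 0 <= C j by exact: (s2valP (cid2 (hfun j))).
have hC j := s2valP' (cid2 (hfun j)).
have N00 : 0 <= N0 by exact: le_trans ler01 N1.
exists (N0 * \sum_j C j); first by rewrite mulr_ge0 // sumr_ge0.
move=> c rho r0 hc; apply: le_trans (hN c) _; rewrite -mulrA ler_wpM2l //.
apply: norm_le_coord => [|j]; first by rewrite mulr_ge0 ?sumr_ge0 // ltW.
have -> : (c *m newtonM 0 0) ord0 j = functional D (fun=> 0) (a j) (z c).
  rewrite mul_newtonM shifted0 /bil mul0r add0r; apply: integ_eq => y _.
  rewrite cof_formE mul0r add0r (eq_bigr (fun i => \sum_l cofactor (hess T ub y) i l * partial l (z c) y * partial i (x j) y)); last first.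
    by move=> i _; rewrite mulr_suml.
  rewrite exchange_big; apply: eq_bigr => l _; rewrite /a mulr_suml; apply: eq_bigr => i _.
  exact: mulrAC.
have nz := fe_nice hD hT hV (V_lincomb c).
apply: le_trans (hC j _ _ nz r0 hc) _.
by rewrite ler_wpM2r ?(ltW r0) // (bigD1 j) //= lerDl sumr_ge0.
Qed.

(** Converse of [coordinates_bound]: a zero with small coordinates lies in the H^1 ball. *)
Lemma energy_lincomb : exists2 C : R, 0 <= C & forall c : X, energy D (z c) <= (C * `|c|) ^+ 2.
Proof.
have [B B1 hB] := element_bounds.
pose q := #|{ffun 'I_n -> 'I_2}|%:R * W.
have q0 : 0 <= q by rewrite mulr_ge0 // fine_ge0.
have B0 : 0 <= B by exact: le_trans ler01 B1.
exists ((q + 1) * B); first by rewrite mulr_ge0 // addr_ge0.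
move=> c; have nz := fe_nice hD hT hV (V_lincomb c).
apply: (@le_trans _ _ (q * (B * `|c|) ^+ 2)).
  apply: energy_bound => //.
    by move=> y Dy; have [_ _ _ h] := hB y Dy; exact: h.
  by move=> i y Dy; have [_ _ h _] := hB y Dy; exact: h.
(* The factor q is replaced by the larger (q + 1)^2, a perfect square. *)
rewrite -[(q + 1) * B * _]mulrA [leRHS]exprMn ler_wpM2r ?sqr_ge0 //.
apply: (@le_trans _ _ (q + 1)); first by rewrite lerDl.
by rewrite expr2 ler_peMl ?lerDr // addr_ge0.
Qed.

Lemma shifted_boundary c : eq_bnd D (U c) gh.
Proof.
rewrite /eq_bnd; have -> : U c - gh = 1 *: (ub - gh) + z c by rewrite scale1r /shifted addrAC.
have n1 := fe_nice hD hT hV (fe_sub hV Vub Vg); have n2 := fe_nice hD hT hV (V_lincomb c).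
exact: (H10_lin oD cD bD 1 n1 n2 ub_gh (H10_lincomb c)).
Qed.

Lemma boundary_shifted v : V v -> eq_bnd D v gh -> exists c, v = U c.
Proof.
move=> Vv hv; have [||c hc] := hspan (v := v - ub).
- exact: (fe_sub hV).
- have -> : v - ub = (v - gh) - (ub - gh) by rewrite opprB addrA subrK.
  have n1 := fe_nice hD hT hV (fe_sub hV Vv Vg); have n2 := fe_nice hD hT hV (fe_sub hV Vub Vg).
  exact: (H10_sub oD cD bD n1 n2 hv ub_gh).
by exists c; rewrite /shifted -hc subrKC.
Qed.

Lemma regularizedP e c : regularized_solution D nu b f T V gh e (U c) <-> newtonF e c = 0.
Proof.
split => [[_ _ h]|h].
- apply/rowP => j; rewrite !mxE; apply/regularized_algebra; exact: h.
- split; [exact: V_shifted|exact: shifted_boundary|].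
  move=> v Vv Hv; apply/regularized_algebra; have [c' ->] := hspan Vv Hv.
  have := newtonF_test e c c'; rewrite h => /esym; rewrite /residual => ->.
  by rewrite big1 // => j _; rewrite mxE mul0r.
Qed.

(* The right-hand side factor (n-1)/n makes the fixed point iteration a Newton step:
   int (cof D^2u Du).Dv = - n int det D^2u v. *)
Lemma next_equation e c c' v : V v -> H10 D v ->
  (e * integ (fun y => lap T (U c') y * lap T v y) + integ (cof_form T (U c) (U c') v) =
    - integ (fun y => f y * v y) + e ^+ 3 * flux D nu b v
      + (n%:R - 1) / n%:R * integ (cof_form T (U c) (U c) v)) <->
  bil e (U c) (z (c' - c)) v = - residual e (U c) v.
Proof.
move=> Vv Hv; have Vc := V_shifted c; have Vz := V_lincomb (c' - c).
have n0 : n%:R != 0 :> R by case: hn => ->.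
have i1 := lap_linear_l hD hT hV Vv 1 Vz Vc; rewrite scale1r mul1r addrC -shiftedD in i1.
have i2 := cof_form_linear_mid hD hT hV Vc Vv 1 Vz Vc; rewrite scale1r mul1r addrC -shiftedD in i2.
have i3 : integ (cof_form T (U c) (U c) v) = - (n%:R * integ (fun y => \det (hess T (U c) y) * v y)).
  rewrite (cof_form_by_parts hn hD hT hV Vc Vc Vv Hv); congr (- _).
  rewrite -(integZ mD fD _ (bmfM (det_hess_bmf Vc) (fe_bmf hD hT hV Vv))).
  by apply: integ_eq => y _; rewrite hess_pair_diag mulrA.
exact: (iterate_algebra _ _ _ n0 i1 i2 i3).
Qed.

Lemma next_iterateP e c c' : next_iterate D nu b f T V gh e (U c) (U c') <->
  (c' - c) *m newtonM e c = - newtonF e c.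
Proof.
split => [[_ _ h]|h].
- apply/rowP => j; have := proj1 (next_equation e c c' (Vx j) (Hx j)) (h _ (Vx j) (Hx j)).
  by rewrite -mul_newtonM => ->; rewrite !mxE.
- split; [exact: V_shifted|exact: shifted_boundary|].
  move=> v Vv Hv; apply/(next_equation e c c' Vv Hv); have [y ->] := hspan Vv Hv.
  have := newtonM_test e c (c' - c) y; rewrite h => <-.
  have := newtonF_test e c y => <-; rewrite -sumrN.
  by apply: eq_bigr => j _; rewrite mxE mulNr.
Qed.

(** By the triangle inequality any norm on V is at most the coordinate norm times the sum of its
    values on the basis. *)
Lemma shifted_cvg (cs : nat -> X) (l : X) : cs @ \oo --> l -> cvg_in V (fun i => U (cs i)) (U l).
Proof.
move=> hc Nm [h0 _ hZ hD'].
have nb c : Nm (z c) <= `|c| * \sum_j Nm (x j).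
  suff [_] : V (z c) /\ Nm (z c) <= \sum_j `|c| * Nm (x j) by rewrite -mulr_sumr.
  rewrite /lincomb; elim: (index_enum _) => [|i s [IH1 IH2]].
    rewrite !big_nil; split; first exact: (fe_zero hV).
    by have := hZ 0 0 (fe_zero hV); rewrite scale0r normr0 mul0r => ->.
  rewrite !big_cons; split; first exact: (fe_lin hV).
  apply: le_trans (hD' _ _ (fe_scale hV _ (Vx i)) IH1) _; apply: lerD => //.
  by rewrite hZ // ler_wpM2r ?h0 //; exact: le_coord_norm.
have e i : U (cs i) - U l = z (cs i - l) by rewrite (shiftedD l (cs i)) addrAC subrr add0r.
have up : (fun i => `|cs i - l| * \sum_j Nm (x j)) @ \oo --> 0.
  have hn0 : (fun i => `|cs i - l|) @ \oo --> (0 : R).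
    have : (fun i => `|cs i - l|) @ \oo --> `|l - l|.
      by apply: cvg_norm; apply: cvgB => //; exact: cvg_cst.
    by rewrite subrr normr0.
  have := cvgM hn0 (cvg_cst (\sum_j Nm (x j))); rewrite mul0r; exact.
apply: (squeeze_cvgr _ (cvg_cst 0) up).
apply: nearW => i; rewrite e nb andbT; apply: h0; exact: V_lincomb.
Qed.

Theorem regularized_newton :
  exists2 rho0 : R, 0 < rho0 & forall rho : R, 0 < rho <= rho0 ->
  exists2 eps0 : R, 0 < eps0 & forall eps : R, 0 < eps <= eps0 ->
  exists u : E -> R,
    unique (fun w => ball_in V D ub rho w /\ regularized_solution D nu b f T V gh eps w) u /\
    forall u0, ball_in V D ub rho u0 -> eq_bnd D u0 gh ->
    exists us : nat -> E -> R,
      [/\ us 0%N = u0,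
          forall i, unique (next_iterate D nu b f T V gh eps (us i)) (us i.+1) &
          cvg_in V us u].
Proof.
have [N0 [K [N1 K1 hM0 hM [hT' hF0]]]] := newton_constants.
have [Cb Cb0 hCb] := coordinates_bound; have [Ce Ce0 hCe] := energy_lincomb.
have hMl e c y he hc := proj1 (hM e c y he hc).
have hMb e c y he hc := proj2 (hM e c y he hc).
pose r := newton_radius N0 K; pose rs := newton_start N0 K.
have rs0 : 0 < rs by exact: newton_start_gt0.
have rsr : rs <= r.
  apply: le_trans (newton_rsr N1 K1) _; have r0 := ltW (newton_radius_gt0 N1 K1).
  by rewrite ler_piMr // invf_le1 // ler1n.
have Cb1 : 0 < Cb + 1 by apply: ltr_wpDl.
(* The H^1 ball of this radius lies in the coordinate ball of radius [rs], where Newton's method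
   converges; the added 1 allows [Cb] = 0. *)
exists (rs / (Cb + 1)); first exact: divr_gt0.
move=> rho /andP[rho_gt0 hrho].
have Cb_rho : Cb * rho <= rs.
  apply: (@le_trans _ _ ((Cb + 1) * rho)); first by rewrite ler_wpM2r ?lerDl // ltW.
  by rewrite mulrC -ler_pdivlMr.
have P0 : 0 < 4 * N0 * K * (Ce + 1).
  rewrite !mulr_gt0 //; [exact: lt_le_trans N1|exact: lt_le_trans K1|exact: ltr_wpDl].
have ball_coord w : V w -> eq_bnd D w gh -> (snorm D 1 2%:E (w - ub)%R <= rho%:E)%E ->
    exists2 c, w = U c & `|c| <= rs.
  move=> Vw bw sw; have [c wc] := boundary_shifted Vw bw; exists c => //.
  apply: le_trans Cb_rho; apply: hCb => //.
  have -> : z c = w - ub by rewrite wc /shifted addrAC subrr add0r.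
  by apply/(snorm_le oD cD bD _ (ltW rho_gt0)) => //; apply: (fe_nice hD hT hV); exact: (fe_sub hV).
(* The first bound admits eps in the Newton theorem; the second makes the H^1 distance of the zero
   to [ub], at most Ce * 4 N0 K eps, no larger than rho. *)
exists (Num.min rs (rho / (4 * N0 * K * (Ce + 1)))); first by rewrite lt_min rs0 divr_gt0.
move=> eps /andP[eps_gt0]; rewrite le_min => /andP[eps_rs eps_rho].
have he : 0 <= eps <= rs by rewrite ltW.
have her : 0 <= eps <= r by rewrite ltW //=; exact: le_trans eps_rs rsr.
have [l [Fl l_eps lr hl]] := newton_theorem N1 K1 hM0 hMl hMb hT' hF0 he.
have [hu1 hu2] := (fun c => @newton_unique R k newtonF newtonM N0 K N1 K1 hM0 hMl hT' eps l c her lr,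
  fun c => @newton_unit R k newtonM N0 K N1 K1 hM0 hMl eps c her).
exists (U l); split; last first.
  move=> u0 [Vu0 su0] bu0; have [c0 -> c0rs] := ball_coord u0 Vu0 bu0 su0.
  have [cl cr] := hl c0 c0rs.
  exists (fun i => U (newton_seq newtonF newtonM eps c0 i)); split; [by []| |exact: shifted_cvg].
  move=> i; set c := newton_seq _ _ _ _ i; have cr' := cr i.
  have st := @newton_stepP R k newtonF newtonM N0 K N1 K1 hM0 hMl eps c her cr'.
  split; first by apply/next_iterateP.
  move=> w hw; have [Vw bw _] := hw; have [c' wc] := boundary_shifted Vw bw.
  rewrite wc in hw *; congr U; have /next_iterateP e := hw.
  (* Uniqueness of the next iterate is invertibility of the derivative, valid because all iterates
     remain within r. *)
  have uM := hu2 c cr'; apply: (addIr (- c)); apply: (can_inj (mulmxK uM)).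
  by rewrite e; exact: st.
split.
- split; last by apply/regularizedP.
  split; first exact: V_shifted.
  have -> : U l - ub = z l by rewrite /shifted addrAC subrr add0r.
  apply/(snorm_le oD cD bD _ (ltW rho_gt0)); first by apply: (fe_nice hD hT hV); exact: V_lincomb.
  apply: le_trans (hCe l) _; rewrite ler_pXn2r ?nnegrE ?mulr_ge0 // ?(ltW rho_gt0) //.
  apply: (@le_trans _ _ ((Ce + 1) * (4 * N0 * K * eps))).
    by apply: ler_pM => //; rewrite lerDl.
  have -> : (Ce + 1) * (4 * N0 * K * eps) = eps * (4 * N0 * K * (Ce + 1)) by ring.
  by rewrite -ler_pdivlMr.
- move=> w [[Vw sw] hw]; have [_ bw _] := hw; have [c wc crs] := ball_coord w Vw bw sw.
  have Fc : newtonF eps c = 0 by apply/regularizedP; rewrite -wc.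
  by rewrite wc -(hu1 c (le_trans crs rsr) Fl Fc).
Qed.

End discrete_newton.

Theorem mainTheorem2
  (R : realType) (n : nat) (hn : n = 2%N \/ n = 3%N)
  (* the domain *)
  (Omega : set 'rV[R]_n) (m : nat) (nu : 'I_m -> 'rV[R]_n) (b : 'I_m -> R)
  (hOmega : polyhedral_domain Omega nu b)
  (* the data *)
  (f : 'rV[R]_n -> R) (c0 : R) (hc0 : 0 < c0)
  (hf : (vol R n).-integrable Omega (EFin \o f))
  (hfc0 : {ae vol R n, forall x, Omega x -> c0 <= f x})
  (g G : 'rV[R]_n -> R) (hG : smooth G)
  (hg : forall x, (closure Omega `\` Omega) x -> G x = g x)
  (* the approximation spaces; H is the set of mesh parameters *)
  (d : nat) (hd : (2 <= d)%N)
  (H : set R) (hH : forall h, H h -> 0 < h)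
  (N : R -> nat) (T : forall h, 'I_(N h) -> set 'rV[R]_n)
  (hT : forall h, H h -> mesh Omega (T h))
  (V : R -> set ('rV[R]_n -> R))
  (hV : forall h, H h -> fe_space Omega d (T h) (V h))
  (Ih : R -> ('rV[R]_n -> R) -> ('rV[R]_n -> R))
  (hI : interpolation Omega H T V d Ih)
  (hinv : inverse_estimates H T V)
  (* the discrete Monge-Ampere solutions *)
  (uh : R -> 'rV[R]_n -> R)
  (huh : forall h, H h -> MA_solution Omega f (T h) (V h) (Ih h G) (uh h))
  (hconv : forall h, H h -> strictly_convex Omega (uh h))
  (C0 C4 : R) (hC0 : 0 < C0)
  (heig : forall h, H h -> forall j x, T h j x ->
     forall a : R, eigenvalue (hess (T h) (uh h) x) a -> 2 * C0 <= a <= C4) :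
  exists2 h0 : R, 0 < h0 & forall h, H h -> h <= h0 ->
  exists2 rho0 : R, 0 < rho0 & forall rho : R, 0 < rho <= rho0 ->
  exists2 eps0 : R, 0 < eps0 & forall eps : R, 0 < eps <= eps0 ->
  exists u : 'rV[R]_n -> R,
    unique (fun w => ball_in (V h) Omega (uh h) rho w /\
                     regularized_solution Omega nu b f (T h) (V h) (Ih h G) eps w) u /\
    forall u0, ball_in (V h) Omega (uh h) rho u0 -> eq_bnd Omega u0 (Ih h G) ->
    exists us : nat -> 'rV[R]_n -> R,
      [/\ us 0%N = u0,
          forall k, unique (next_iterate Omega nu b f (T h) (V h) (Ih h G) eps (us k))
                           (us k.+1) &
          cvg_in (V h) us u].
Proof.
(* The constants may depend on h, so any positive bound on h can be given. *)
exists 1 => // h Hh _.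
have hD := hOmega; have mT := hT h Hh; have fV := hV h Hh.
have [Vu bu MA] := huh h Hh.
have eig j x : T h j x -> forall a : R, eigenvalue (hess (T h) (uh h) x) a -> 0 < a.
  move=> Tx a ha; have /andP[h1 _] := heig h Hh j x Tx a ha.
  by apply: lt_le_trans h1; rewrite mulr_gt0.
have nG : nice Omega G := smooth_nice (domain_convex hD) (pd_bounded hD) hG.
have SG := nice_Sobolev (domain_open hD) (domain_convex hD) (pd_bounded hD) nG.
have one_le2 : (1 <= 2%:E :> \bar R)%E by rewrite lee_fin ler1n.
(* G is in W^{1,2}, so the interpolation property with l = 0 and p = 2 places the discrete boundary
   datum in V_h. *)
have [Vg _] := (proj1 hI) h 0%N 2%:E G Hh (leq0n d) one_le2 SG.
pose X := [set v | V h v /\ H10 Omega v].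
have Xlin a v w : X v -> X w -> X (a *: v + w).
  move=> [Vv Hv] [Vw Hw]; split; first exact: (fe_lin fV).
  exact: (H10_lin (domain_open hD) (domain_convex hD) (pd_bounded hD) _
    (fe_nice hD mT fV Vv) (fe_nice hD mT fV Vw) Hv Hw).
have [M [e eV]] := proj1 fV.
have Xe v : X v -> exists c : 'I_M -> R, v = \sum_j c j *: e j by rewrite /X /= eV => -[].
(* Coordinates are taken in the homogeneous space V_h meet H^1_0, over which solutions with the
   given boundary values form an affine space through u_h. *)
have [k [x [Xx span ind]]] := finite_basis Xlin Xe.
apply: (@regularized_newton R n hn Omega m nu b hD (N h) (T h) mT d (V h) fV f hf (uh h) Vu eig MA
  k x (fun i => proj1 (Xx i)) (fun i => proj2 (Xx i)) ind _ (Ih h G) Vg bu).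
by move=> v Vv Hv; exact: span.
Qed.
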